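(* Let $\beta\in[0,1)$ and let $U:\mathbb{R}^d\to\mathbb{R}$ satisfy: (i) $U$ is twice continuously differentiable, $\nabla U(0)=0$, and $\sup_x\|\mathrm{D}^2U(x)\|\le\mathtt{L}$ for some $\mathtt{L}\ge0$; (ii) $U$ is three times continuously differentiable and $\sup_x\|\mathrm{D}^3U(x)\|\le\mathtt{M}$ for some $\mathtt{M}\ge0$; (iii) there exist $\mathtt{m}_\beta>0$ and $\mathtt{L}_\beta,\mathtt{K}_\beta\ge0$ such that for all $\|x\|\ge\mathtt{K}_\beta$, $\|y\|=1$, $\frac{\mathtt{L}_\beta}{1+\|x\|^{3\beta/4}}\ge\mathrm{D}^2U(x)[y,y]\ge\frac{\mathtt{m}_\beta}{1+\|x\|^\beta}$. Let $\bar\eta_\beta=\mathtt{m}_\beta/2^5$ and $W_{\bar\eta_\beta}(x)=\exp\{\bar\eta_\beta(1+\|x\|^2)^{1/2}\}$. Then there exist $\bar\Gamma_\beta>0$ and $\bar A_\beta>0$ with $\pi(W_{\bar\eta_\beta})\le\bar A_\beta$ such that for every $\bar\gamma\in(0,\bar\Gamma_\beta]$ there exist $C_{\bar\gamma,\beta}\ge0$, $\rho_{\bar\gamma,\beta}\in[0,1)$ such that for all $x\in\mathbb{R}^d$, $\gamma\in(0,\bar\gamma]$ and $k\in\mathbb{N}$, $$\|\delta_xR_\gamma^k-\pi\|_{W_{\bar\eta_\beta}}\le C_{\bar\gamma,\beta}\rho_{\bar\gamma,\beta}^{\gamma k}\{W_{\bar\eta_\beta}(x)+\pi(W_{\ba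r\eta_\beta})\}.$$
   Context: $\pi$ denotes the probability density proportional to $e^{-U}$ and the associated measure. For $\gamma>0$, $r_\gamma(x,y)=(4\pi\gamma)^{-d/2}\exp(-\|y-x+\gamma\nabla U(x)\|^2/(4\gamma))$, $\alpha_\gamma(x,y)=1\wedge\frac{\pi(y)r_\gamma(y,x)}{\pi(x)r_\gamma(x,y)}$, and the MALA kernel is $R_\gamma(x,A)=\int\mathbb{1}_A(y)\alpha_\gamma(x,y)r_\gamma(x,y)dy+\delta_x(A)\int\{1-\alpha_\gamma(x,y)\}r_\gamma(x,y)dy$. For $V\ge1$ measurable and a finite signed measure $\mu$, $\|\mu\|_V=\sup\{|\int fd\mu|:\sup_x|f(x)|/V(x)\le1\}$. *)

(* Defs.v *)
From HB Require Import structures.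
From mathcomp Require Import all_boot all_order all_algebra.
From mathcomp Require Import all_classical all_reals all_analysis.
Set Implicit Arguments. Unset Strict Implicit. Unset Printing Implicit Defensive.
Import Order.TTheory GRing.Theory Num.Theory.
Import numFieldNormedType.Exports.
Local Open Scope classical_set_scope.
Local Open Scope ring_scope.

Section defs.
Variables (R : realType) (d : nat).

Definition Rd : Type := g_sigma_algebraType (@open 'rV[R]_d).
Definition Rd_measurableType : measurableType _ := Rd.

Definition dotR (x y : 'rV[R]_d) : R := \sum_(i < d) x ord0 i * y ord0 i.
Definition enorm (x : 'rV[R]_d) : R := Num.sqrt (dotR x x).

Definition bilin (H : 'M[R]_d) (y z : 'rV[R]_d) : R := (y *m H *m z^T) ord0 ord0.

Definition is_lebesgue (mu : {measure set Rd -> \bar R}) : Prop :=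
  forall a b : 'rV[R]_d, (forall i, a ord0 i <= b ord0 i) ->
    mu [set x : Rd | forall i, a ord0 i <= (x : 'rV[R]_d) ord0 i <= b ord0 i]
    = (\prod_(i < d) (b ord0 i - a ord0 i))%:E.

Variables (mu : {measure set Rd -> \bar R}) (U : 'rV[R]_d -> R).

Definition Zpi : R := fine (\int[mu]_(x in setT) (expR (- U (x : 'rV[R]_d)))%:E)%E.
Definition pidens (x : 'rV[R]_d) : R := expR (- U x) / Zpi.

Definition pi_int (f : 'rV[R]_d -> R) : \bar R :=
  (\int[mu]_(x in setT) (f (x : 'rV[R]_d) * pidens x)%:E)%E.

Variable gradU : 'rV[R]_d -> 'rV[R]_d.

Definition r_prop (gamma : R) (x y : 'rV[R]_d) : R :=
  powR (4 * pi * gamma) (- (d%:R / 2)) *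
  expR (- (enorm (y - x + gamma *: gradU x) ^+ 2) / (4 * gamma)).

Definition alpha_acc (gamma : R) (x y : 'rV[R]_d) : R :=
  Num.min 1 ((pidens y * r_prop gamma y x) / (pidens x * r_prop gamma x y)).

(* action of the MALA kernel R_gamma on a function f: (R_gamma f)(x) = int f(y) R_gamma(x,dy) *)
Definition mala_op (gamma : R) (f : 'rV[R]_d -> R) (x : 'rV[R]_d) : R :=
  Rintegral mu setT (fun y : Rd => f y * alpha_acc gamma x y * r_prop gamma x y)
  + f x * Rintegral mu setT (fun y : Rd => (1 - alpha_acc gamma x y) * r_prop gamma x y).

Definition Vdist (V : 'rV[R]_d -> R) (gamma : R) (k : nat) (x : 'rV[R]_d) : \bar R :=
  ereal_sup [set (`| iter k (mala_op gamma) f x - fine (pi_int f) |)%:E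
            | f in [set f : 'rV[R]_d -> R |
                      measurable_fun (setT : set Rd) (f : Rd -> R) /\
                      forall z, `|f z| <= V z]].
End defs.

(* Main.v *)
(* One kernel step contracts a distance, and invariance of [pi] does the rest. Write [W] for the Lyapunov function,
   [Q] for the Gaussian proposal and [rho(x,y) = 2 - exp(-lam |x-y|) + ep (W x + W y)] for [x <> y]; the aim is that
   [|f x - f y| <= K rho(x,y)] for all [x <> y] implies the same bound for [R f] with [K (1 - c gamma)].
   - [Q f x - Q f y] is estimated by integrating [f(u) - f(u')] against the difference of the two Gaussian densities on
     a half space, [u'] being the mirror image of [u] in the bisector of the two means (reflection coupling). The concave
     profile [2 - exp(-lam r)] gains [lam^2 exp(-lam r) gamma] from the variance of the noise, which beats the expansion
     [1 + L gamma] of the gradient step as long as [r] is bounded by a fixed multiple of [lam / L].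
   - [R f - Q f] is bounded through the rejection probability: it is [O(gamma^(3/2) (1+|x|)^3)] (trapezoidal rule and the
     bound on the third derivative); far from the origin, the two-sided Hessian bounds make the log acceptance ratio at
     least [- C |w|^2], [w] being the noise, so that the [W]-weighted cost of a rejection is [O(gamma W x)]. As
     [<x, grad U x> / |x|] tends to infinity, [Q W] has a drift that absorbs this cost, and [W x + W y] controls the
     pairs for which the coupling does not contract.
   - [pi] is invariant because [(f y - f x) pi(x) r(x,y) alpha(x,y)] is antisymmetric; integrating the contraction in [y]
     against [pi] gives the theorem with rate [exp(-c)]. *)
Require Import Defs.
From HB Require Import structures.
From mathcomp Require Import all_boot all_order all_algebra.
From mathcomp Require Import all_classical all_reals all_analysis.
From mathcomp Require Import measurable_realfun ring lra.
Import Order.TTheory GRing.Theory Num.Theory.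
Import numFieldNormedType.Exports.
Local Open Scope classical_set_scope.
Local Open Scope ring_scope.

(** * Borel sets and Lebesgue measure on row vectors *)

(** The curvature may decay like [powR (enorm x) (- beta)], so no uniform contraction of the
    gradient step is available, and distant pairs can only be handled through [W]. The value 1 of
    the profile at [0+] is what makes the coupling work: after reflection the signed distance [s] is
    Gaussian and may be negative, and for [s < 0] the odd function [sg s * (1 - exp(- lam |s|))]
    exceeds [1 - exp(- lam s)], whose mean is explicit. With the extra unit the comparison holds as
    long as [lam |s| <= 1], and the rest is a rare event. The exponent [3 * beta / 4] enters through
    its double: since [3 * beta / 2 >= beta], the square of the upper Hessian bound is at most a
    multiple of the lower one, uniformly far from the origin. This is what lets the noise alone
    control the log acceptance ratio. The constants are fixed in the order [b] (drift), [D]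
    (distance), [lam], [q] (gain of the profile), [ep], and then the step [g0]. There is no circle,
    because the drift of [W] involves neither [lam] nor [ep]. *)

Section borel_rV.
Context {R : realType} {d : nat}.

Definition cbox (a b : 'rV[R]_d) : set (Rd R d) :=
  [set x : Rd R d | forall i, a ord0 i <= (x : 'rV[R]_d) ord0 i <= b ord0 i].

Definition cboxes : set (set (Rd R d)) := [set A | exists a b, A = cbox a b].

(** An open set is the union of the closed boxes with rational corners that it contains. The pairs
    of corners are enumerated by [unpickle]; codes without meaning and boxes that leave [U]
    contribute the empty set. *)
Lemma open_sub_cboxes (U : set 'rV[R]_d) : open U -> <<s cboxes >> U.
Proof.
move=> Uo.
pose F (n : nat) : set (Rd R d) :=
  if (unpickle n : option ('rV[rat]_d * 'rV[rat]_d)) is Some p then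
    let B := cbox (map_mx ratr p.1) (map_mx ratr p.2) in
    if `[< B `<=` U >] then B else set0
  else set0.
have -> : U = \bigcup_n F n.
  apply/seteqP; split => [x Ux|x [n _]]; last first.
    rewrite /F; case: unpickle => [p|//].
    by case: ifPn => // /asboolP; apply.
  have /nbhs_ballP[e /= e0 xeU] : nbhs x U by exact: open_nbhs_nbhs.
  have ha i : {q : rat | ratr q \in `]x ord0 i - e, x ord0 i[}.
    by apply/cid/rat_in_itvoo; rewrite ltrBlDr ltrDl.
  have hb i : {q : rat | ratr q \in `]x ord0 i, x ord0 i + e[}.
    by apply/cid/rat_in_itvoo; rewrite ltrDl.
  exists (pickle ((\row_i projT1 (ha i), \row_i projT1 (hb i)) : 'rV[rat]_d * 'rV[rat]_d)) => //.
  rewrite /F pickleK /= ifT; last first.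
    apply/asboolP => y /= yB; apply: xeU; split => // i j.
    rewrite (ord1 i); move: (yB j); rewrite !mxE.
    case: (ha j) => /= p /itvP hp; case: (hb j) => /= q /itvP hq.
    move=> /andP[py yq]; rewrite /ball /= ltr_distlC; apply/andP; split.
      by rewrite (lt_le_trans _ py) // hp.
    by rewrite (le_lt_trans yq) // hq.
  move=> i; rewrite !mxE.
  case: (ha i) => /= p /itvP hp; case: (hb i) => /= q /itvP hq.
  by rewrite !ltW ?hp ?hq.
have [_ _ sU] := @smallest_sigma_algebra _ setT cboxes.
have [s0 _ _] := @smallest_sigma_algebra _ setT cboxes.
apply: sU => n; rewrite /F; case: unpickle => [p|//].
case: ifPn => // _.
by apply: sub_sigma_algebra; exists (map_mx ratr p.1), (map_mx ratr p.2).
Qed.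

Lemma measurable_Rd_cboxes : @measurable _ (Rd R d) `<=` <<s cboxes >>.
Proof.
apply: smallest_sub; first exact: smallest_sigma_algebra.
exact: open_sub_cboxes.
Qed.

Lemma open_measurable_Rd (A : set 'rV[R]_d) : open A -> @measurable _ (Rd R d) A.
Proof. by move=> Ao; apply: sub_sigma_algebra. Qed.

Lemma continuous_measurable_Rd (f : 'rV[R]_d -> R) :
  continuous f -> measurable_fun (setT : set (Rd R d)) (f : Rd R d -> R).
Proof.
move=> cf; apply: (measurability (@RGenOpens.G R)); first exact: RGenOpens.measurableE.
move=> _ [_ [a [b ->] <-]]; rewrite setTI.
apply: open_measurable_Rd.
by apply: open_comp => // x _; exact: cf.
Qed.

Lemma measurable_coord (i : 'I_d) :
  measurable_fun (setT : set (Rd R d)) (fun x : Rd R d => (x : 'rV[R]_d) ord0 i).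
Proof. by apply: continuous_measurable_Rd => x; exact: coord_continuous. Qed.

Lemma cboxE {T} (f : T -> 'rV[R]_d) (a b : 'rV[R]_d) :
  f @^-1` cbox a b =
  \bigcap_(i in [set: 'I_d]) ((fun t => f t ord0 i) @^-1` `[a ord0 i, b ord0 i]).
Proof.
apply/seteqP; split => x /=.
  by move=> h i _; rewrite /= in_itv /=; exact: h.
by move=> h i; have := h i I; rewrite /= in_itv.
Qed.

Lemma measurable_preimage_cbox {d'} {T : measurableType d'} (f : T -> 'rV[R]_d) a b :
  (forall i, measurable_fun setT (fun t => f t ord0 i)) ->
  measurable (f @^-1` cbox a b).
Proof.
move=> mf; rewrite cboxE; apply: fin_bigcap_measurable; first exact: finite_finset.
move=> i _; rewrite -[X in measurable X]setTI.
by apply: mf => //; exact: measurable_itv.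
Qed.

Lemma measurable_cbox a b : measurable (cbox a b).
Proof. exact: (@measurable_preimage_cbox _ _ (fun x : Rd R d => x) _ _ measurable_coord). Qed.

Lemma measurable_RdE : @measurable _ (Rd R d) = <<s cboxes >>.
Proof.
apply/seteqP; split; first exact: measurable_Rd_cboxes.
apply: smallest_sub; first exact: sigma_algebra_measurable.
by move=> _ [a [b ->]]; exact: measurable_cbox.
Qed.

Lemma measurable_fun_Rd {d'} {T : measurableType d'} (f : T -> Rd R d) :
  (forall i, measurable_fun setT (fun t => (f t : 'rV[R]_d) ord0 i)) ->
  measurable_fun setT f.
Proof.
move=> mf; apply: (measurability cboxes); first exact: measurable_RdE.
move=> _ [_ [a [b ->]] <-]; rewrite setTI.
exact: measurable_preimage_cbox.
Qed.

Lemma cboxes_setI : setI_closed cboxes.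
Proof.
move=> _ _ [a [b ->]] [a' [b' ->]].
exists (\row_i Num.max (a ord0 i) (a' ord0 i)), (\row_i Num.min (b ord0 i) (b' ord0 i)).
apply/seteqP; split => x /=.
  move=> [h h'] i; rewrite !mxE ge_max le_min.
  by case/andP: (h i) => -> ->; case/andP: (h' i) => -> ->.
move=> h; split => i; have := h i; rewrite !mxE ge_max le_min.
  by case/andP => /andP[-> _] /andP[-> _].
by case/andP => /andP[_ ->] /andP[_ ->].
Qed.

Lemma cboxes_cover :
  \bigcup_n cbox (const_mx (- n%:R)) (const_mx n%:R) = [set: Rd R d].
Proof.
apply/seteqP; split => // x _.
have [n hn] : exists n : nat, forall i, `|(x : 'rV[R]_d) ord0 i| <= n%:R.
  exists (Num.truncn (\sum_i `|(x : 'rV[R]_d) ord0 i|)).+1 => i.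
  apply: le_trans (ltW (truncnS_gt _)).
  by rewrite (bigD1 i) //= lerDl sumr_ge0.
by exists n => // i; rewrite !mxE -ler_norml; exact: hn.
Qed.

Lemma cbox_eq0 (a b : 'rV[R]_d) : (exists i, b ord0 i < a ord0 i) -> cbox a b = set0.
Proof.
move=> [i ba]; apply/seteqP; split => // x /(_ i) /andP[h1 h2].
by have := le_lt_trans (le_trans h1 h2) ba; rewrite ltxx.
Qed.

Section lebesgue_rV.
Variables (mu : {measure set Rd R d -> \bar R}) (Hmu : is_lebesgue mu).

Lemma lebesgue_cbox_fin a b : (mu (cbox a b) < +oo)%E.
Proof.
have [/existsP/cbox_eq0 ->|] := boolP [exists i, b ord0 i < a ord0 i].
  by rewrite measure0.
rewrite negb_exists => /forallP h; rewrite /cbox Hmu ?ltry //.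
by move=> i; rewrite leNgt.
Qed.

(** Closed boxes are stable under intersection, generate the Borel sets, have finite measure and
    exhaust the space, so the values on boxes determine the measure. *)
Lemma lebesgue_unique (nu : {measure set Rd R d -> \bar R}) :
  is_lebesgue nu -> forall A, measurable A -> mu A = nu A.
Proof.
move=> Hnu A mA.
apply: (measure_unique cboxes (fun n : nat => cbox (const_mx (- n%:R)) (const_mx n%:R))) => //.
- exact: measurable_RdE.
- exact: cboxes_setI.
- by move=> i; eexists; eexists; reflexivity.
- exact: cboxes_cover.
- move=> _ [a [b ->]].
  have [/existsP/cbox_eq0 ->|] := boolP [exists i, b ord0 i < a ord0 i].
    by rewrite !measure0.
  rewrite negb_exists => /forallP h; rewrite /cbox Hmu ?Hnu //.
    by move=> i; rewrite leNgt.
  by move=> i; rewrite leNgt.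
- by move=> k; exact: lebesgue_cbox_fin.
Qed.

Lemma lebesgue_sigma_finite : sigma_finite setT mu.
Proof.
exists (fun n : nat => cbox (const_mx (- n%:R)) (const_mx n%:R)).
  by rewrite cboxes_cover.
by move=> n; split; [exact: measurable_cbox|exact: lebesgue_cbox_fin].
Qed.

End lebesgue_rV.
End borel_rV.

(** * Fubini and translation invariance for Lebesgue measure *)

Section lebesgue_invariance.
Context {R : realType} {d : nat}.
Variables (mu : {measure set Rd R d -> \bar R}) (Hmu : is_lebesgue mu).

(** A copy of [mu] that carries the proof [Hmu], so that the sigma-finite structure required by
    Fubini can be attached to it. *)
Definition lebesgue_sf of is_lebesgue mu : set (Rd R d) -> \bar R := mu.
HB.instance Definition _ := Measure.copy (lebesgue_sf Hmu) mu.
HB.instance Definition _ := @Measure_isSigmaFinite.Build _ _ _ (lebesgue_sf Hmu) (lebesgue_sigma_finite _ Hmu).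
Definition lebesgue_sfm : {sigma_finite_measure set (Rd R d) -> \bar R} := lebesgue_sf Hmu.

Lemma lebesgue_fubini_tonelli (f : Rd_measurableType R d * Rd_measurableType R d -> \bar R) :
  measurable_fun setT f -> (forall p, 0 <= f p)%E ->
  (\int[mu]_x \int[mu]_y f (x, y) = \int[mu]_y \int[mu]_x f (x, y))%E.
Proof. by move=> mf f0; exact: (fubini_tonelli (m1 := lebesgue_sfm) (m2 := lebesgue_sfm)). Qed.

Lemma lebesgue_measurable_fubini_F {d'} {T : measurableType d'} (f : T * Rd_measurableType R d -> \bar R) :
  measurable_fun setT f -> (forall p, 0 <= f p)%E ->
  measurable_fun setT (fun x => \int[mu]_y f (x, y))%E.
Proof. by move=> mf f0; exact: (measurable_fun_fubini_tonelli_F (m2 := lebesgue_sfm)). Qed.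

Lemma measurable_shift (v : 'rV[R]_d) :
  measurable_fun setT ((fun x => x + v) : Rd R d -> Rd R d).
Proof.
apply: measurable_fun_Rd => i.
under eq_fun do rewrite mxE.
by apply: measurable_funD => //; exact: measurable_coord.
Qed.

Lemma measurable_fun_opp_Rd {d'} {T : measurableType d'} (f : T -> 'rV[R]_d) :
  measurable_fun setT (f : T -> Rd R d) ->
  measurable_fun setT ((fun t => - f t) : T -> Rd R d).
Proof.
move=> mf; apply: measurable_fun_Rd => i.
under eq_fun do rewrite mxE.
apply: measurableT_comp => //.
exact: (measurableT_comp (measurable_coord i) mf).
Qed.

(** The image of [mu] under a translation has the same values on boxes, so uniqueness identifies the
    two. *)
Lemma lebesgue_shift (v : 'rV[R]_d) (A : set (Rd R d)) : measurable A ->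
  mu A = pushforward mu ((fun x => x + v) : Rd R d -> Rd R d) A.
Proof.
pose nu : {measure set Rd R d -> \bar R} :=
  @measure_function_pushforward__canonical__measure_function_Measure _ _ _ _ _ mu _ (measurable_shift v).
apply: (lebesgue_unique _ Hmu nu) => a b ab.
rewrite /= /pushforward.
have -> : (fun x : Rd R d => (x : 'rV[R]_d) + v) @^-1`
    [set x : Rd R d | forall i, a ord0 i <= (x : 'rV[R]_d) ord0 i <= b ord0 i] =
    cbox (a - v) (b - v).
  apply/seteqP; split => x /= h i; have := h i; rewrite !mxE.
    by rewrite lerBlDr lerBrDr.
  by rewrite lerBlDr lerBrDr.
rewrite Hmu; last by move=> i; rewrite !mxE lerB.
by congr (_%:E); apply: eq_bigr => i _; rewrite !mxE; lra.
Qed.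

Lemma ge0_integral_shift (v : 'rV[R]_d) (f : Rd R d -> \bar R) :
  measurable_fun setT f -> (forall x, 0 <= f x)%E ->
  (\int[mu]_x f ((x : 'rV[R]_d) + v)%R = \int[mu]_x f x)%E.
Proof.
move=> mf f0.
have := @ge0_integral_pushforward _ _ _ _ R _ (measurable_shift v) mu setT f measurableT mf.
rewrite preimage_setT => <- //.
pose nu : {measure set Rd R d -> \bar R} :=
  @measure_function_pushforward__canonical__measure_function_Measure _ _ _ _ _ mu _ (measurable_shift v).
apply: (@eq_measure_integral _ _ _ _ mu nu f) => A mA _.
by rewrite (lebesgue_shift v A mA).
Qed.

End lebesgue_invariance.

(** * Product integrals and the Gaussian integral *)

Section lebesgue_product.
Context {R : realType}.

Definition row_cons {d} (p : R * 'rV[R]_d) : 'rV[R]_d.+1 :=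
  \row_i (if unlift ord0 i is Some j then p.2 ord0 j else p.1).

Lemma row_cons0 {d} (p : R * 'rV[R]_d) : row_cons p ord0 ord0 = p.1.
Proof. by rewrite mxE unlift_none. Qed.

Lemma row_consS {d} (p : R * 'rV[R]_d) j : row_cons p ord0 (lift ord0 j) = p.2 ord0 j.
Proof. by rewrite mxE liftK. Qed.

Lemma measurable_row_cons {d} :
  measurable_fun setT (row_cons : measurableTypeR R * Rd_measurableType R d -> Rd R d.+1).
Proof.
apply: measurable_fun_Rd => i; have [j ->|->] := unliftP ord0 i.
  under eq_fun do rewrite row_consS.
  exact: (measurableT_comp (measurable_coord j) measurable_snd).
under eq_fun do rewrite row_cons0.
exact: measurable_fst.
Qed.

(** [is_lebesgue] gives only the volumes of boxes. Integrals of product functions are therefore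
    computed on a measure built coordinate by coordinate from products, and [lebesgue_integral_prod]
    transfers them to [mu] by uniqueness. *)
Lemma lebesgue_measure_prod d : exists nu : {measure set Rd R d -> \bar R},
  is_lebesgue nu /\
  forall (g : R -> R) (c : R), measurable_fun setT g -> (forall t, 0 <= g t) ->
    (\int[lebesgue_measure]_t (g t)%:E = c%:E)%E ->
    (\int[nu]_x (\prod_i g ((x : 'rV[R]_d) ord0 i))%:E = (c ^+ d)%:E)%E.
Proof.
elim: d => [|d [nu [Hnu nuM]]].
  (* In dimension 0 there is a single point, and every box has the empty product 1 as volume. *)
  exists (dirac (T := Rd_measurableType R 0) (0 : 'rV[R]_0)).
  split=> [a b _|g c mg g0 gc].
    rewrite big_ord0 /dirac /= diracE mem_set //; by case.
  under eq_integral do rewrite big_ord0.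
  by rewrite integral_cst //= diracT mul1e.
pose lebR : {sigma_finite_measure set (measurableTypeR R) -> \bar R} := lebesgue_measure.
pose P : {measure set (measurableTypeR R * Rd_measurableType R d) -> \bar R} :=
  product_measure1 lebR (lebesgue_sfm _ Hnu).
pose nu' : {measure set Rd R d.+1 -> \bar R} :=
  @measure_function_pushforward__canonical__measure_function_Measure _ _ _ _ _ P _ measurable_row_cons.
exists nu'; split=> [a b ab|g c mg g0 gc].
  rewrite /nu' /= /pushforward /=.
  rewrite [_ @^-1` _](_ : _ = `[a ord0 ord0, b ord0 ord0] `*`
    cbox (\row_j a ord0 (lift ord0 j)) (\row_j b ord0 (lift ord0 j))).
    rewrite product_measure1E //; last exact: measurable_cbox.
    rewrite big_ord_recl EFinM; congr (_ * _)%E.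
      transitivity (if (a ord0 ord0)%:E < (b ord0 ord0)%:E then (b ord0 ord0)%:E - (a ord0 ord0)%:E else 0)%E.
        exact: (lebesgue_measure_itv `[a ord0 ord0, b ord0 ord0]).
      rewrite lte_fin; case: ltP (ab ord0) => // h1 h2.
      by have -> : b ord0 ord0 = a ord0 ord0 by [apply/eqP; rewrite eq_le h1 h2]; rewrite subrr.
    rewrite [LHS](Hnu _ _ _); last by move=> j; rewrite !mxE.
    by congr (_%:E); apply: eq_bigr => j _; rewrite !mxE.
  apply/seteqP; split => [[t x] /= h|[t x] /= [h1 h2] i].
    split; first by have := h ord0; rewrite row_cons0 in_itv.
    by move=> j; have := h (lift ord0 j); rewrite row_consS !mxE.
  have [j ->|->] := unliftP ord0 i.
    by have := h2 j; rewrite row_consS !mxE.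
  by rewrite row_cons0; move: h1; rewrite in_itv.
have mprod n : measurable_fun setT (fun x : Rd R n => (\prod_i g ((x : 'rV[R]_n) ord0 i))).
  apply: measurable_prod => i _; apply: measurableT_comp => //; exact: measurable_coord.
have p0 n (x : 'rV[R]_n) : 0 <= \prod_i g (x ord0 i) by apply: prodr_ge0.
have c0 : 0 <= c by rewrite -lee_fin -gc; apply: integral_ge0 => t _; rewrite lee_fin.
have mE : measurable_fun setT (fun x : Rd R d.+1 => (\prod_i g ((x : 'rV[R]_d.+1) ord0 i))%:E).
  by apply/measurable_EFinP; exact: mprod.
have := @ge0_integral_pushforward _ _ _ _ R _ measurable_row_cons
  P setT _ measurableT mE.
move=> /(_ _)/wrap[]; first by move=> x _; rewrite lee_fin.
move=> E; rewrite [LHS]E {E}.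
rewrite preimage_setT.
pose F (p : measurableTypeR R * Rd_measurableType R d) :=
  (g p.1 * \prod_j g ((p.2 : 'rV[R]_d) ord0 j))%:E.
transitivity (\int[P]_p F p)%E.
  apply: eq_integral => p _; rewrite /F /= big_ord_recl row_cons0.
  by congr (_ * _)%:E; apply: eq_bigr => j _; congr g; exact: row_consS.
have mF : measurable_fun setT F.
  apply/measurable_EFinP; apply: measurable_funM.
    exact: (measurableT_comp mg measurable_fst).
  exact: (measurableT_comp (mprod d) measurable_snd).
have F0 p : (0 <= F p)%E by rewrite lee_fin mulr_ge0.
rewrite [LHS](fubini_tonelli1 F mF F0) /fubini_F /F /=.
transitivity (\int[lebesgue_measure]_t ((c ^+ d)%:E * (g t)%:E))%E.
  apply: eq_integral => t _.
  under eq_integral do rewrite EFinM.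
  rewrite ge0_integralZl //; first by rewrite [X in (_ * X)%E](nuM g c) // muleC.
  - by apply/measurable_EFinP; exact: mprod.
  - by move=> x _; rewrite lee_fin; exact: p0.
  - by rewrite lee_fin.
rewrite ge0_integralZl //; first by rewrite gc -EFinM exprSr.
- by apply/measurable_EFinP.
- by move=> x _; rewrite lee_fin.
- by rewrite lee_fin exprn_ge0.
Qed.

Lemma lebesgue_integral_prod d (mu : {measure set Rd R d -> \bar R}) (g : R -> R) (c : R) :
  is_lebesgue mu -> measurable_fun setT g -> (forall t, 0 <= g t) ->
  (\int[lebesgue_measure]_t (g t)%:E = c%:E)%E ->
  (\int[mu]_x (\prod_i g ((x : 'rV[R]_d) ord0 i))%:E = (c ^+ d)%:E)%E.
Proof.
move=> Hmu mg g0 gc; have [nu [Hnu /(_ g c mg g0 gc) <-]] := lebesgue_measure_prod d.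
by apply: eq_measure_integral => A mA _; exact: lebesgue_unique.
Qed.

(** Up to its normalising constant, the integrand is the centred normal density of variance
    [c / 2]. *)
Lemma lebesgue_integral_gauss1 (c : R) : 0 < c ->
  (\int[lebesgue_measure]_t (expR (- t ^+ 2 / c))%:E = (Num.sqrt (c * pi))%:E)%E.
Proof.
move=> c0.
pose s := Num.sqrt (c / 2).
have s0 : s != 0 by rewrite gt_eqF // sqrtr_gt0 divr_gt0.
have s2 : s ^+ 2 = c / 2 by rewrite sqr_sqrtr // ltW // divr_gt0.
have peak : (normal_peak s)^-1 = Num.sqrt (c * pi).
  rewrite /normal_peak invrK s2; congr Num.sqrt.
  by rewrite -mulr_natr; field.
have pk0 : normal_peak s != 0 by rewrite gt_eqF // normal_peak_gt0.
transitivity (\int[lebesgue_measure]_t ((normal_peak s)^-1%:E * (normal_pdf 0 s t)%:E))%E.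
  apply: eq_integral => t _.
  rewrite normal_pdfE //= -EFinM mulKf // /normal_fun s2; congr (expR _)%:E.
  by rewrite subr0 -mulr_natr; field; rewrite gt_eqF.
rewrite ge0_integralZl //.
- by rewrite integral_normal_pdf mule1 peak.
- by apply/measurable_EFinP; exact: measurable_normal_pdf.
- by move=> t _; rewrite lee_fin normal_pdf_ge0.
- by rewrite lee_fin invr_ge0 normal_peak_ge0.
Qed.

Lemma sqrt_powR_half (a : R) n : 0 <= a -> Num.sqrt a ^+ n = powR a (n%:R / 2).
Proof.
move=> a0; rewrite -powR12_sqrt // -powR_mulrn ?powR_ge0 // -powRrM.
by congr powR; rewrite mulrC.
Qed.

Lemma dotRE d (x : 'rV[R]_d) : dotR x x = \sum_i x ord0 i ^+ 2.
Proof. by apply: eq_bigr => i _; rewrite expr2. Qed.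

Lemma dotR_ge0 d (x : 'rV[R]_d) : 0 <= dotR x x.
Proof. by rewrite dotRE sumr_ge0 // => i _; rewrite sqr_ge0. Qed.

Lemma enorm_sqr d (x : 'rV[R]_d) : enorm x ^+ 2 = dotR x x.
Proof. by rewrite sqr_sqrtr // dotR_ge0. Qed.

Lemma lebesgue_integral_gauss d (mu : {measure set Rd R d -> \bar R}) (c : R) :
  is_lebesgue mu -> 0 < c ->
  (\int[mu]_x (expR (- enorm (x : 'rV[R]_d) ^+ 2 / c))%:E = (powR (c * pi) (d%:R / 2))%:E)%E.
Proof.
move=> Hmu c0; rewrite -sqrt_powR_half; last by rewrite mulr_ge0 ?pi_ge0 // ltW.
rewrite -(@lebesgue_integral_prod d mu (fun t => expR (- t ^+ 2 / c))) //.
- apply: eq_integral => x _; congr (_%:E).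
  by rewrite -expR_sum -mulr_suml sumrN enorm_sqr dotRE.
- apply: measurableT_comp => //; apply: measurable_funM => //.
  by apply: measurableT_comp => //; exact: exprn_measurable.
- exact: lebesgue_integral_gauss1.
Qed.

End lebesgue_product.

(** * Euclidean inner product and norm *)

Section euclid.
Context {R : realType} {d : nat}.
Implicit Types (x y z : 'rV[R]_d) (a : R).

Lemma dotRC x y : dotR x y = dotR y x.
Proof. by apply: eq_bigr => i _; rewrite mulrC. Qed.

Lemma dotRDl x y z : dotR (x + y) z = dotR x z + dotR y z.
Proof. by rewrite -big_split; apply: eq_bigr => i _; rewrite mxE mulrDl. Qed.

Lemma dotRZl a x y : dotR (a *: x) y = a * dotR x y.
Proof. by rewrite mulr_sumr; apply: eq_bigr => i _; rewrite mxE mulrA. Qed.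

Lemma dotRNl x y : dotR (- x) y = - dotR x y.
Proof. by rewrite -scaleN1r dotRZl mulN1r. Qed.

Lemma dotRBl x y z : dotR (x - y) z = dotR x z - dotR y z.
Proof. by rewrite dotRDl dotRNl. Qed.

Lemma dotRDr x y z : dotR x (y + z) = dotR x y + dotR x z.
Proof. by rewrite !(dotRC x) dotRDl. Qed.

Lemma dotRZr a x y : dotR x (a *: y) = a * dotR x y.
Proof. by rewrite !(dotRC x) dotRZl. Qed.

Lemma dotRNr x y : dotR x (- y) = - dotR x y.
Proof. by rewrite !(dotRC x) dotRNl. Qed.

Lemma dot0R x : dotR 0 x = 0.
Proof. by rewrite -(scale0r x) dotRZl mul0r. Qed.

Lemma dotR0 x : dotR x 0 = 0.
Proof. by rewrite dotRC dot0R. Qed.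

Definition dotRE' := (dotRDl, dotRDr, dotRZl, dotRZr, dotRNl, dotRNr).

Lemma enorm_ge0 x : 0 <= enorm x.
Proof. exact: sqrtr_ge0. Qed.

Lemma dotRxx x : dotR x x = enorm x ^+ 2.
Proof. by rewrite enorm_sqr. Qed.

Lemma enorm_sqrD x y : enorm (x + y) ^+ 2 = enorm x ^+ 2 + 2 * dotR x y + enorm y ^+ 2.
Proof. rewrite !enorm_sqr !dotRE' (dotRC y x); ring. Qed.

Lemma enorm_sqrB x y : enorm (x - y) ^+ 2 = enorm x ^+ 2 - 2 * dotR x y + enorm y ^+ 2.
Proof. rewrite !enorm_sqr !dotRE' (dotRC y x); ring. Qed.

Lemma enormZ a x : enorm (a *: x) = `|a| * enorm x.
Proof. by rewrite /enorm dotRZl dotRZr mulrA -expr2 sqrtrM ?sqr_ge0 // sqrtr_sqr. Qed.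

Lemma enormN x : enorm (- x) = enorm x.
Proof. by rewrite -scaleN1r enormZ normrN1 mul1r. Qed.

Lemma enormB x y : enorm (x - y) = enorm (y - x).
Proof. by rewrite -enormN opprB. Qed.

Lemma enorm0 : enorm (0 : 'rV[R]_d) = 0.
Proof. by rewrite /enorm dot0R sqrtr0. Qed.

Lemma enorm_eq0 x : enorm x = 0 -> x = 0.
Proof.
move=> x0; have : dotR x x = 0 by rewrite dotRxx x0 expr0n.
rewrite dotRE => /psumr_eq0P h; apply/rowP => i; rewrite mxE.
by apply/eqP; rewrite -sqrf_eq0; apply/eqP/h => // j _; exact: sqr_ge0.
Qed.

Lemma enorm_gt0 x : x != 0 -> 0 < enorm x.
Proof.
by move=> x0; rewrite lt_neqAle enorm_ge0 andbT eq_sym; apply: contra x0 => /eqP/enorm_eq0 ->.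
Qed.

(** Cauchy-Schwarz, by expanding the square of the norm of [enorm y *: x - enorm x *: y]. *)
Lemma dotR_le x y : dotR x y <= enorm x * enorm y.
Proof.
have [y0|y0] := eqVneq y 0; first by rewrite y0 dotR0 enorm0 mulr0.
have N0 := enorm_gt0 _ y0; have M0 := enorm_ge0 x.
have [x0|x0] := eqVneq x 0; first by rewrite x0 dot0R enorm0 mul0r.
have P0 := enorm_gt0 _ x0.
have : 0 <= enorm ((enorm y) *: x - (enorm x) *: y) ^+ 2 by exact: sqr_ge0.
rewrite enorm_sqrB !enormZ !dotRE' (ger0_norm (enorm_ge0 x)) (ger0_norm (enorm_ge0 y)).
move: N0 P0; set p := enorm x; set q := enorm y; set t := dotR x y => N0 P0 h.
rewrite -(ler_pM2l (mulr_gt0 N0 P0)); nra.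
Qed.

Lemma normr_dotR x y : `|dotR x y| <= enorm x * enorm y.
Proof.
rewrite ler_norml dotR_le andbT lerNl -dotRNl.
by apply: le_trans (dotR_le _ _) _; rewrite enormN.
Qed.

Lemma enormD x y : enorm (x + y) <= enorm x + enorm y.
Proof.
rewrite -ler_sqr ?nnegrE ?addr_ge0 ?enorm_ge0 // enorm_sqrD.
have := dotR_le x y; lra.
Qed.

Lemma enorm_sub_le x y : enorm x - enorm y <= enorm (x - y).
Proof. by rewrite lerBlDr; have := enormD (x - y) y; rewrite subrK. Qed.

Section measurability.
Context {d'} {T : measurableType d'}.
Implicit Types f g : T -> 'rV[R]_d.

Lemma measurable_dotR f g : measurable_fun setT (f : T -> Rd R d) ->
  measurable_fun setT (g : T -> Rd R d) ->
  measurable_fun setT (fun t => dotR (f t) (g t)).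
Proof.
move=> mf mg; apply: measurable_sum => i; apply: measurable_funM.
  exact: (measurableT_comp (measurable_coord i) mf).
exact: (measurableT_comp (measurable_coord i) mg).
Qed.

Lemma measurable_enorm_sqr f : measurable_fun setT (f : T -> Rd R d) ->
  measurable_fun setT (fun t => enorm (f t) ^+ 2).
Proof.
move=> mf; under eq_fun do rewrite enorm_sqr.
exact: measurable_dotR.
Qed.

Lemma measurable_enorm f : measurable_fun setT (f : T -> Rd R d) ->
  measurable_fun setT (fun t => enorm (f t)).
Proof.
move=> mf; have ms : measurable_fun [set: R] (Num.sqrt : R -> R).
  by apply: continuous_measurable_fun; exact: sqrt_continuous.
exact: (measurableT_comp ms (measurable_dotR _ _ mf mf)).
Qed.

Lemma measurable_addRd f g : measurable_fun setT (f : T -> Rd R d) ->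
  measurable_fun setT (g : T -> Rd R d) ->
  measurable_fun setT ((fun t => f t + g t) : T -> Rd R d).
Proof.
move=> mf mg; apply: measurable_fun_Rd => i.
under eq_fun do rewrite mxE.
apply: measurable_funD.
  exact: (measurableT_comp (measurable_coord i) mf).
exact: (measurableT_comp (measurable_coord i) mg).
Qed.

Lemma measurable_subRd f g : measurable_fun setT (f : T -> Rd R d) ->
  measurable_fun setT (g : T -> Rd R d) ->
  measurable_fun setT ((fun t => f t - g t) : T -> Rd R d).
Proof.
move=> mf mg; apply: (measurable_addRd f (fun t => - g t)) => //.
exact: measurable_fun_opp_Rd.
Qed.

Lemma measurable_scaleRd (h : T -> R) f : measurable_fun setT h ->
  measurable_fun setT (f : T -> Rd R d) ->
  measurable_fun setT ((fun t => h t *: f t) : T -> Rd R d).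
Proof.
move=> mh mf; apply: measurable_fun_Rd => i.
under eq_fun do rewrite mxE.
apply: measurable_funM => //.
exact: (measurableT_comp (measurable_coord i) mf).
Qed.
End measurability.
End euclid.

(** * Gaussian expectations and reflection coupling *)

Section reflection.
Context {R : realType} {d : nat}.
Variables (mu : {measure set Rd R d -> \bar R}) (Hmu : is_lebesgue mu).

Definition refl (e u : 'rV[R]_d) : 'rV[R]_d := u - (2 * dotR u e) *: e.

Section unit_vector.
Variables (e : 'rV[R]_d) (e1 : enorm e = 1).

Lemma reflD u v : refl e (u + v) = refl e u + refl e v.
Proof. by rewrite /refl !dotRE' mulrDr scalerDl opprD addrACA. Qed.

Lemma reflN u : refl e (- u) = - refl e u.
Proof. by rewrite /refl !dotRE' mulrN scaleNr opprD. Qed.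

Lemma reflB u v : refl e (u - v) = refl e u - refl e v.
Proof. by rewrite reflD reflN. Qed.

Lemma dot_refl u : dotR (refl e u) e = - dotR u e.
Proof. by rewrite /refl dotRBl dotRZl dotRxx e1; ring. Qed.

Lemma reflK u : refl e (refl e u) = u.
Proof.
rewrite {1}/refl dot_refl /refl -addrA -opprD -scalerDl.
by rewrite mulrN subrr scale0r subr0.
Qed.

Lemma enorm_refl u : enorm (refl e u) = enorm u.
Proof.
rewrite /enorm; congr Num.sqrt; rewrite !dotRxx /refl enorm_sqrB enormZ exprMn.
by rewrite real_normK ?num_real // e1 dotRZr; ring.
Qed.

Lemma measurable_refl {d'} {T : measurableType d'} (f : T -> 'rV[R]_d) :
  measurable_fun setT (f : T -> Rd R d) ->
  measurable_fun setT ((fun t => refl e (f t)) : T -> Rd R d).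
Proof.
move=> mf; apply: measurable_subRd => //.
apply: measurable_scaleRd => //.
by apply: measurable_funM => //; exact: measurable_dotR.
Qed.

(* Two invariant measures are proportional: integrate [f (refl x + y) g y] in both orders, the Gaussian [g] being even and reflection invariant *)
Lemma ge0_integral_refl (f : Rd R d -> \bar R) :
  measurable_fun setT f -> (forall x, 0 <= f x)%E ->
  (\int[mu]_x f (refl e x) = \int[mu]_x f x)%E.
Proof.
move=> mf f0.
pose g (x : 'rV[R]_d) : \bar R := (expR (- enorm x ^+ 2 / 1))%:E.
have g0 x : (0 <= g x)%E by rewrite lee_fin expR_ge0.
have mg d' (T : measurableType d') (h : T -> 'rV[R]_d) :
    measurable_fun setT (h : T -> Rd R d) -> measurable_fun setT (fun t => g (h t)).
  move=> mh; apply/measurable_EFinP; apply: measurableT_comp => //.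
  apply: measurable_funM => //; apply: measurableT_comp => //.
  exact: measurable_enorm_sqr.
pose c := powR (1 * pi) (d%:R / 2) : R.
have gc : (\int[mu]_x g x = c%:E)%E by exact: lebesgue_integral_gauss.
have c0 : c != 0 by rewrite gt_eqF // powR_gt0 // mul1r pi_gt0.
have mrefl : measurable_fun setT ((fun x => refl e x) : Rd R d -> Rd R d).
  exact: (@measurable_refl _ (Rd_measurableType R d) (fun x => x)).
have gE u v : enorm u = enorm v -> g u = g v by rewrite /g => ->.
pose E := Rd_measurableType R d.
have m1 : measurable_fun setT ((fun p => p.1) : E * E -> Rd R d) by exact: measurable_fst.
have m2 : measurable_fun setT ((fun p => p.2) : E * E -> Rd R d) by exact: measurable_snd.
have mr1 : measurable_fun setT ((fun p => refl e p.1) : E * E -> Rd R d).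
  exact: (measurableT_comp mrefl m1).
have mr2 : measurable_fun setT ((fun p => refl e p.2) : E * E -> Rd R d).
  exact: (measurableT_comp mrefl m2).
have mid : measurable_fun setT ((fun x => x) : E -> Rd R d) by exact: measurable_id.
have H : ((\int[mu]_x f (refl e x)) * c%:E = (\int[mu]_x f x) * c%:E)%E.
  transitivity (\int[mu]_y \int[mu]_x (g y * f (refl e x + y)%R))%E.
    rewrite muleC -gc -ge0_integralZr //; last 2 first.
    - exact: (mg _ E (fun x => x)).
    - exact: integral_ge0.
    apply: eq_integral => y _.
    rewrite ge0_integralZl //.
      congr (_ * _)%E; rewrite -(ge0_integral_shift mu Hmu (refl e y) (fun x => f (refl e x))) //.
        by apply: eq_integral => x _; rewrite reflD reflK.
      exact: (measurableT_comp mf mrefl).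
    apply: (measurableT_comp mf).
    exact: (measurable_addRd (refl e : E -> _) (cst y)).
  transitivity (\int[mu]_x \int[mu]_y (g y * f (refl e x + y)%R))%E.
    apply: (lebesgue_fubini_tonelli mu Hmu (fun p => g p.1 * f (refl e p.2 + p.1)%R)%E).
      apply: emeasurable_funM; first exact: mg.
      by apply: (measurableT_comp mf); exact: measurable_addRd.
    by move=> p; rewrite mule_ge0.
  transitivity (\int[mu]_x \int[mu]_y (f y * g (y - refl e x)%R))%E.
    apply: eq_integral => x _.
    pose h y : \bar R := (f y * g (y - refl e x)%R)%E.
    have mh : measurable_fun setT (h : Rd R d -> \bar R).
      apply: emeasurable_funM => //; apply: mg.
      exact: (measurable_subRd (fun y : E => y) (cst (refl e x))).
    have h0 y : (0 <= h y)%E by rewrite mule_ge0.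
    apply: etrans (ge0_integral_shift mu Hmu (refl e x) h mh h0).
    by apply: eq_integral => y _; rewrite /h addrK muleC addrC.
  rewrite (lebesgue_fubini_tonelli mu Hmu (fun p => f p.2 * g (p.2 - refl e p.1)%R)%E); last 2 first.
  - apply: emeasurable_funM; first exact: (measurableT_comp mf m2).
    by apply: mg; exact: measurable_subRd.
  - by move=> p; rewrite mule_ge0.
  rewrite -ge0_integralZr //; last by rewrite lee_fin powR_ge0.
  apply: eq_integral => y _.
  have mgy : measurable_fun setT (fun x : E => g (y - refl e x)).
    by apply: mg; exact: (measurable_subRd (cst y) (refl e : E -> _)).
  apply: (etrans (ge0_integralZl mu measurableT mgy (fun x _ => g0 _) (f0 y))).
  congr (_ * _)%E; rewrite -gc.
  apply: etrans (ge0_integral_shift mu Hmu (- refl e y) g (mg _ E (fun x => x) mid) g0).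
  apply: eq_integral => x _; apply: gE.
  by rewrite -enorm_refl reflB reflK enormB.
have cV : (c%:E * c^-1%:E = 1)%E by rewrite -EFinM divff.
by rewrite -[LHS]mule1 -[RHS]mule1 -cV !muleA H.
Qed.

End unit_vector.
End reflection.

Section invariant_integral.
Context {R : realType} {d : nat}.
Variables (mu : {measure set Rd R d -> \bar R}) (T : Rd R d -> Rd R d).
Hypothesis (mT : measurable_fun setT T).
Hypothesis invT : forall f : Rd R d -> \bar R, measurable_fun setT f ->
  (forall x, 0 <= f x)%E -> (\int[mu]_x f (T x) = \int[mu]_x f x)%E.

Lemma integral_invariant (f : Rd R d -> \bar R) :
  measurable_fun setT f -> (\int[mu]_x f (T x) = \int[mu]_x f x)%E.
Proof.
move=> mf; rewrite [LHS]integralE [RHS]integralE; congr (_ - _)%E.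
  have pos0 x : (0 <= (f^\+)%E x)%E by exact: funepos_ge0.
  apply: etrans (invT _ (measurable_funepos mf) pos0).
  by apply: eq_integral => x _; rewrite !funeposE.
have neg0 x : (0 <= (f^\-)%E x)%E by exact: funeneg_ge0.
apply: etrans (invT _ (measurable_funeneg mf) neg0).
by apply: eq_integral => x _; rewrite !funenegE.
Qed.

Lemma integrable_invariant (f : Rd R d -> \bar R) :
  mu.-integrable setT f -> mu.-integrable setT (f \o T).
Proof.
move=> /integrableP[mf fi]; apply/integrableP; split; first exact: measurableT_comp.
apply: le_lt_trans fi.
by rewrite (invT (fun x => `|f x|)%E) //; exact: measurableT_comp.
Qed.
End invariant_integral.

Lemma powR_ratio {R : realType} (p q h : R) : 0 < p -> 0 < q ->
  powR p (- h) * powR (p / q) h = powR q (- h).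
Proof.
move=> p0 q0; rewrite powRM ?invr_ge0 ?ltW // -(@powR_inv1 _ q) ?ltW // -powRrM mulN1r.
by rewrite powRN mulrA mulVf ?mul1r // gt_eqF // powR_gt0.
Qed.

(** * Gaussian expectations and their exponential moments *)

Section gaussian.
Context {R : realType} {d : nat}.
Variables (mu : {measure set Rd R d -> \bar R}) (Hmu : is_lebesgue mu).
Implicit Types (a b l : 'rV[R]_d) (g : R).
Local Notation E := (Rd_measurableType R d).

(** Density of the normal law with mean [a] and covariance [2 * g] times the identity; the proposal
    is the case [a = x - g *: gradU x]. *)
Definition gdens g a (u : 'rV[R]_d) : R :=
  powR (4 * pi * g) (- (d%:R / 2)) * expR (- (enorm (u - a) ^+ 2) / (4 * g)).

Lemma gdens_ge0 g a u : 0 <= gdens g a u.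
Proof. by rewrite mulr_ge0 ?powR_ge0 ?expR_ge0. Qed.

Lemma measurable_idRd : measurable_fun setT ((fun u => u) : E -> Rd R d).
Proof. exact: measurable_id. Qed.

Lemma measurable_subcst a : measurable_fun setT ((fun u => (u : 'rV[R]_d) - a) : E -> Rd R d).
Proof. exact: (measurable_subRd (fun u : E => u) (cst a) measurable_idRd). Qed.

Lemma measurable_gdens {d'} {T : measurableType d'} g (f h : T -> 'rV[R]_d) :
  measurable_fun setT (f : T -> Rd R d) -> measurable_fun setT (h : T -> Rd R d) ->
  measurable_fun setT (fun t => gdens g (f t) (h t)).
Proof.
move=> mf mh; apply: measurable_funM => //; apply: measurableT_comp => //.
apply: measurable_funM => //; apply: measurableT_comp => //.
by apply: measurable_enorm_sqr; exact: measurable_subRd.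
Qed.

Lemma measurable_gdens1 g a : measurable_fun setT (gdens g a : E -> R).
Proof. exact: (measurable_gdens g (cst a) (fun u : E => u)). Qed.

(** Completing the square: the integrand is [expR (g * enorm l ^+ 2)] times a Gaussian centred at
    [a + (2 * g) *: l]. *)
Lemma gauss_integral_lin g a l : 0 < g ->
  (\int[mu]_u (expR (dotR l ((u : 'rV[R]_d) - a) - enorm ((u : 'rV[R]_d) - a) ^+ 2 / (4 * g)))%:E
   = (powR (4 * pi * g) (d%:R / 2) * expR (g * enorm l ^+ 2))%:E)%E.
Proof.
move=> g0.
pose h (w : 'rV[R]_d) : \bar R := (expR (- enorm w ^+ 2 / (4 * g)))%:E.
have mh d' (T : measurableType d') (k : T -> 'rV[R]_d) :
    measurable_fun setT (k : T -> Rd R d) -> measurable_fun setT (fun t => h (k t)).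
  move=> mk; apply/measurable_EFinP; apply: measurableT_comp => //.
  apply: measurable_funM => //; apply: measurableT_comp => //.
  exact: measurable_enorm_sqr.
have h0 w : (0 <= h w)%E by rewrite lee_fin expR_ge0.
transitivity (\int[mu]_u ((expR (g * enorm l ^+ 2))%:E *
    h ((u : 'rV[R]_d) + (- a - (2 * g) *: l))%R))%E.
  apply: eq_integral => u _; rewrite /h -EFinM -expRD.
  have -> : dotR l (u - a) - enorm (u - a) ^+ 2 / (4 * g) =
     g * enorm l ^+ 2 + - enorm (u + (- a - (2 * g) *: l)) ^+ 2 / (4 * g); last by [].
  rewrite addrA (enorm_sqrB (u - a) ((2 * g) *: l)) enormZ exprMn real_normK ?num_real // dotRZr (dotRC l).
  by field; rewrite gt_eqF.
have mh1 : measurable_fun setT (fun u : E => h ((u : 'rV[R]_d) + (- a - (2 * g) *: l))).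
  by apply: mh; exact: (measurable_addRd (fun u : E => u) (cst _) measurable_idRd).
have e0 : (0 <= (expR (g * enorm l ^+ 2))%:E)%E by rewrite lee_fin expR_ge0.
apply: (etrans (ge0_integralZl mu measurableT mh1 (fun x _ => h0 _) e0)).
rewrite (mulrC (powR _ _)) EFinM; congr (_ * _)%E.
apply: (etrans (ge0_integral_shift mu Hmu (- a - (2 * g) *: l) h (mh _ E _ measurable_idRd) h0)).
have g4 : 0 < 4 * g by rewrite mulr_gt0.
by rewrite /h (lebesgue_integral_gauss _ _ _ Hmu g4) mulrAC.
Qed.

(** Measurability of [f] itself is recorded besides integrability of the product, because [f] is
    later composed with the mirror map. *)
Definition gint g a (f : 'rV[R]_d -> R) : Prop :=
  measurable_fun setT (f : E -> R) /\
  mu.-integrable setT (EFin \o (fun u : E => f u * gdens g a u)).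

Definition gexp g a (f : 'rV[R]_d -> R) : R :=
  Rintegral mu setT (fun u : Rd R d => f u * gdens g a u).

Lemma gint_measurable g a f : gint g a f -> measurable_fun setT (f : E -> R).
Proof. by case. Qed.

Lemma gint_dom g a (f h : 'rV[R]_d -> R) : measurable_fun setT (f : E -> R) ->
  gint g a h -> (forall u, `|f u| <= h u) -> gint g a f.
Proof.
move=> mf [mh ih] fh; split=> //; apply: (le_integrable measurableT _ _ ih).
  by apply/measurable_EFinP; apply: measurable_funM => //; exact: measurable_gdens1.
move=> u _; rewrite /= lee_fin !normrM; apply: ler_wpM2r => //.
exact: le_trans (fh u) (ler_norm _).
Qed.

Lemma gintD g a (f h : 'rV[R]_d -> R) : gint g a f -> gint g a h ->
  gint g a (fun u => f u + h u).
Proof.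
move=> [mf i_f] [mh i_h]; split; first exact: measurable_funD.
apply: eq_integrable (integrableD measurableT i_f i_h) => // u _.
by rewrite /= mulrDl EFinD.
Qed.

Lemma gexpD g a (f h : 'rV[R]_d -> R) : gint g a f -> gint g a h ->
  gexp g a (fun u => f u + h u) = gexp g a f + gexp g a h.
Proof.
move=> [mf i_f] [mh i_h]; rewrite /gexp -(RintegralD measurableT i_f i_h).
by apply: eq_Rintegral => u _; rewrite mulrDl.
Qed.

Lemma gintZ g a (c : R) (f : 'rV[R]_d -> R) : gint g a f ->
  gint g a (fun u => c * f u).
Proof.
move=> [mf i_f]; split; first exact: measurable_funM.
by apply: eq_integrable (integrableZl measurableT c i_f) => // u _; rewrite /= -EFinM mulrA.
Qed.

Lemma gexpZ g a (c : R) (f : 'rV[R]_d -> R) : gint g a f ->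
  gexp g a (fun u => c * f u) = c * gexp g a f.
Proof.
move=> [mf i_f]; rewrite /gexp -(RintegralZl c measurableT i_f).
by apply: eq_Rintegral => u _; rewrite mulrA.
Qed.

Lemma gintB g a (f h : 'rV[R]_d -> R) : gint g a f -> gint g a h ->
  gint g a (fun u => f u - h u).
Proof.
move=> i_f i_h; have := gintD _ _ _ _ i_f (gintZ _ _ (-1) _ i_h).
by congr gint; apply: funext => u; rewrite mulN1r.
Qed.

Lemma gexpB g a (f h : 'rV[R]_d -> R) : gint g a f -> gint g a h ->
  gexp g a (fun u => f u - h u) = gexp g a f - gexp g a h.
Proof.
move=> i_f i_h; rewrite -mulN1r -gexpZ // -gexpD //; last exact: gintZ.
by congr gexp; apply: funext => u; rewrite mulN1r.
Qed.

Lemma le_gexp g a (f h : 'rV[R]_d -> R) : gint g a f -> gint g a h ->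
  (forall u, f u <= h u) -> gexp g a f <= gexp g a h.
Proof.
move=> [mf i_f] [mh i_h] fh; apply: le_Rintegral => // u _.
by rewrite ler_wpM2r // gdens_ge0.
Qed.

Lemma normr_gexp g a (f h : 'rV[R]_d -> R) : measurable_fun setT (f : E -> R) ->
  gint g a h -> (forall u, `|f u| <= h u) -> `|gexp g a f| <= gexp g a h.
Proof.
move=> mf i_h fh; have i_f := gint_dom _ _ _ _ mf i_h fh.
rewrite ler_norml; apply/andP; split.
  rewrite lerNl -mulN1r -gexpZ //; apply: le_gexp => //; first exact: gintZ.
  by move=> u; rewrite mulN1r lerNl; have := fh u; rewrite ler_norml => /andP[].
by apply: le_gexp => // u; apply: le_trans (fh u); exact: ler_norm.
Qed.

Lemma gexp_ge0 g a (f : 'rV[R]_d -> R) : (forall u, 0 <= f u) -> 0 <= gexp g a f.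
Proof. by move=> f0; apply: Rintegral_ge0 => u _; rewrite mulr_ge0 ?gdens_ge0. Qed.

(** The quadratic term only rescales the variance, from [g] to [g / (1 - 4 * g * k)]. The ratio of
    the two normalising constants gives the power, and the linear term is handled by
    [gauss_integral_lin]. *)
Lemma gauss_quad g a l (k : R) : 0 < g -> 4 * g * k < 1 ->
  gint g a (fun u => expR (dotR l (u - a) + k * enorm (u - a) ^+ 2)) /\
  gexp g a (fun u => expR (dotR l (u - a) + k * enorm (u - a) ^+ 2)) =
   powR (1 - 4 * g * k) (- (d%:R / 2)) * expR (g / (1 - 4 * g * k) * enorm l ^+ 2).
Proof.
move=> g0 gk; set q := 1 - 4 * g * k; have q0 : 0 < q by rewrite subr_gt0.
have gq0 : 0 < g / q by rewrite divr_gt0.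
have mf : measurable_fun setT ((fun u => expR (dotR l (u - a) + k * enorm (u - a) ^+ 2)) : E -> R).
  apply: measurableT_comp => //; apply: measurable_funD.
    exact: (measurable_dotR (cst l) _ (measurable_cst _) (measurable_subcst a)).
  by apply: measurable_funM => //; apply: measurable_enorm_sqr; exact: measurable_subcst.
have val : (\int[mu]_u (expR (dotR l ((u : 'rV[R]_d) - a) + k * enorm ((u : 'rV[R]_d) - a) ^+ 2) * gdens g a u)%:E =
   (powR q (- (d%:R / 2)) * expR (g / q * enorm l ^+ 2))%:E)%E.
  transitivity (\int[mu]_u ((powR (4 * pi * g) (- (d%:R / 2)))%:E *
    (expR (dotR l ((u : 'rV[R]_d) - a) - enorm ((u : 'rV[R]_d) - a) ^+ 2 / (4 * (g / q))))%:E))%E.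
    apply: eq_integral => u _; rewrite /gdens -EFinM mulrCA -expRD.
    have -> : dotR l (u - a) + k * enorm (u - a) ^+ 2 + - enorm (u - a) ^+ 2 / (4 * g) =
      dotR l (u - a) - enorm (u - a) ^+ 2 / (4 * (g / q)); last by [].
    by rewrite /q; field; rewrite -/q !gt_eqF.
  have p0 : (0 <= (powR (4 * pi * g) (- (d%:R / 2)))%:E)%E by rewrite lee_fin powR_ge0.
  have mh : measurable_fun setT (fun u : E => (expR (dotR l ((u : 'rV[R]_d) - a) - enorm ((u : 'rV[R]_d) - a) ^+ 2 / (4 * (g / q))))%:E).
    apply/measurable_EFinP; apply: measurableT_comp => //; apply: measurable_funB.
      exact: (measurable_dotR (cst l) _ (measurable_cst _) (measurable_subcst a)).
    by apply: measurable_funM => //; apply: measurable_enorm_sqr; exact: measurable_subcst.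
  apply: (etrans (ge0_integralZl mu measurableT mh _ p0)); first by move=> u _; rewrite lee_fin expR_ge0.
  rewrite (gauss_integral_lin (g / q) a l gq0) -EFinM (mulrA (powR _ (- _))); congr (_ * _)%:E.
  have pg : 0 < 4 * pi * g by rewrite !mulr_gt0 // pi_gt0.
  by rewrite (mulrA _ g) powR_ratio.
split; last by rewrite /gexp /Rintegral val.
split=> //; apply/integrableP; split.
  by apply/measurable_EFinP; apply: measurable_funM => //; exact: measurable_gdens1.
apply: le_lt_trans (ltry (powR q (- (d%:R / 2)) * expR (g / q * enorm l ^+ 2))).
rewrite -val le_eqVlt; apply/orP; left; apply/eqP; apply: eq_integral => u _.
by rewrite /= ger0_norm // mulr_ge0 ?gdens_ge0 ?expR_ge0.
Qed.

Lemma gexp_lin g a l : 0 < g ->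
  gint g a (fun u => expR (dotR l (u - a))) /\
  gexp g a (fun u => expR (dotR l (u - a))) = expR (g * enorm l ^+ 2).
Proof.
move=> g0; have [|H1 H2] := gauss_quad g a l 0 g0; first by rewrite mulr0.
have E0 : (fun u => expR (dotR l (u - a) + 0 * enorm (u - a) ^+ 2)) = (fun u => expR (dotR l (u - a))).
  by apply: funext => u; rewrite mul0r addr0.
by rewrite E0 in H1 H2; split => //; rewrite H2 mulr0 subr0 powR1 mul1r divr1.
Qed.

Lemma gexp_cst g a (c : R) : 0 < g -> gint g a (fun=> c) /\ gexp g a (fun=> c) = c.
Proof.
move=> g0; have [i1 e1] := gexp_lin g a 0 g0.
have E1 : (fun u : 'rV[R]_d => expR (dotR 0 (u - a))) = (fun=> 1).
  by apply: funext => u; rewrite dot0R expR0.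
rewrite E1 in i1 e1; have -> : (fun _ : 'rV[R]_d => c) = (fun u => c * (fun=> 1) u).
  by apply: funext => u; rewrite mulr1.
split; first exact: gintZ.
by rewrite gexpZ // e1 enorm0 expr0n mulr0 expR0 mulr1.
Qed.

End gaussian.

Lemma measurable_sg {R : realType} : measurable_fun [set: R] (Num.sg : R -> R).
Proof.
rewrite (_ : Num.sg = (fun x => \1_(`]0, +oo[%classic) x - \1_(`]-oo, 0[%classic) x)).
  by apply: measurable_funB; exact: measurable_indic.
apply: funext => x; rewrite !indicE !mem_setE !in_itv /= andbT.
have [x0|x0|x0] := ltgtP x 0.
- by rewrite ltr0_sg // sub0r.
- by rewrite gtr0_sg // subr0.
- by rewrite x0 sgr0 subrr.
Qed.

(** The eighth power of [expR (- 1 / 8) >= 7 / 8] is still above [1 / 3]. *)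
Lemma expR1_le3 {R : realType} : expR 1 <= 3 :> R.
Proof.
have h : (7 / 8 : R) <= expR (- (8%:R^-1)).
  by apply: le_trans (expR_ge1Dx _); lra.
rewrite -[leLHS]invrK -expRN invf_ple ?posrE ?expR_gt0 //.
rewrite (_ : -1 = 8%:R * - (8%:R^-1)); last by lra.
rewrite expRM_natl; apply: le_trans (_ : (7 / 8) ^+ 8 <= _); first lra.
by apply: lerXn2r => //; rewrite nnegrE ?expR_ge0 //; lra.
Qed.

(** * Reflection coupling of two Gaussians with the same covariance *)

Section reflection_coupling.
Context {R : realType} {d : nat}.
Variables (mu : {measure set Rd R d -> \bar R}) (Hmu : is_lebesgue mu).
Variables (g : R) (g0 : 0 < g) (a b : 'rV[R]_d) (ab : a != b).
Local Notation E := (Rd_measurableType R d).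

Let dist := enorm (a - b).
Let dist0 : 0 < dist. Proof. by rewrite enorm_gt0 // subr_eq0. Qed.
Let e := dist^-1 *: (a - b).
Let e1 : enorm e = 1.
Proof. by rewrite enormZ ger0_norm ?invr_ge0 ?ltW // mulVf // gt_eqF. Qed.
Let abE : a - b = dist *: e.
Proof. by rewrite scalerA divff ?scale1r // gt_eqF. Qed.

(* signed distance between [u] and its mirror image in the bisecting hyperplane of [a] and [b] *)
Definition sdist (u : 'rV[R]_d) : R := dist + 2 * dotR (u - a) e.

Definition mirror (u : 'rV[R]_d) : 'rV[R]_d := u - sdist u *: e.

Lemma sdistE u : sdist u = 2 * dotR u e - dotR (a + b) e.
Proof.
have dE : dist = dotR (a - b) e by rewrite abE dotRZl dotRxx e1; ring.
by rewrite /sdist dE !dotRE'; ring.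
Qed.

Lemma mirrorE u : mirror u = refl e (u + (- dotR (a + b) e) *: e).
Proof.
rewrite /mirror /refl sdistE (dotRDl u) (dotRZl _ e e) dotRxx e1 -addrA -scalerBl; congr (_ + _).
by rewrite -[LHS]scaleNr; congr (_ *: _); ring.
Qed.

Lemma sdist_mirror u : sdist (mirror u) = - sdist u.
Proof. by rewrite /mirror !sdistE (dotRBl u) (dotRZl _ e e) dotRxx e1; ring. Qed.

Lemma mirrorK u : mirror (mirror u) = u.
Proof. by rewrite {1}/mirror sdist_mirror /mirror scaleNr opprK subrK. Qed.

Lemma mirror_sub u v : mirror u - mirror v = refl e (u - v).
Proof. by rewrite !mirrorE -reflB opprD addrACA subrr addr0. Qed.

Lemma mirrora : mirror a = b.
Proof. by rewrite /mirror /sdist subrr dot0R mulr0 addr0 -abE subKr. Qed.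

Lemma mirrorb : mirror b = a.
Proof. by rewrite -mirrora mirrorK. Qed.

Lemma enorm_mirror u : enorm (u - mirror u) = `|sdist u|.
Proof. by rewrite /mirror subKr enormZ e1 mulr1. Qed.

Lemma gdens_mirror u : gdens g a (mirror u) = gdens g b u.
Proof. by rewrite /gdens -{1}mirrorb mirror_sub enorm_refl. Qed.

Lemma gdens_mirror' u : gdens g b (mirror u) = gdens g a u.
Proof. by rewrite -gdens_mirror mirrorK. Qed.

(** The difference [enorm (u - b) ^+ 2 - enorm (u - a) ^+ 2] equals [dist * sdist u], so the sign of
    [sdist] tells which centre is nearer. *)
Lemma gdens_sdist u : 0 <= sdist u -> gdens g b u <= gdens g a u.
Proof.
have g4 : 0 <= (4 * g)^-1 by rewrite invr_ge0 mulr_ge0 // ltW.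
move=> su; rewrite ler_wpM2l ?powR_ge0 // ler_expR ler_wpM2r //.
rewrite lerN2 [leRHS](_ : _ = enorm (u - a) ^+ 2 + dist * sdist u).
  by rewrite lerDl mulr_ge0 // ltW.
rewrite (_ : u - b = (u - a) + dist *: e); last by rewrite -abE addrA subrK.
rewrite enorm_sqrD enormZ e1 dotRZr /sdist mulr1 real_normK ?num_real //; ring.
Qed.

Lemma measurable_sdist : measurable_fun setT (sdist : E -> R).
Proof.
apply: measurable_funD => //; apply: measurable_funM => //.
exact: (measurable_dotR _ (cst e) (measurable_subcst a)).
Qed.

Lemma measurable_mirror : measurable_fun setT (mirror : E -> Rd R d).
Proof.
apply: measurable_subRd; first exact: measurable_idRd.
by apply: (measurable_scaleRd _ (cst e)) => //; exact: measurable_sdist.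
Qed.

Lemma ge0_integral_mirror (f : Rd R d -> \bar R) :
  measurable_fun setT f -> (forall x, 0 <= f x)%E ->
  (\int[mu]_x f (mirror x) = \int[mu]_x f x)%E.
Proof.
move=> mf f0.
have mfr : measurable_fun setT (fun x : E => f (refl e x)).
  by apply: (measurableT_comp mf); exact: (measurable_refl e (fun x : E => x)).
apply: etrans (ge0_integral_refl mu Hmu e e1 f mf f0).
apply: etrans (ge0_integral_shift mu Hmu ((- dotR (a + b) e) *: e) _ mfr (fun x => f0 _)).
by apply: eq_integral => x _; rewrite mirrorE.
Qed.

Lemma gint_mirror (f : 'rV[R]_d -> R) : gint mu g b f -> gint mu g a (f \o mirror).
Proof.
move=> [mf i_f]; split; first exact: (measurableT_comp mf measurable_mirror).
rewrite (_ : EFin \o _ = (EFin \o (fun u : E => f u * gdens g b u)) \o mirror).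
  exact: (integrable_invariant mu mirror measurable_mirror ge0_integral_mirror _ i_f).
by apply: funext => u /=; rewrite gdens_mirror'.
Qed.

Lemma gint_mirror' (f : 'rV[R]_d -> R) : gint mu g a f -> gint mu g b (f \o mirror).
Proof.
move=> [mf i_f]; split; first exact: (measurableT_comp mf measurable_mirror).
rewrite (_ : EFin \o _ = (EFin \o (fun u : E => f u * gdens g a u)) \o mirror).
  exact: (integrable_invariant mu mirror measurable_mirror ge0_integral_mirror _ i_f).
by apply: funext => u /=; rewrite gdens_mirror.
Qed.

Lemma gexp_mirror (f : 'rV[R]_d -> R) : measurable_fun setT (f : E -> R) ->
  gexp mu g a (f \o mirror) = gexp mu g b f.
Proof.
move=> mf; rewrite /gexp /Rintegral.
have mfg : measurable_fun setT (fun u : Rd R d => (f u * gdens g b u)%:E).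
  by apply/measurable_EFinP; apply: measurable_funM => //; exact: measurable_gdens1.
rewrite -(integral_invariant mu mirror ge0_integral_mirror _ mfg).
by under eq_integral do rewrite -gdens_mirror'.
Qed.

(** The mirror map exchanges the two Gaussians, so an odd [h] has opposite means under them. Twice
    the mean under [a] is thus the integral of [h] against the difference of the densities, and both
    factors have the sign of [sdist]. *)
Lemma gexp_odd_ge0 (h : 'rV[R]_d -> R) : gint mu g a h -> gint mu g b h ->
  (forall u, h (mirror u) = - h u) -> (forall u, 0 < sdist u -> 0 <= h u) ->
  0 <= gexp mu g a h.
Proof.
move=> [mh ia] [_ ib] odd_h h0.
have : 0 <= gexp mu g a h - gexp mu g b h.
  rewrite /gexp -(RintegralB measurableT ia ib); apply: Rintegral_ge0 => u _.
  rewrite -mulrBr; have [su|su|su] := ltgtP 0 (sdist u).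
  - by rewrite mulr_ge0 ?h0 // subr_ge0 gdens_sdist // ltW.
  - rewrite -mulrNN mulr_ge0 //.
      by rewrite -odd_h h0 // sdist_mirror oppr_gt0.
    rewrite opprB subr_ge0 -gdens_mirror -(gdens_mirror' u) gdens_sdist //.
    by rewrite sdist_mirror oppr_ge0 ltW.
  - have -> : gdens g a u = gdens g b u; last by rewrite subrr mulr0.
    by rewrite -(gdens_mirror u) /mirror -su scale0r subr0.
rewrite -gexp_mirror // (_ : h \o mirror = (fun u => -1 * h u)); last first.
  by apply: funext => u; rewrite /= odd_h mulN1r.
by rewrite gexpZ // mulN1r opprK -mulr2n pmulrn_lge0.
Qed.

Opaque gint gexp.

(** No joint law is constructed. The odd function [D u = f u - f (mirror u)] has mean
    [gexp mu g a f - gexp mu g b f], and on the half space [0 < sdist u] it is dominated by [G + S],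
    the odd extension of the assumed bound; [gexp_odd_ge0] compares the means. *)
Lemma reflection_coupling (f W : 'rV[R]_d -> R) (F : R -> R) (ep : R) :
  gint mu g a f -> gint mu g b f -> gint mu g a W -> gint mu g b W ->
  measurable_fun setT F -> (forall t, 0 <= F t <= 2) -> 0 <= ep -> (forall u, 0 <= W u) ->
  (forall u v, u != v -> `|f u - f v| <= F (enorm (u - v)) + ep * (W u + W v)) ->
  `|gexp mu g a f - gexp mu g b f| <=
     gexp mu g a (fun u => Num.sg (sdist u) * F `|sdist u|) +
     ep * (gexp mu g a W + gexp mu g b W).
Proof.
move=> ifa ifb iWa iWb mF F2 ep0 W0 fF.
pose D u := f u - f (mirror u).
pose V u := ep * (W u + W (mirror u)).
pose G u := Num.sg (sdist u) * F `|sdist u|.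
pose S u := Num.sg (sdist u) * V u.
have msg : measurable_fun setT ((fun u => Num.sg (sdist u)) : E -> R).
  apply: (measurableT_comp _ measurable_sdist); exact: measurable_sg.
have iDa : gint mu g a D by exact: gintB ifa (gint_mirror _ ifb).
have iDb : gint mu g b D by exact: gintB ifb (gint_mirror' _ ifa).
have iWTa := gint_mirror _ iWb.
have iVa : gint mu g a V by exact: (gintZ _ _ _ _ _ (gintD _ _ _ _ _ iWa iWTa)).
have iVb : gint mu g b V by exact: (gintZ _ _ _ _ _ (gintD _ _ _ _ _ iWb (gint_mirror' _ iWa))).
have V0 u : 0 <= V u by rewrite mulr_ge0 // addr_ge0.
have mG : measurable_fun setT (G : E -> R).
  apply: measurable_funM => //; apply: (measurableT_comp mF).
  by apply: measurableT_comp => //; exact: measurable_sdist.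
have G2 u : `|G u| <= 2.
  have /andP[h1 h2] := F2 `|sdist u|.
  rewrite normrM normr_sg (ger0_norm h1).
  by case: (sdist u != 0); rewrite ?mul1r ?mul0r.
have iG c : gint mu g c G by apply: gint_dom mG (gexp_cst mu Hmu g c 2 g0).1 G2.
have mS : measurable_fun setT (S : E -> R) by apply: measurable_funM => //; exact: gint_measurable iVa.
have SV u : `|S u| <= V u.
  rewrite normrM normr_sg (ger0_norm (V0 u)).
  by case: (sdist u != 0); rewrite ?mul1r ?mul0r.
have iSa : gint mu g a S by apply: gint_dom mS iVa SV.
have iSb : gint mu g b S by apply: gint_dom mS iVb SV.
(* Applied with [c = 1] and [c = -1], this bounds the absolute value. [S] is then replaced by
   [V >= S], whose mean under [a] splits into the means of [W] under [a] and under [b]. *)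
have main (c : R) : `|c| = 1 -> c * gexp mu g a D <= gexp mu g a G + ep * (gexp mu g a W + gexp mu g b W).
  move=> c1.
  have : 0 <= gexp mu g a (fun u => (G u + S u) - c * D u).
    apply: gexp_odd_ge0.
    - exact: gintB (gintD _ _ _ _ _ (iG a) iSa) (gintZ _ _ _ c _ iDa).
    - exact: gintB (gintD _ _ _ _ _ (iG b) iSb) (gintZ _ _ _ c _ iDb).
    - move=> u; rewrite /G /S /D /V sdist_mirror mirrorK sgrN normrN (addrC (W _)); ring.
    - move=> u su; rewrite /G /S gtr0_sg // !mul1r subr_ge0 (gtr0_norm su).
      apply: (le_trans (ler_norm _)); rewrite normrM c1 mul1r.
      have := fF u (mirror u); rewrite enorm_mirror (gtr0_norm su); apply.
      apply: contraTneq su => uT; have := sdist_mirror u.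
      by rewrite -uT => h; rewrite (_ : sdist u = 0) ?ltxx //; lra.
  rewrite (gexpB _ _ _ _ _ (gintD _ _ _ _ _ (iG a) iSa) (gintZ _ _ _ c _ iDa)).
  rewrite (gexpD _ _ _ _ _ (iG a) iSa) (gexpZ _ _ _ c _ iDa) subr_ge0 => h; apply: (le_trans h); rewrite lerD2l.
  have : gexp mu g a S <= gexp mu g a V.
    by apply: (le_gexp _ _ _ _ _ iSa iVa) => u; apply: le_trans (SV u); exact: ler_norm.
  move=> /le_trans; apply.
  rewrite (gexpZ _ _ _ _ _ (gintD _ _ _ _ _ iWa iWTa)) (gexpD _ _ _ _ _ iWa iWTa).
  by rewrite (gexp_mirror W) //; exact: gint_measurable iWa.
have DE : gexp mu g a f - gexp mu g b f = gexp mu g a D.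
  rewrite -(gexp_mirror f); last exact: gint_measurable ifa.
  by rewrite -(gexpB _ _ _ _ _ ifa (gint_mirror _ ifb)).
rewrite DE ler_norml; apply/andP; split.
  rewrite lerNl -mulN1r; apply: main; exact: normrN1.
by rewrite -[leLHS]mul1r; apply: main; exact: normr1.
Qed.

(* The exponential correction takes care of the region [s < -1 / lam], which is exponentially unlikely as the step [g] tends to 0 *)
Lemma odd_profile_le (lam th s : R) : 0 < lam -> 0 < th ->
  Num.sg s * (2 - expR (- lam * `|s|)) <=
  2 - expR (- lam * s) + expR (- th / lam) * expR (- (lam + th) * s).
Proof.
move=> l0 t0; have P := expR_ge0.
have Q0 : 0 <= expR (- th / lam) * expR (- (lam + th) * s) by rewrite mulr_ge0.
have [s0|s0|<-] := ltgtP 0 s.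
- by rewrite gtr0_sg // gtr0_norm // mul1r lerDl.
- rewrite ltr0_sg // ltr0_norm //.
  set t := - s; have t1 : 0 < t by rewrite oppr_gt0.
  have -> : - lam * s = lam * t by rewrite /t; ring.
  have [h|h] := leP (lam * t) 1.
    suff : expR (lam * t) + expR (- lam * t) <= 4 by move: Q0; lra.
    have h1 : expR (lam * t) <= 3.
      apply: (@le_trans _ _ (expR 1)); first by rewrite ler_expR.
      by exact: expR1_le3.
    have h2 : expR (- lam * t) <= 1 by rewrite -expR0 ler_expR mulNr oppr_le0 mulr_ge0 ?ltW.
    lra.
  have h2 : expR (- lam * t) <= 1 by rewrite -expR0 ler_expR mulNr oppr_le0 mulr_ge0 ?ltW.
  suff : expR (lam * t) <= expR (- th / lam) * expR (- (lam + th) * s) by lra.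
  rewrite -expRD ler_expR.
  have -> : - th / lam + - (lam + th) * s = lam * t + th / lam * (lam * t - 1).
    by rewrite /t; field; rewrite gt_eqF.
  by rewrite lerDl mulr_ge0 ?divr_ge0 ?ltW // subr_gt0.
- by rewrite sgr0 mul0r !mulr0 expR0 mulr1; have := P R (- th / lam); lra.
Qed.

(** Under the Gaussian at [a], [sdist] is normal with mean [dist] and variance [8 * g]; this is its
    Laplace transform. *)
Lemma gexp_sdist (k : R) :
  gint mu g a (fun u => expR (- k * sdist u)) /\
  gexp mu g a (fun u => expR (- k * sdist u)) = expR (- k * dist + 4 * g * k ^+ 2).
Proof.
have [i1 e1'] := gexp_lin mu Hmu g a ((- 2 * k) *: e) g0.
have EE : (fun u => expR (- k * sdist u)) =
    (fun u => expR (- k * dist) * expR (dotR ((- 2 * k) *: e) (u - a))).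
  apply: funext => u; rewrite -expRD; congr expR.
  by rewrite /sdist dotRZl (dotRC e); ring.
rewrite EE; split; first exact: gintZ _ _ _ _ _ i1.
rewrite (gexpZ _ _ _ _ _ i1) e1' -expRD; congr expR.
by rewrite enormZ e1 mulr1 real_normK ?num_real //; ring.
Qed.

(** Expectation of [odd_profile_le]. The decay in [dist] of the correction term is given away. *)
Lemma gexp_profile_le (lam th : R) : 0 < lam -> 0 < th ->
  gexp mu g a (fun u => Num.sg (sdist u) * (2 - expR (- lam * `|sdist u|))) <=
  2 - expR (- lam * dist + 4 * g * lam ^+ 2) + expR (- th / lam + 4 * g * (lam + th) ^+ 2).
Proof.
move=> l0 t0.
have [il el] := gexp_sdist lam; have [it et] := gexp_sdist (lam + th).
have [i2 e2] := gexp_cst mu Hmu g a 2 g0.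
have i3 := gintZ mu g a (expR (- th / lam)) _ it.
have i4 := gintB _ _ _ _ _ i2 il.
apply: (@le_trans _ _ (gexp mu g a (fun u => 2 - expR (- lam * sdist u) +
   expR (- th / lam) * expR (- (lam + th) * sdist u)))).
  apply: le_gexp; last by move=> u; exact: odd_profile_le.
    apply: gint_dom (_ : gint mu g a (fun=> 2)) _ => //.
      apply: measurable_funM.
        apply: (measurableT_comp _ measurable_sdist); exact: measurable_sg.
      apply: measurable_funB => //; apply: measurableT_comp => //.
      by apply: measurable_funM => //; apply: measurableT_comp => //; exact: measurable_sdist.
    move=> u; rewrite normrM normr_sg.
    have h1 : expR (- lam * `|sdist u|) <= 1.
      by rewrite -expR0 ler_expR mulNr oppr_le0 mulr_ge0 // ltW.
    have h2 := expR_ge0 (- lam * `|sdist u|).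
    rewrite ger0_norm; last by lra.
    by case: (sdist u != 0); rewrite ?mul1r ?mul0r //; lra.
  exact: gintD i4 i3.
rewrite (gexpD _ _ _ _ _ i4 i3) (gexpB _ _ _ _ _ i2 il) (gexpZ _ _ _ _ _ it) e2 el et lerD2l -expRD ler_expR.
have : 0 <= (lam + th) * dist by rewrite mulr_ge0 // ?addr_ge0 // ltW.
lra.
Qed.

End reflection_coupling.

(** * The potential and the acceptance ratio *)

Section mean_value.
Context {R : realType}.
Implicit Types (f df : R -> R).

Lemma mean_value f df (a b : R) : a <= b ->
  (forall t : R, is_derive t (1 : R) f (df t)) ->
  exists2 c, a <= c <= b & f b - f a = df c * (b - a).
Proof.
move=> ab fd; have [|c] := @MVT_segment R f df a b ab (fun t _ => fd t).
  apply: continuous_subspaceT => t; apply: differentiable_continuous.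
  by apply/derivable1_diffP; case: (fd t).
by rewrite in_itv /= => cab E; exists c.
Qed.

Lemma derive_ge0_le f df (a b : R) : a <= b ->
  (forall t : R, is_derive t (1 : R) f (df t)) -> (forall t, a <= t <= b -> 0 <= df t) -> f a <= f b.
Proof.
move=> ab fd df0; have [c cab E] := mean_value f df a b ab fd.
by rewrite -subr_ge0 E mulr_ge0 ?subr_ge0 ?df0.
Qed.
End mean_value.

Section bilinear.
Context {R : realType} {d : nat}.
Implicit Types (H : 'M[R]_d) (x y z : 'rV[R]_d) (a : R).

Lemma bilinE H y z : bilin H y z = dotR (y *m H) z.
Proof. by rewrite /bilin [LHS]mxE; apply: eq_bigr => j _; rewrite [z^T _ _]mxE. Qed.

Lemma bilinDl H x y z : bilin H (x + y) z = bilin H x z + bilin H y z.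
Proof. by rewrite !bilinE mulmxDl dotRDl. Qed.

Lemma bilinZl H a x z : bilin H (a *: x) z = a * bilin H x z.
Proof. by rewrite !bilinE -scalemxAl dotRZl. Qed.

Lemma bilinDr H x y z : bilin H x (y + z) = bilin H x y + bilin H x z.
Proof. by rewrite !bilinE dotRDr. Qed.

Lemma bilinZr H a x z : bilin H x (a *: z) = a * bilin H x z.
Proof. by rewrite !bilinE dotRZr. Qed.

Lemma bilinNl H x z : bilin H (- x) z = - bilin H x z.
Proof. by rewrite -scaleN1r bilinZl mulN1r. Qed.

Lemma bilinNr H x z : bilin H x (- z) = - bilin H x z.
Proof. by rewrite -scaleN1r bilinZr mulN1r. Qed.

(* Polarisation: [4 H(y,z) = H(y+z,y+z) - H(y-z,y-z)] *)
Lemma bilin_psd_le H (h : R) : (forall y z, bilin H y z = bilin H z y) ->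
  (forall y, 0 <= bilin H y y <= h * enorm y ^+ 2) ->
  forall y z, bilin H y z <= h * enorm y * enorm z.
Proof.
move=> symH psd.
have unit y z : enorm y = 1 -> enorm z = 1 -> bilin H y z <= h.
  move=> y1 z1; have /andP[_ h1] := psd (y + z); have /andP[h2 _] := psd (y - z).
  have h3 : enorm (y + z) ^+ 2 <= 4.
    by rewrite enorm_sqrD y1 z1; have := dotR_le y z; rewrite y1 z1; lra.
  have h0 : 0 <= h by have /andP[p q] := psd y; move: q; rewrite y1 expr1n mulr1; exact: le_trans.
  move: h1 h2; rewrite !(bilinDl, bilinDr, bilinNl, bilinNr) (symH z y) => h1 h2.
  by have : h * enorm (y + z) ^+ 2 <= h * 4 by [rewrite ler_wpM2l]; lra.
move=> y z.
have [->|y0] := eqVneq y 0; first by rewrite -(scale0r 0) bilinZl mul0r enormZ normr0 !(mul0r, mulr0).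
have [->|z0] := eqVneq z 0; first by rewrite -(scale0r 0) bilinZr mul0r enormZ normr0 !(mul0r, mulr0).
have y1 := enorm_gt0 _ y0; have z1 := enorm_gt0 _ z0.
have := unit ((enorm y)^-1 *: y) ((enorm z)^-1 *: z).
rewrite !enormZ !ger0_norm ?invr_ge0 ?enorm_ge0 // !mulVf ?gt_eqF // => /(_ erefl erefl).
by rewrite bilinZl bilinZr mulrA -invfM mulrC ler_pdivrMr ?mulr_gt0 // mulrA.
Qed.
End bilinear.

(** * Derivatives along lines *)

Section line_derivatives.
Context {R : realType} {d : nat}.

Lemma is_derive_line {V : normedModType R} (f : 'rV[R]_d -> V) (x v : 'rV[R]_d) (t : R) df :
  is_diff (x + t *: v) f df -> is_derive t (1 : R) (fun s : R => f (x + s *: v)) (df v).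
Proof.
move=> fd.
have E : (fun h : R => h^-1 *: (((fun s : R => f (x + s *: v)) \o shift t) (h *: (1 : R)) - f (x + t *: v))) =
  (fun h : R => h^-1 *: ((f \o shift (x + t *: v)) (h *: v) - f (x + t *: v))).
  apply: funext => h; congr (_ *: (f _ - _)) => /=.
  have -> : h%:A = h :> R by rewrite -[RHS]mulr1.
  by rewrite scalerDl addrCA.
have fD : differentiable f (x + t *: v) by case: fd.
split; first by rewrite /derivable E; exact: diff_derivable.
by rewrite /derive E -/(derive f _ v) deriveE //; case: fd => _ ->.
Qed.

Lemma is_diff_linear {V W : normedModType R} (l : {linear V -> W}) (x : V) :
  continuous l -> is_diff x l l.
Proof.
by move=> lc; apply: DiffDef; [exact: linear_differentiable|exact: diff_lin].
Qed.

Lemma continuous_sum_fin (T : topologicalType) (I : finType) (F : I -> T -> R) :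
  (forall i, continuous (F i)) -> continuous (fun y => \sum_i F i y).
Proof.
move=> cF; rewrite (_ : (fun y => _) = \sum_i F i); last by apply: funext => y; rewrite fct_sumE.
elim/big_ind: _ => [y|f g cf cg y|i _ //]; first exact: cvg_cst.
exact: cvgD (cf y) (cg y).
Qed.

(** These are the linear functionals of a matrix. [dotR _ w] is the case of a single row and
    [bilin _ y z] the case [c = y^T *m z], so both get their chain rule from one argument. *)
Lemma coordsum_continuous m n (c : 'M[R]_(m, n)) :
  continuous (fun y : 'M[R]_(m, n) => \sum_i \sum_j y i j * c i j).
Proof.
apply: continuous_sum_fin => i; apply: continuous_sum_fin => j y.
have cc := @coord_continuous R m n i j y.
by apply: (@cvgMr_tmp R _ (nbhs y) _ (fun y : 'M[R]_(m, n) => y i j) _ _ cc).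
Qed.

Lemma coordsum_linear m n (c : 'M[R]_(m, n)) :
  linear (fun y : 'M[R]_(m, n) => \sum_i \sum_j y i j * c i j).
Proof.
move=> a x y; rewrite scaler_sumr -big_split; apply: eq_bigr => i _ /=.
rewrite scaler_sumr -big_split; apply: eq_bigr => j _ /=.
by rewrite !mxE mulrDl /GRing.scale /= mulrA.
Qed.

Lemma is_diff_coordsum m n (c : 'M[R]_(m, n)) (x : 'M[R]_(m, n)) :
  is_diff x (fun y : 'M[R]_(m, n) => \sum_i \sum_j y i j * c i j : R)
    (fun y => \sum_i \sum_j y i j * c i j).
Proof.
pose lM := GRing.isLinear.Build _ _ _ _ _ (coordsum_linear m n c).
pose l : {linear 'M[R]_(m, n) -> R} := HB.pack (fun y : 'M[R]_(m, n) => \sum_i \sum_j y i j * c i j) lM.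
exact: (@is_diff_linear _ _ l x (coordsum_continuous m n c)).
Qed.

Lemma is_derive_line_dotR (f : 'rV[R]_d -> 'rV[R]_d) (x v w : 'rV[R]_d) (t : R) df :
  is_diff (x + t *: v) f df ->
  is_derive t (1 : R) (fun s : R => dotR (f (x + s *: v)) w) (dotR (df v) w).
Proof.
move=> fd; have := is_diff_comp fd (is_diff_coordsum 1 d w (f (x + t *: v))).
move=> /is_derive_line; congr is_derive => /=; last by rewrite big_ord1.
by apply: funext => s /=; rewrite big_ord1.
Qed.

Lemma bilin_coord (H : 'M[R]_d) (y z : 'rV[R]_d) :
  bilin H y z = \sum_i \sum_j H i j * (y^T *m z) i j.
Proof.
rewrite bilinE /dotR exchange_big /=; apply: eq_bigr => j _.
rewrite mxE mulr_suml; apply: eq_bigr => i _; rewrite !mxE big_ord1 !mxE; ring.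
Qed.

Lemma is_derive_line_bilin (f : 'rV[R]_d -> 'M[R]_d) (x v y z : 'rV[R]_d) (t : R) df :
  is_diff (x + t *: v) f df ->
  is_derive t (1 : R) (fun s : R => bilin (f (x + s *: v)) y z) (bilin (df v) y z).
Proof.
move=> fd; have := is_diff_comp fd (is_diff_coordsum d d (y^T *m z) (f (x + t *: v))).
move=> /is_derive_line; congr is_derive => /=; last by rewrite bilin_coord.
by apply: funext => s /=; rewrite bilin_coord.
Qed.

End line_derivatives.

(** From [1 + l <= expR l]: lower bounds on the log acceptance ratio become upper bounds on the
    rejection probability. *)
Lemma one_sub_accept_le {R : realType} (l b : R) : 0 <= b -> - b <= l ->
  1 - Num.min 1 (expR l) <= b.
Proof.
move=> b0 bl; have h := expR_ge1Dx l.
by rewrite lerBlDr -lerBlDl le_min; apply/andP; split; lra.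
Qed.

Lemma unit_dir {R : realType} {d} (x : 'rV[R]_d) : x != 0 -> exists2 e, enorm e = 1 & x = enorm x *: e.
Proof.
move=> x0; have x1 := enorm_gt0 _ x0; exists ((enorm x)^-1 *: x).
  by rewrite enormZ ger0_norm ?invr_ge0 ?ltW // mulVf // gt_eqF.
by rewrite scalerA divff ?scale1r // gt_eqF.
Qed.

Lemma enorm_ray {R : realType} {d} (e : 'rV[R]_d) (s : R) : enorm e = 1 -> 0 <= s -> enorm (s *: e) = s.
Proof. by move=> e1 s0; rewrite enormZ e1 mulr1 ger0_norm. Qed.

Lemma divr_onepowR_le {R : realType} (c s t p : R) : 0 <= c -> 0 <= s -> s <= t -> 0 <= p ->
  c / (1 + powR t p) <= c / (1 + powR s p).
Proof.
move=> c0 s0 st p0; apply: ler_wpM2l => //; rewrite lef_pV2 ?posrE ?ltr_wpDr ?powR_ge0 //.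
by rewrite lerD2l; apply: ge0_ler_powR; rewrite // nnegrE // (le_trans s0).
Qed.

(** * Hessian and gradient estimates, log acceptance ratio *)

Section potential.
Context {R : realType} {d : nat}.
Variables (U : 'rV[R]_d -> R) (gradU : 'rV[R]_d -> 'rV[R]_d)
  (hessU : 'rV[R]_d -> 'M[R]_d) (D3U : 'rV[R]_d -> 'rV[R]_d -> 'M[R]_d) (L M : R).
Hypotheses
  (HD1 : forall x : 'rV[R]_d, is_diff x U (fun h => dotR (gradU x) h))
  (HD2 : forall x : 'rV[R]_d, is_diff x gradU (fun h => h *m hessU x))
  (HD3 : forall x : 'rV[R]_d, is_diff x hessU (D3U x))
  (Hgrad0 : gradU 0 = 0) (HL : 0 <= L)
  (Hhess : forall x y z, `|bilin (hessU x) y z| <= L * enorm y * enorm z)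
  (HM : 0 <= M)
  (HD3b : forall x h y z, `|bilin (D3U x h) y z| <= M * enorm h * enorm y * enorm z).

Lemma is_derive_U x v t :
  is_derive t (1 : R) (fun s : R => U (x + s *: v)) (dotR (gradU (x + t *: v)) v).
Proof. exact: is_derive_line (HD1 _). Qed.

Lemma is_derive_gradU x v w t :
  is_derive t (1 : R) (fun s : R => dotR (gradU (x + s *: v)) w) (bilin (hessU (x + t *: v)) v w).
Proof. by rewrite bilinE; exact: is_derive_line_dotR (HD2 _). Qed.

Lemma is_derive_hessU x v y z t :
  is_derive t (1 : R) (fun s : R => bilin (hessU (x + s *: v)) y z) (bilin (D3U (x + t *: v) v) y z).
Proof. exact: is_derive_line_bilin (HD3 _). Qed.

Lemma hess_lip x v y z :
  `|bilin (hessU (x + v)) y z - bilin (hessU x) y z| <= M * enorm v * enorm y * enorm z.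
Proof.
have [c _] := mean_value _ _ 0 1 ler01 (is_derive_hessU x v y z).
by rewrite scale1r scale0r addr0 subr0 mulr1 => ->.
Qed.

Lemma grad_mean_value x v w : exists2 c, 0 <= c <= 1 &
  dotR (gradU (x + v) - gradU x) w = bilin (hessU (x + c *: v)) v w.
Proof.
have [c c01] := mean_value _ _ 0 1 ler01 (is_derive_gradU x v w).
by rewrite scale1r scale0r addr0 subr0 mulr1 -dotRBl => E; exists c.
Qed.

(** The mean value theorem is applied to the scalar product with the increment itself, and one
    factor of its norm cancels. *)
Lemma grad_sub_le (h : R) x v : 0 <= h ->
  (forall c w, 0 <= c <= 1 -> bilin (hessU (x + c *: v)) v w <= h * enorm v * enorm w) ->
  enorm (gradU (x + v) - gradU x) <= h * enorm v.
Proof.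
move=> h0 H; set w := gradU (x + v) - gradU x.
have [c c01 E] := grad_mean_value x v w.
have := H c w c01; rewrite -E dotRxx expr2.
have [->|w0] := eqVneq w 0; first by rewrite enorm0 mulr_ge0 ?enorm_ge0.
by rewrite ler_pM2r // enorm_gt0.
Qed.

Lemma grad_lip x v : enorm (gradU (x + v) - gradU x) <= L * enorm v.
Proof.
apply: grad_sub_le => // c w _.
by apply: le_trans (Hhess _ _ _); exact: ler_norm.
Qed.

Lemma grad_le x : enorm (gradU x) <= L * enorm x.
Proof. by have := grad_lip 0 x; rewrite add0r Hgrad0 subr0. Qed.

(** Two mean value theorems: one in direction [h] for the difference of [U] on two parallel
    segments, then one in direction [k] for the gradient. *)
Lemma hess_second_difference x h k (s : R) : 0 < s ->
  exists2 v, enorm v <= s * (enorm h + enorm k) &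
  U (x + s *: h + s *: k) - U (x + s *: h) - U (x + s *: k) + U x =
    s ^+ 2 * bilin (hessU (x + v)) k h.
Proof.
move=> s0.
have dd t : is_derive t (1 : R) (fun s' : R => U ((x + s *: k) + s' *: h) - U (x + s' *: h))
    (dotR (gradU (x + s *: k + t *: h)) h - dotR (gradU (x + t *: h)) h).
  exact: is_deriveB (is_derive_U (x + s *: k) h t) (is_derive_U x h t).
have [c /andP[c0 cs]] := mean_value _ _ 0 s (ltW s0) dd.
rewrite !scale0r !addr0 subr0 -dotRBl => E1.
have [e /andP[e0 e1]] := mean_value _ _ 0 s (ltW s0) (is_derive_gradU (x + c *: h) k h).
rewrite !scale0r !addr0 subr0 -dotRBl => E2.
exists (c *: h + e *: k).
  apply: le_trans (enormD _ _) _; rewrite !enormZ !ger0_norm // mulrDr.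
  by apply: lerD; rewrite ler_wpM2r ?enorm_ge0.
rewrite addrA.
have -> : x + s *: h + s *: k = x + s *: k + s *: h by rewrite addrAC.
have -> : U (x + s *: k + s *: h) - U (x + s *: h) - U (x + s *: k) + U x =
  (U (x + s *: k + s *: h) - U (x + s *: h)) - (U (x + s *: k) - U x) by ring.
rewrite E1 (_ : x + s *: k + c *: h = x + c *: h + s *: k); last by rewrite addrAC.
by rewrite E2; ring.
Qed.

(** Schwarz's theorem. The second difference is symmetric in the two directions, so the forms agree
    at two points within [s * (enorm y + enorm z)] of [x]; [hess_lip] lets [s] tend to 0. *)
Lemma hess_sym x y z : bilin (hessU x) y z = bilin (hessU x) z y.
Proof.
apply/eqP; rewrite -subr_eq0 -normr_le0; apply/ler_addgt0Pl => ep ep0; rewrite addr0.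
pose K := 2 * M * (enorm y + enorm z) * enorm y * enorm z.
have N0 := @enorm_ge0 R d.
have K0 : 0 <= K by rewrite !mulr_ge0 // addr_ge0.
pose s := ep / (K + 1); have s0 : 0 < s by rewrite divr_gt0 // ltr_wpDl.
have [v vs E1] := hess_second_difference x z y s s0.
have [w ws E2] := hess_second_difference x y z s s0.
have EE : bilin (hessU (x + v)) y z = bilin (hessU (x + w)) z y.
  apply: (mulfI (_ : s ^+ 2 != 0)); first by rewrite expf_eq0 gt_eqF.
  by rewrite -E1 -E2 (addrAC x (s *: z)); ring.
have h1 := hess_lip x v y z; have h2 := hess_lip x w z y.
have sK : s * K <= ep.
  by rewrite /s mulrAC ler_pdivrMr ?ltr_wpDl // ler_pM2l // lerDl.
have b1 : M * enorm v * enorm y * enorm z <= s * K / 2.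
  rewrite [leRHS](_ : _ = M * (s * (enorm z + enorm y)) * enorm y * enorm z); last by rewrite /K; field.
  by rewrite !ler_wpM2r // ler_wpM2l.
have b2 : M * enorm w * enorm z * enorm y <= s * K / 2.
  rewrite [leRHS](_ : _ = M * (s * (enorm y + enorm z)) * enorm z * enorm y); last by rewrite /K; field.
  by rewrite !ler_wpM2r // ler_wpM2l.
move: h1 h2; rewrite EE !ler_norml => /andP[p1 p2] /andP[p3 p4].
by apply/andP; split; lra.
Qed.

(* Bregman divergence seen from the far end of the segment *)
Lemma strong_convexity x v (a : R) :
  (forall c, 0 <= c <= 1 -> a * enorm v ^+ 2 <= bilin (hessU (x + c *: v)) v v) ->
  a / 2 * enorm v ^+ 2 <= U x - U (x + v) + dotR (gradU (x + v)) v.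
Proof.
move=> H.
pose f (t : R) := - U (x + t *: v) + t * dotR (gradU (x + t *: v)) v - a / 2 * enorm v ^+ 2 * t ^+ 2.
pose df (t : R) := t * (bilin (hessU (x + t *: v)) v v - a * enorm v ^+ 2).
have fd (t : R) : is_derive t (1 : R) f (df t).
  have d1 := is_derive_U x v t; have d2 := is_derive_gradU x v v t.
  have d3 := is_deriveM (is_derive_id t (1 : R)) d2.
  have d4 := is_deriveX 2 (is_derive_id t (1 : R)).
  have d5 := is_deriveB (is_deriveD (is_deriveN d1) d3) (is_deriveZ (a / 2 * enorm v ^+ 2) d4).
  by apply: is_derive_eq d5 _; rewrite /df /GRing.scale /= expr1; field.
have f01 : f 0 <= f 1.
  apply: (derive_ge0_le f df) => // t t01; rewrite /df mulr_ge0 //; first by case/andP: t01.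
  by rewrite subr_ge0 H.
move: f01; rewrite /f scale0r scale1r addr0 expr0n expr1n mul0r mulr0 mul1r mulr1; lra.
Qed.

(** Seen as a function of the end point [t], the trapezoidal error has derivative [t / 2] times the
    difference of two second derivatives on the segment, which [hess_lip] controls. *)
Lemma trapezoid_ge x v :
  - (M / 2 * enorm v ^+ 3) <= U x - U (x + v) + dotR (gradU x + gradU (x + v)) v / 2.
Proof.
pose f (t : R) := - U (x + t *: v) + 2^-1 * (t * (dotR (gradU x) v + dotR (gradU (x + t *: v)) v)).
pose df (t : R) := - dotR (gradU (x + t *: v)) v + 2^-1 * (t * bilin (hessU (x + t *: v)) v v +
  (dotR (gradU x) v + dotR (gradU (x + t *: v)) v)).
have fd (t : R) : is_derive t (1 : R) f (df t).
  have d1 := is_derive_U x v t.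
  have d2 := is_deriveD (is_derive_cst (dotR (gradU x) v) t (1 : R)) (is_derive_gradU x v v t).
  have d3 := is_deriveM (is_derive_id t (1 : R)) d2.
  have d5 := is_deriveD (is_deriveN d1) (is_deriveZ 2^-1 d3).
  by apply: is_derive_eq d5 _; rewrite /df !fctE /GRing.scale /=; field.
have [t /andP[t0 t1] E] := mean_value f df 0 1 ler01 fd.
have -> : U x - U (x + v) + dotR (gradU x + gradU (x + v)) v / 2 = df t.
  by rewrite -[RHS]mulr1 -[X in df t * X](subr0 1) -E /f scale0r scale1r addr0 dotRDl; field.
have [s /andP[s0 st]] := mean_value _ _ 0 t t0 (is_derive_gradU x v v).
rewrite scale0r addr0 subr0 => E2.
have -> : df t = t / 2 * (bilin (hessU (x + t *: v)) v v - bilin (hessU (x + s *: v)) v v).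
  rewrite /df; have -> : dotR (gradU (x + t *: v)) v = bilin (hessU (x + s *: v)) v v * t + dotR (gradU x) v by rewrite -E2 subrK.
  by field.
have := hess_lip (x + s *: v) ((t - s) *: v) v v.
rewrite -addrA -scalerDl (addrC s) subrK enormZ (ger0_norm (_ : 0 <= t - s)) ?subr_ge0 // => h.
have N0 := @enorm_ge0 R d v.
have V0 : 0 <= M * enorm v ^+ 3 by rewrite mulr_ge0 ?exprn_ge0.
have {}h : `|bilin (hessU (x + t *: v)) v v - bilin (hessU (x + s *: v)) v v| <= M * enorm v ^+ 3.
  apply: (le_trans h); rewrite [leLHS](_ : _ = (t - s) * (M * enorm v ^+ 3)); last by ring.
  by rewrite ler_piMl //; lra.
move: h; rewrite ler_norml => /andP[h _].
rewrite -mulNr; nra.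
Qed.

Variables (beta m_beta L_beta K_beta : R).
Hypotheses (Hbeta : 0 <= beta < 1)
  (Hmb : 0 < m_beta) (HLb : 0 <= L_beta) (HKb : 0 <= K_beta)
  (Hcurv : forall x y : 'rV[R]_d, K_beta <= enorm x -> enorm y = 1 ->
      bilin (hessU x) y y <= L_beta / (1 + powR (enorm x) (3 * beta / 4)) /\
      m_beta / (1 + powR (enorm x) beta) <= bilin (hessU x) y y).

Lemma curvature x y : K_beta <= enorm x ->
  m_beta / (1 + powR (enorm x) beta) * enorm y ^+ 2 <= bilin (hessU x) y y <=
  L_beta / (1 + powR (enorm x) (3 * beta / 4)) * enorm y ^+ 2.
Proof.
move=> xK; have [->|y0] := eqVneq y 0.
  by rewrite -(scale0r 0) bilinZl mul0r scale0r enorm0 expr0n !mulr0 lexx.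
have y1 := enorm_gt0 _ y0.
have [|h1 h2] := Hcurv x ((enorm y)^-1 *: y) xK.
  by rewrite enormZ ger0_norm ?invr_ge0 ?ltW // mulVf // gt_eqF.
have E : bilin (hessU x) ((enorm y)^-1 *: y) ((enorm y)^-1 *: y) = bilin (hessU x) y y / enorm y ^+ 2.
  by rewrite bilinZl bilinZr expr2 invfM; ring.
have y2 : 0 < enorm y ^+ 2 by rewrite exprn_gt0.
by move: h1 h2; rewrite E ler_pdivrMr // ler_pdivlMr // => -> ->.
Qed.

Lemma hess_psd x y : K_beta <= enorm x -> 0 <= bilin (hessU x) y y.
Proof.
move=> xK; have /andP[h _] := curvature x y xK; apply: le_trans h.
by rewrite mulr_ge0 ?sqr_ge0 // divr_ge0 ?addr_ge0 ?powR_ge0 // ltW.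
Qed.

(** Mean value theorem on the ray between the radii [K_beta] and [r]. The lower curvature bound is
    weakest at [r], and at radius [K_beta] the gradient is at most [L * K_beta]. *)
Lemma grad_ray_ge (e : 'rV[R]_d) (r : R) : enorm e = 1 -> K_beta <= r ->
  m_beta / (1 + powR r beta) * (r - K_beta) - L * K_beta <= dotR (gradU (r *: e)) e.
Proof.
move=> e1 rK; have /andP[b0 b1] := Hbeta.
have [c /andP[c0 cr]] := mean_value _ _ K_beta r rK (is_derive_gradU 0 e e).
rewrite !add0r => E.
have cE : enorm (c *: e) = c by rewrite enorm_ray //; exact: le_trans c0.
have /andP[h1 _] : m_beta / (1 + powR c beta) * enorm e ^+ 2 <= bilin (hessU (c *: e)) e e <=
   L_beta / (1 + powR c (3 * beta / 4)) * enorm e ^+ 2.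
  by have := curvature (c *: e) e; rewrite cE; apply.
have h2 : m_beta / (1 + powR r beta) <= m_beta / (1 + powR c beta).
  rewrite ler_pM2l // lef_pV2 ?posrE ?ltr_wpDr ?powR_ge0 // lerD2l.
  by apply: ge0_ler_powR; rewrite // nnegrE; [exact: le_trans c0|exact: le_trans rK].
have h3 : - (L * K_beta) <= dotR (gradU (K_beta *: e)) e.
  rewrite lerNl -dotRNl; apply: le_trans (dotR_le _ _) _; rewrite e1 mulr1 enormN.
  by apply: le_trans (grad_le _) _; rewrite enorm_ray.
rewrite e1 expr1n mulr1 in h1.
have h4 : m_beta / (1 + powR r beta) * (r - K_beta) <= bilin (hessU (c *: e)) e e * (r - K_beta).
  by rewrite ler_wpM2r ?subr_ge0 // (le_trans h2).
by lra.
Qed.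

(** The radial force of [grad_ray_ge] is of order [powR r (1 - beta)], which is unbounded because
    [beta < 1]. *)
Lemma grad_growth (B : R) : exists2 K, 1 <= K & forall x, K <= enorm x ->
  B * enorm x <= dotR (gradU x) x.
Proof.
have /andP[b0 b1] := Hbeta.
(* For large [r], [1 + powR r beta] is at most [2 * powR r beta] and [r - K_beta] at least [r / 2],
   whence the factor 4. The value [C] must be reached by [powR r (1 - beta)]. *)
pose C := Num.max 0 ((B + L * K_beta) * 4 / m_beta).
have C0 : 0 <= C by rewrite le_max lexx.
exists (Num.max 1 (Num.max (2 * K_beta) (powR C (1 - beta)^-1))); first by rewrite le_max lexx.
move=> x; rewrite !ge_max => /and3P[x1 xK xC].
have x0 : x != 0 by apply: contraTneq x1 => ->; rewrite enorm0 -ltNge.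
have [e e1 xe] := unit_dir _ x0; set r := enorm x in x1 xK xC xe *.
rewrite {1}xe {}xe dotRZr mulrC ler_pM2l; last by lra.
have rK : K_beta <= r by lra.
apply: le_trans (grad_ray_ge e r e1 rK).
have r0 : 0 < r by lra.
have P1 : 1 <= powR r beta by rewrite -(powRr0 r) ler_powR.
have CP : C <= r / powR r beta.
  have -> : r / powR r beta = powR r (1 - beta).
    by rewrite powRB ?gt_eqF ?implybT // powRr1 // ltW.
  have bN : 1 - beta != 0 by rewrite gt_eqF // subr_gt0.
  have : powR (powR C (1 - beta)^-1) (1 - beta) <= powR r (1 - beta).
    by apply: ge0_ler_powR; rewrite ?nnegrE ?powR_ge0 ?subr_ge0 // ltW.
  by rewrite -powRrM mulVf // powRr1.
have h : (B + L * K_beta) * 4 / m_beta <= r / powR r beta by apply: le_trans CP; rewrite le_max lexx orbT.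
rewrite lerBrDr.
apply: (@le_trans _ _ (m_beta / (2 * powR r beta) * (r / 2))).
  rewrite [leRHS](_ : _ = r / powR r beta * (m_beta / 4)); last by field; rewrite gt_eqF //; lra.
  by rewrite -ler_pdivrMr ?divr_gt0 // invf_div mulrA.
apply: ler_pM; [by rewrite divr_ge0 ?mulr_ge0 ?powR_ge0 // ltW|by rewrite divr_ge0 // ltW| |by lra].
by rewrite ler_pM2l // lef_pV2 ?posrE; lra.
Qed.

(** Nonnegativity of the Hessian form at [th *: e - w], divided by [2 * th]. The constant [L + 1]
    stays positive when [L = 0]. *)
Lemma hess_young (p e w : 'rV[R]_d) (th : R) : 0 < th -> K_beta <= enorm p ->
  bilin (hessU p) e w <= (th * bilin (hessU p) e e + (L + 1) * enorm w ^+ 2 / th) / 2.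
Proof.
move=> th0 pK; have h := hess_psd p (th *: e - w) pK.
rewrite !(bilinDl, bilinDr, bilinNl, bilinNr, bilinZl, bilinZr) (hess_sym p w e) in h.
have h2 : bilin (hessU p) w w <= (L + 1) * enorm w ^+ 2.
  apply: le_trans (ler_norm _) _; apply: le_trans (Hhess _ _ _) _.
  by rewrite -mulrA -expr2 ler_wpM2r ?sqr_ge0 // lerDl.
rewrite -(ler_pM2l th0).
rewrite [leRHS](_ : _ = (th * (th * bilin (hessU p) e e) + (L + 1) * enorm w ^+ 2) / 2); first by lra.
by field; rewrite gt_eqF.
Qed.

(* Integrating Young's inequality for the Hessian form along the ray gives the cocoercivity bound [|G|^2 <= (L+1)(r-K)<G,e>] of the gradient increment *)
Lemma grad_ray_cocoercive (e : 'rV[R]_d) (r : R) : enorm e = 1 -> K_beta < r ->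
  enorm (gradU (r *: e) - gradU (K_beta *: e)) ^+ 2 <=
    (L + 1) * (r - K_beta) * dotR (gradU (r *: e) - gradU (K_beta *: e)) e.
Proof.
move=> e1 rK; set G := gradU (r *: e) - gradU (K_beta *: e).
have L1 : 0 < L + 1 by rewrite ltr_wpDl.
pose th := (L + 1) * (r - K_beta); have th0 : 0 < th by rewrite mulr_gt0 // subr_gt0.
pose f (s : R) := 2^-1 * (th * dotR (gradU (s *: e)) e + (L + 1) * enorm G ^+ 2 / th * s) -
  dotR (gradU (s *: e)) G.
pose df (s : R) := 2^-1 * (th * bilin (hessU (s *: e)) e e + (L + 1) * enorm G ^+ 2 / th) -
  bilin (hessU (s *: e)) e G.
have fd (s : R) : is_derive s (1 : R) f (df s).
  have d1 := is_derive_gradU 0 e e s; have d2 := is_derive_gradU 0 e G s.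
  have d3 := is_deriveD (is_deriveZ th d1) (is_deriveZ ((L + 1) * enorm G ^+ 2 / th) (is_derive_id s (1 : R))).
  have d4 := is_deriveB (is_deriveZ 2^-1 d3) d2.
  have -> : f = 2^-1 \*: (th \*: (fun s0 : R => dotR (gradU (0 + s0 *: e)) e) +
     ((L + 1) * enorm G ^+ 2 / th) \*: id) - (fun s0 : R => dotR (gradU (0 + s0 *: e)) G).
    by apply: funext => t; rewrite /f !fctE /GRing.scale /= !add0r.
  by apply: is_derive_eq d4 _; rewrite /df /GRing.scale /= !add0r; ring.
have : f K_beta <= f r.
  apply: (derive_ge0_le _ _ _ _ (ltW rK) fd) => t /andP[t0 t1].
  have tK : K_beta <= enorm (t *: e) by rewrite enorm_ray //; exact: le_trans t0.
  by have := hess_young (t *: e) e G th th0 tK; rewrite /df; lra.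
have GE : dotR G G = dotR (gradU (r *: e)) G - dotR (gradU (K_beta *: e)) G by rewrite -dotRBl.
have GE2 : dotR G e = dotR (gradU (r *: e)) e - dotR (gradU (K_beta *: e)) e by rewrite -dotRBl.
have Q : (L + 1) * enorm G ^+ 2 / th * r - (L + 1) * enorm G ^+ 2 / th * K_beta = enorm G ^+ 2.
  have L1n : L + 1 != 0 by rewrite gt_eqF.
  have rKn : r - K_beta != 0 by rewrite gt_eqF // subr_gt0.
  by rewrite -mulrBr /th; field; rewrite ?L1n ?rKn.
rewrite /f -/th; move: GE GE2 Q; rewrite dotRxx.
set A := enorm G ^+ 2; set X1 := dotR _ G; set X2 := dotR _ G; set Y1 := dotR _ e; set Y2 := dotR _ e.
by move=> -> -> /eqP; rewrite subr_eq => /eqP -> ; lra.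
Qed.

(** This keeps the explicit gradient step from overshooting, for steps below a fixed size. The
    Hessian is known to be nonnegative only beyond radius [K_beta], so the increment is taken from
    that radius on, and the gradient there is at most [L * K_beta]. *)
Lemma grad_cocoercive : exists C K : R, [/\ 0 < C, 1 <= K & forall x, K <= enorm x ->
  enorm (gradU x) ^+ 2 <= C * dotR (gradU x) x].
Proof.
(* With this value of [B], the radial component of the gradient at [x] dominates the gradient at
   radius [K_beta]. *)
have [K0 K01 H] := grad_growth (1 + L * K_beta).
have L1 : 0 < L + 1 by rewrite ltr_wpDl.
exists (6 * (L + 1)), (K0 + K_beta); split; [by rewrite mulr_gt0|by rewrite ler_wpDr|].
move=> x xK; have xK0 : K0 <= enorm x by rewrite (le_trans _ xK) // lerDl.
have xKb : K_beta < enorm x by rewrite (lt_le_trans _ xK) // ltrDr; lra.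
have {H} := H x xK0.
have x0 : x != 0 by apply: contraTneq xKb => ->; rewrite enorm0 -leNgt.
have [e e1 xe] := unit_dir _ x0; set r := enorm x in xK xK0 xKb xe *.
rewrite xe dotRZr => H.
have r1 : 1 <= r by exact: le_trans xK0.
have r0 : 0 < r by lra.
have {}H : 1 + L * K_beta <= dotR (gradU (r *: e)) e by rewrite -(ler_pM2l r0); lra.
have := grad_ray_cocoercive e r e1 xKb; rewrite dotRBl.
set g := gradU (r *: e) in H *; set k := gradU (K_beta *: e); set p := dotR g e in H *.
have kL : enorm k <= L * K_beta by apply: le_trans (grad_le _) _; rewrite enorm_ray.
have kp : - dotR k e <= L * K_beta.
  by rewrite -dotRNl; apply: le_trans (dotR_le _ _) _; rewrite e1 mulr1 enormN.
move=> HG.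
have LK0 : 0 <= L * K_beta by rewrite mulr_ge0.
have k2 : enorm k ^+ 2 <= (L + 1) * r * p.
  apply: (@le_trans _ _ ((L * K_beta) * (L * K_beta))).
    by rewrite expr2; apply: ler_pM => //; exact: enorm_ge0.
  apply: ler_pM => //; last by lra.
  by apply: ler_pM => //; [lra|exact: ltW].
have g2 : enorm g ^+ 2 <= 2 * enorm (g - k) ^+ 2 + 2 * enorm k ^+ 2.
  have e3 := enorm_sqrD (g - k) k; rewrite subrK in e3.
  rewrite e3 -subr_ge0 [leRHS](_ : _ = enorm (g - k - k) ^+ 2) ?sqr_ge0 //.
  by rewrite (enorm_sqrB (g - k) k); ring.
have p0 : 0 <= p by lra.
have : (L + 1) * (r - K_beta) * (p - dotR k e) <= (L + 1) * r * (2 * p).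
  apply: ler_pM; [by rewrite mulr_ge0 ?subr_ge0 // ltW| | |lra].
    by have := dotR_le k e; rewrite e1 mulr1; lra.
  by rewrite ler_pM2l // gerBl.
move=> HH; have : enorm (g - k) ^+ 2 <= (L + 1) * r * (2 * p) by exact: le_trans HH.
move: k2 g2; set A := (L + 1) * r * p => k2 g2.
rewrite [X in _ <= X -> _](_ : _ = 2 * A) => [h3|]; last by rewrite /A; ring.
rewrite [leRHS](_ : _ = 6 * A); first by lra.
by rewrite /A; ring.
Qed.

(** Logarithm of the ratio in [alpha_acc]; the constant [Zpi] and the Gaussian normalisation
    cancel. *)
Definition lograt (g : R) (x y : 'rV[R]_d) : R :=
  U x - U y + (enorm (y - x + g *: gradU x) ^+ 2 - enorm (x - y + g *: gradU y) ^+ 2) / (4 * g).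

(** When the squares are expanded, the terms in [enorm v ^+ 2] cancel and the cross terms turn
    [U x - U (x + v)] into the error of the trapezoidal rule. This cancellation is why rejections
    are of order [g ^ (3/2)]. *)
Lemma lograt_trapezoid (g : R) x v : 0 < g -> lograt g x (x + v) =
  (U x - U (x + v) + dotR (gradU x + gradU (x + v)) v / 2) +
  g / 4 * (enorm (gradU x) ^+ 2 - enorm (gradU (x + v)) ^+ 2).
Proof.
move=> g0; rewrite /lograt (addrC x v) addrK opprD addrCA subrr addr0 (addrC v x).
rewrite (addrC (- v)) (enorm_sqrB _ v) enorm_sqrD !enormZ !exprMn real_normK ?num_real //.
by rewrite dotRDl !dotRZr dotRZl (dotRC v); field; rewrite gt_eqF.
Qed.

Lemma lograt_ge_near (g : R) x v : 0 < g ->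
  - (M / 2 * enorm v ^+ 3 + g / 4 * (L * enorm v * (2 * L * enorm x + L * enorm v)))
  <= lograt g x (x + v).
Proof.
move=> g0; rewrite lograt_trapezoid // opprD; apply: lerD; first exact: trapezoid_ge.
have g4 : 0 <= g / 4 by rewrite divr_ge0 // ltW.
rewrite -mulrN ler_wpM2l // lerNl opprB.
have N0 := @enorm_ge0 R d.
have h1 := grad_lip x v; have h2 := grad_le x; have h3 := grad_le (x + v).
have h4 := enormD x v.
have h5 : enorm (gradU (x + v)) - enorm (gradU x) <= L * enorm v.
  exact: le_trans (enorm_sub_le _ _) h1.
have h6 : enorm (gradU (x + v)) + enorm (gradU x) <= 2 * L * enorm x + L * enorm v.
  have : L * enorm (x + v) <= L * (enorm x + enorm v) by rewrite ler_wpM2l.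
  lra.
rewrite subr_sqr; have [h|h] := leP 0 (enorm (gradU (x + v)) - enorm (gradU x)).
  by apply: ler_pM => //; rewrite addr_ge0.
apply: (@le_trans _ _ 0); first by rewrite mulr_le0_ge0 ?addr_ge0 // ltW.
by rewrite mulr_ge0 ?addr_ge0 ?mulr_ge0.
Qed.

(** In terms of the noise [w], the ratio is the Bregman term of [strong_convexity] minus
    [dotR D w / 2] and [g / 4 * enorm D ^+ 2], with [enorm D <= h * enorm v]. Half of the Bregman
    term absorbs the last one since [g * h ^+ 2 <= a]; the other half completes a square with the
    mixed term. *)
Lemma lograt_ge_far (g : R) x v (a h : R) : 0 < g -> 0 < a -> 0 <= h -> g * h ^+ 2 <= a ->
  (forall c, 0 <= c <= 1 -> forall z,
     a * enorm z ^+ 2 <= bilin (hessU (x + c *: v)) z z <= h * enorm z ^+ 2) ->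
  - (h ^+ 2 / (4 * a) * enorm (v + g *: gradU x) ^+ 2) <= lograt g x (x + v).
Proof.
move=> g0 a0 h0 gh H; set w := v + g *: gradU x.
set D := gradU (x + v) - gradU x.
have E : lograt g x (x + v) = (U x - U (x + v) + dotR (gradU (x + v)) v) - dotR D w / 2 - g / 4 * enorm D ^+ 2.
  rewrite lograt_trapezoid // /D enorm_sqrB /w !dotRE' !dotRxx (dotRC (gradU (x + v)) (gradU x)).
  by field.
have h1 : a / 2 * enorm v ^+ 2 <= U x - U (x + v) + dotR (gradU (x + v)) v.
  by apply: strong_convexity => c c01; case/andP: (H c c01 v).
have h2 : enorm D <= h * enorm v.
  apply: grad_sub_le => // c z c01; apply: bilin_psd_le; first exact: hess_sym.
  move=> y; have /andP[p ->] := H c c01 y; rewrite andbT; apply: le_trans p.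
  by rewrite mulr_ge0 ?sqr_ge0 // ltW.
have N0 := @enorm_ge0 R d.
have h3 : dotR D w <= h * enorm v * enorm w.
  by apply: le_trans (dotR_le _ _) _; rewrite ler_wpM2r.
have h4 : g / 4 * enorm D ^+ 2 <= a / 4 * enorm v ^+ 2.
  apply: (@le_trans _ _ (g / 4 * (h * enorm v) ^+ 2)).
    by rewrite ler_wpM2l ?divr_ge0 ?(ltW g0) // lerXn2r // nnegrE ?mulr_ge0.
  rewrite exprMn [leLHS](_ : _ = g * h ^+ 2 * (enorm v ^+ 2 / 4)); last by field.
  rewrite [leRHS](_ : _ = a * (enorm v ^+ 2 / 4)); last by field.
  by rewrite ler_wpM2r // divr_ge0 ?sqr_ge0.
rewrite E; set V := enorm v in h1 h2 h3 h4 *; set W := enorm w in h3 *.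
have h5 : 0 <= a / 4 * V ^+ 2 - h * V * W / 2 + h ^+ 2 / (4 * a) * W ^+ 2.
  rewrite [leRHS](_ : _ = (a * V - h * W) ^+ 2 / (4 * a)); last by field; rewrite gt_eqF.
  by rewrite divr_ge0 ?sqr_ge0 ?mulr_ge0 // ltW.
lra.
Qed.

Definition reject (g : R) (x y : 'rV[R]_d) : R := 1 - Num.min 1 (expR (lograt g x y)).

Lemma rej_ge0 (g : R) x y : 0 <= reject g x y.
Proof. by rewrite subr_ge0 ge_min lexx. Qed.

Lemma rej_le1 (g : R) x y : reject g x y <= 1.
Proof. by rewrite gerBl le_min ler01 expR_ge0. Qed.

(** Noise and gradient displacement are both at most [Num.sqrt g] times a polynomial, so the cubic
    error of [lograt_ge_near] gives [g ^ (3/2)]. The powers of the noise go into an exponential weak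
    enough to be integrated later together with the growth of [W]. *)
Lemma rej_near : exists2 C : R, 0 < C & forall (g : R) x y, 0 < g <= 1 ->
  reject g x y <= C * (g * Num.sqrt g) * (1 + enorm x) ^+ 3 *
    expR (enorm (y - (x - g *: gradU x)) ^+ 2 / (16 * g)).
Proof.
have c1 : 0 <= (1 + L) ^+ 3 by rewrite exprn_ge0 // addr_ge0.
have c2 : 0 <= M / 2 + 3 / 4 * L ^+ 2.
  by apply: addr_ge0; [rewrite divr_ge0|apply: mulr_ge0; rewrite ?sqr_ge0 // divr_ge0].
(* 64 is large enough for [(1 + p) ^+ 2 <= 64 * (1 + p ^+ 2 / 32)]. *)
have [k kE] : exists k : R, k = 64 by exists 64.
have c0 : 0 <= k ^+ 2 by exact: sqr_ge0.
exists (k ^+ 2 * (1 + L) ^+ 3 * (M / 2 + 3 / 4 * L ^+ 2) + 1).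
  by apply: ltr_wpDl => //; apply: mulr_ge0 => //; exact: mulr_ge0.
move=> g x y /andP[g0 g1].
set w := y - _; set C := k ^+ 2 * _ * _.
(* [s] is the scale of the noise, and [p] below is the size of the noise in this unit. *)
pose s := Num.sqrt g; have s0 : 0 < s by rewrite sqrtr_gt0.
have s2 : s ^+ 2 = g by rewrite sqr_sqrtr // ltW.
have s1 : s <= 1 by rewrite -(ler_pXn2r (n := 2)) ?nnegrE ?(ltW s0) // s2 expr1n.
pose p := enorm w / s; have N0 := @enorm_ge0 R d; have p0 : 0 <= p by rewrite divr_ge0 // ltW.
pose q := 1 + p; pose X := 1 + enorm x; pose A := (1 + L) * X * q.
have q1 : 1 <= q by rewrite lerDl. have X1 : 1 <= X by rewrite lerDl.
have L1 : 1 <= 1 + L by rewrite lerDl.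
have XA : X <= A.
  rewrite /A -[leLHS]mulr1; apply: ler_pM => //; [lra|].
  by rewrite -[leLHS]mul1r ler_wpM2r //; lra.
have A1 : 1 <= A by lra.
have vA : enorm (y - x) <= s * A.
  have -> : y - x = w - g *: gradU x by rewrite /w opprB addrA addrAC addrK.
  apply: le_trans (enormD _ _) _; rewrite enormN enormZ (gtr0_norm g0).
  have h1 : enorm w = s * p by rewrite /p mulrC divfK // gt_eqF.
  have h2 : g * enorm (gradU x) <= s * (L * enorm x).
    rewrite -s2 expr2 -mulrA ler_pM2l //; apply: (@le_trans _ _ (1 * (L * enorm x))).
      by apply: ler_pM => //; [exact: ltW|exact: grad_le].
    by rewrite mul1r.
  rewrite h1; apply: (le_trans (lerD (lexx _) h2)).
  rewrite -mulrDr ler_pM2l //.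
  have : A = 1 + enorm x + p + enorm x * p + L * enorm x + L + L * (p + enorm x * p).
    by rewrite /A /X /q; ring.
  have : 0 <= enorm x * p by rewrite mulr_ge0.
  have : 0 <= L * (p + enorm x * p) by rewrite mulr_ge0 // addr_ge0 // mulr_ge0.
  have := N0 x; move: HL; lra.
have q4 : q ^+ 3 <= k ^+ 2 * expR (enorm w ^+ 2 / (16 * g)).
  have -> : enorm w ^+ 2 / (16 * g) = p ^+ 2 / 32 + p ^+ 2 / 32.
    by rewrite /p expr_div_n s2; field; rewrite gt_eqF.
  rewrite expRD -expr2; set E := expR _.
  have E1 : 1 + p ^+ 2 / 32 <= E by exact: expR_ge1Dx.
  have P2 := sqr_ge0 p.
  apply: (@le_trans _ _ (q ^+ 4)); first by apply: ler_weXn2l.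
  have h1 : q ^+ 2 <= k * E.
    rewrite /q kE; have := sqr_ge0 (1 - p); rewrite !sqrrD; lra.
  rewrite (_ : q ^+ 4 = (q ^+ 2) ^+ 2); last by rewrite -exprM.
  by rewrite -exprMn ler_pXn2r // nnegrE ?sqr_ge0 // mulr_ge0 ?expR_ge0 // kE ler0n.
have key : reject g x y <= s ^+ 3 * A ^+ 3 * (M / 2 + 3 / 4 * L ^+ 2).
  apply: one_sub_accept_le.
    have A0 : 0 <= A by exact: le_trans A1.
    by apply: mulr_ge0 => //; apply: mulr_ge0; rewrite exprn_ge0 // ltW.
  have := lograt_ge_near g x (y - x) g0; rewrite (addrC x) subrK => /(le_trans _); apply.
  rewrite lerN2; set V := enorm (y - x) in vA *.
  have V0 : 0 <= V by exact: N0.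
  have sA0 : 0 <= s * A by apply: le_trans vA.
  have h1 : M / 2 * V ^+ 3 <= M / 2 * (s * A) ^+ 3.
    by rewrite ler_wpM2l ?divr_ge0 // lerXn2r // nnegrE.
  have sAA : s * A <= A by rewrite ler_piMl //; lra.
  have h2 : g / 4 * (L * V * (2 * L * enorm x + L * V)) <= g / 4 * (L * (s * A) * (3 * L * A)).
    rewrite ler_wpM2l ?divr_ge0 ?(ltW g0) //; apply: ler_pM.
    - by rewrite mulr_ge0.
    - by rewrite addr_ge0 ?mulr_ge0.
    - by rewrite ler_wpM2l.
    - have k1 : L * enorm x <= L * A by rewrite ler_wpM2l // (le_trans _ XA) // /X lerDr.
      have k2 : L * V <= L * A by rewrite ler_wpM2l // (le_trans vA).
      lra.
  apply: (le_trans (lerD h1 h2)).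
  have -> : s ^+ 3 * A ^+ 3 * (M / 2 + 3 / 4 * L ^+ 2) = M / 2 * (s * A) ^+ 3 + s ^+ 3 * (3 / 4) * L ^+ 2 * A ^+ 3.
    by ring.
  rewrite lerD2l [leLHS](_ : _ = s ^+ 3 * (3 / 4) * L ^+ 2 * A ^+ 2); last by rewrite -s2; field.
  rewrite ler_wpM2l ?mulr_ge0 ?exprn_ge0 ?(ltW s0) ?divr_ge0 //.
  by apply: ler_weXn2l.
apply: (le_trans key).
have -> : g * Num.sqrt g = s ^+ 3 by rewrite -/s -s2; ring.
have K0 : 0 <= s ^+ 3 * (1 + L) ^+ 3 * X ^+ 3 * (M / 2 + 3 / 4 * L ^+ 2).
  apply: mulr_ge0 => //; apply: mulr_ge0; last by rewrite exprn_ge0 // (le_trans _ X1).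
  by apply: mulr_ge0 => //; rewrite exprn_ge0 // ltW.
have := ler_wpM2l K0 q4; rewrite -/X /A.
set E := expR _ => h.
apply: (@le_trans _ _ (C * s ^+ 3 * X ^+ 3 * E)); first by rewrite /C; move: h; lra.
have E0 : 0 <= E by exact: expR_ge0.
have : 0 <= s ^+ 3 * X ^+ 3 * E.
  by apply: mulr_ge0 => //; apply: mulr_ge0; rewrite exprn_ge0 ?(ltW s0) // (le_trans _ X1).
lra.
Qed.

(** If the noise exceeds [enorm x / 8], the bound is above 1. Otherwise the whole segment lies
    between the radii [enorm x / 2] and [2 * enorm x], where both Hessian bounds have fixed orders
    of magnitude and [lograt_ge_far] applies. *)
Lemma rej_far : exists C K g0 : R, [/\ 0 < C, 1 <= K, 0 < g0 &
  forall (g : R) x y, 0 < g <= g0 -> K <= enorm x ->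
    reject g x y <= C * enorm (y - (x - g *: gradU x)) ^+ 2].
Proof.
have /andP[b0 b1] := Hbeta.
(* 12 is 3 times 4: below, [a] is at least [m_beta / (3 * P)] and [h ^+ 2] at most
   [4 * L_beta ^+ 2 / P]. *)
pose Cr := 12 * L_beta ^+ 2 / m_beta.
have Cr0 : 0 <= Cr by apply: divr_ge0; [apply: mulr_ge0 => //; exact: sqr_ge0|exact: ltW].
(* Ensures both [g * L <= 1 / 8], for the segment, and [g * Cr <= 1], for the hypothesis
   [g * h ^+ 2 <= a]. *)
pose g0 := (8 * L + Cr + 1)^-1.
have D0 : 0 < 8 * L + Cr + 1 by rewrite ltr_wpDl // addr_ge0 // mulr_ge0.
exists (64 + Cr), (1 + 2 * K_beta), g0; split.
- by rewrite ltr_wpDr.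
- by rewrite lerDl mulr_ge0.
- by rewrite invr_gt0.
move=> g x y /andP[gp gg0] xK.
have x1 : 1 <= enorm x by apply: le_trans xK; rewrite lerDl mulr_ge0.
have gD : g * (8 * L + Cr + 1) <= 1 by rewrite -ler_pdivlMr // mul1r.
have gL : g * L <= 8%:R^-1 by have : 0 <= g * (Cr + 1); [rewrite mulr_ge0 ?addr_ge0 // ltW|lra].
have gCr : g * Cr <= 1 by have : 0 <= g * (8 * L + 1); [rewrite mulr_ge0 ?addr_ge0 ?mulr_ge0 // ltW|lra].
set w := y - _.
have N0 := @enorm_ge0 R d.
have [wx|wx] := leP (enorm w) (enorm x / 8); last first.
  apply: (le_trans (rej_le1 _ _ _)).
  have : 1 <= 64 * enorm w ^+ 2.
    have : 1 <= (8 * enorm w) ^+ 2 by rewrite exprn_ege1 //; lra.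
    by rewrite exprMn; congr (_ <= _); ring.
  have : 0 <= Cr * enorm w ^+ 2 by rewrite mulr_ge0 ?sqr_ge0.
  lra.
pose v := y - x; have vE : v = w - g *: gradU x by rewrite /v /w opprB addrA addrAC addrK.
have vx : enorm v <= enorm x / 4.
  rewrite vE; apply: le_trans (enormD _ _) _; rewrite enormN enormZ (gtr0_norm gp).
  have : g * enorm (gradU x) <= g * (L * enorm x) by rewrite ler_pM2l // grad_le.
  have : g * L * enorm x <= 8%:R^-1 * enorm x by rewrite ler_wpM2r.
  lra.
have seg c : 0 <= c <= 1 -> enorm x / 2 <= enorm (x + c *: v) <= 2 * enorm x.
  move=> /andP[c0 c1].
  have cv : enorm (c *: v) <= enorm x / 4.
    by rewrite enormZ ger0_norm //; apply: le_trans vx; rewrite ler_piMl.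
  have h1 := enormD x (c *: v); have h2 := enorm_sub_le x (- (c *: v)).
  rewrite opprK enormN in h2.
  by apply/andP; split; have := N0 x; lra.
set r := enorm x in x1 xK wx vx seg.
pose P := powR r beta; have P1 : 1 <= P by rewrite -(powRr0 r) ler_powR.
pose Q := powR (r / 2) (3 * beta / 4); have Q0 : 0 <= Q by exact: powR_ge0.
have r0 : 0 <= r by exact: N0.
(* Here the two curvature exponents meet: squaring doubles [3 * beta / 4] to [3 * beta / 2], which
   is at least [beta], and at most 2, so that halving [r] costs at most the factor 4. *)
have PQ : P <= 4 * Q ^+ 2.
  have Q2 : Q ^+ 2 = powR r (3 * beta / 2) * powR 2^-1 (3 * beta / 2).
    by rewrite -powRM ?invr_ge0 // /Q -powR_mulrn ?powR_ge0 // -powRrM; congr powR; field.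
  have h1 : P <= powR r (3 * beta / 2) by rewrite ler_powR //; lra.
  have h2 : 4^-1 <= powR (2^-1 : R) (3 * beta / 2).
    have -> : (4^-1 : R) = powR (2^-1) 2.
      by rewrite powR_mulrn ?invr_ge0 //; field.
    have e2 (t : R) : powR 2^-1 t = powR 2 (- t) by rewrite -(@powR_inv1 _ 2) // -powRrM mulN1r.
    by rewrite !e2 ler_powR ?ler1n //; lra.
  rewrite Q2; set a := powR r _ in h1 *; set b := powR _ _ in h2 *.
  have : a * 4^-1 <= a * b by rewrite ler_wpM2l ?powR_ge0.
  lra.
have P2 : powR (2 * r) beta <= 2 * P.
  rewrite powRM // ler_wpM2r ?powR_ge0 // -[leRHS](@powRr1 _ 2) // ler_powR //; [lra|exact: ltW].
pose a := m_beta / (1 + powR (2 * r) beta).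
pose h := L_beta / (1 + Q).
have a0 : 0 < a by rewrite divr_gt0 // ltr_wpDr ?powR_ge0.
have h0 : 0 <= h by rewrite divr_ge0 // addr_ge0.
have aP : m_beta / (3 * P) <= a.
  by rewrite ler_pM2l // lef_pV2 ?posrE; [lra|lra|rewrite ltr_wpDr ?powR_ge0].
have hP : h ^+ 2 <= 4 * L_beta ^+ 2 / P.
  rewrite /h expr_div_n ler_pdivrMr ?exprn_gt0 ?ltr_wpDr //.
  rewrite mulrAC ler_pdivlMr; last by lra.
  rewrite [leRHS](_ : _ = L_beta ^+ 2 * (4 * (1 + Q) ^+ 2)); last by ring.
  rewrite ler_wpM2l ?sqr_ge0 //.
  have : (1 + Q) ^+ 2 = 1 + 2 * Q + Q ^+ 2 by ring.
  lra.
have ha : h ^+ 2 <= Cr * a.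
  apply: (le_trans hP); apply: (@le_trans _ _ (Cr * (m_beta / (3 * P)))); last by rewrite ler_wpM2l.
  have Pn : P != 0 by rewrite gt_eqF //; lra.
  have mn : m_beta != 0 by rewrite gt_eqF.
  by rewrite le_eqVlt; apply/orP; left; apply/eqP; rewrite /Cr; field; rewrite Pn mn.
have gh : g * h ^+ 2 <= a.
  apply: (@le_trans _ _ (g * (Cr * a))); first by rewrite ler_pM2l.
  by rewrite mulrA ler_piMl // ltW.
have curv c : 0 <= c <= 1 -> forall z,
    a * enorm z ^+ 2 <= bilin (hessU (x + c *: v)) z z <= h * enorm z ^+ 2.
  move=> c01 z; have /andP[s1 s2] := seg c c01.
  have pK : K_beta <= enorm (x + c *: v).
    apply: le_trans s1; rewrite ler_pdivlMr // mulrC.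
    by apply: le_trans xK; rewrite lerDr.
  have /andP[p1 p2] := curvature (x + c *: v) z pK.
  have r20 : 0 <= r / 2 by rewrite divr_ge0.
  apply/andP; split.
    apply: le_trans p1; apply: ler_wpM2r; first exact: sqr_ge0.
    exact: (divr_onepowR_le _ _ _ _ (ltW Hmb) (N0 _) s2 b0).
  apply: (le_trans p2); apply: ler_wpM2r; first exact: sqr_ge0.
  apply: (divr_onepowR_le _ _ _ _ HLb r20 s1).
  by rewrite divr_ge0 ?mulr_ge0.
have E := lograt_ge_far g x v a h gp a0 h0 gh curv.
have wE : v + g *: gradU x = w by rewrite vE subrK.
have vx2 : x + v = y by rewrite /v addrC subrK.
rewrite wE vx2 in E.
apply: one_sub_accept_le; first by rewrite mulr_ge0 ?sqr_ge0 // addr_ge0.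
apply: le_trans E; rewrite lerN2 ler_wpM2r ?sqr_ge0 //.
have a4 : 0 < 4 * a by rewrite mulr_gt0.
rewrite (ler_pdivrMr _ _ a4); apply: (le_trans ha).
have : 0 <= Cr * a by rewrite mulr_ge0 // ltW.
lra.
Qed.

End potential.

(** * Drift of the proposal and cost of rejections *)

Section elementary.
Context {R : realType}.
Implicit Types (t x c : R).

Lemma sqrt_le_amgm x c : 0 < c -> 0 <= x -> Num.sqrt x <= (x / c + c) / 2.
Proof.
move=> c0 x0; have := sqr_ge0 (Num.sqrt x - c); rewrite sqrrB sqr_sqrtr // => h.
rewrite -(ler_pM2l c0) [leRHS](_ : _ = (x + c ^+ 2) / 2); first by lra.
by field; rewrite gt_eqF.
Qed.

Lemma expRN_le_half t : 0 <= t <= 1 -> expR (- t) <= 1 - t / 2.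
Proof.
move=> /andP[t0 t1]; have h := expR_ge1Dx t; rewrite expRN.
rewrite -[leLHS]mul1r ler_pdivrMr ?expR_gt0 //.
apply: (@le_trans _ _ ((1 - t / 2) * (1 + t))); first by nra.
by rewrite ler_wpM2l //; lra.
Qed.

Lemma expR_le_1D2 t : 0 <= t <= 2^-1 -> expR t <= 1 + 2 * t.
Proof.
move=> /andP[t0 t1]; have h := expR_ge1Dx (- t); have p := expR_gt0 t.
have : expR t * (1 - t) <= 1 by rewrite -[leRHS](expRxMexpNx_1 t) ler_wpM2l // ltW.
nra.
Qed.

Lemma expRN2_le t : 0 <= t <= 2^-1 -> expR (- (2 * t)) <= 1 - t.
Proof.
move=> /andP[t0 t1]; have h := expR_ge1Dx (2 * t); rewrite expRN.
rewrite -[leLHS]mul1r ler_pdivrMr ?expR_gt0 //.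
apply: (@le_trans _ _ ((1 - t) * (1 + 2 * t))); first by nra.
by rewrite ler_wpM2l //; lra.
Qed.

End elementary.

Section japanese_bracket.
Context {R : realType} {d : nat}.
Implicit Types (x y w : 'rV[R]_d).

Definition jap x : R := Num.sqrt (1 + enorm x ^+ 2).

Lemma jap_sqr x : jap x ^+ 2 = 1 + enorm x ^+ 2.
Proof. by rewrite sqr_sqrtr // addr_ge0 ?sqr_ge0. Qed.

Lemma jap_ge0 x : 0 <= jap x. Proof. exact: sqrtr_ge0. Qed.

Lemma jap_ge1 x : 1 <= jap x.
Proof.
by rewrite -(ler_pXn2r (n := 2)) ?nnegrE ?jap_ge0 // jap_sqr expr1n lerDl sqr_ge0.
Qed.

Lemma jap_gt0 x : 0 < jap x. Proof. exact: lt_le_trans (jap_ge1 x). Qed.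

Lemma enorm_le_jap x : enorm x <= jap x.
Proof.
by rewrite -(ler_pXn2r (n := 2)) ?nnegrE ?jap_ge0 ?enorm_ge0 // jap_sqr lerDr.
Qed.

Lemma jap_le x : jap x <= 1 + enorm x.
Proof.
have N0 := enorm_ge0 x.
rewrite -(ler_pXn2r (n := 2)) ?nnegrE ?jap_ge0 ?addr_ge0 // jap_sqr sqrrD expr1n.
lra.
Qed.

Lemma jap_amgm x y : jap y <= ((1 + enorm y ^+ 2) / jap x + jap x) / 2.
Proof. by apply: sqrt_le_amgm; rewrite ?jap_gt0 // addr_ge0 ?sqr_ge0. Qed.

(** First order expansion of the bracket with remainder at most [enorm w ^+ 2 / 2]: the tangent line
    of the square root at [jap x ^+ 2], followed by [1 <= jap x]. *)
Lemma jap_quad x w : jap (x + w) <= jap x + dotR x w / jap x + enorm w ^+ 2 / 2.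
Proof.
apply: le_trans (jap_amgm x _) _; have J := jap_gt0 x; have J1 := jap_ge1 x.
rewrite enorm_sqrD [leLHS](_ : _ = (jap x ^+ 2 + 2 * dotR x w + enorm w ^+ 2) / jap x / 2 + jap x / 2); last first.
  by rewrite jap_sqr; field; rewrite gt_eqF.
rewrite [leLHS](_ : _ = jap x + dotR x w / jap x + enorm w ^+ 2 / 2 / jap x); last by field; rewrite gt_eqF.
by rewrite lerD2l ler_pdivrMr // ler_peMr // divr_ge0 ?sqr_ge0.
Qed.

Lemma jap_lip x w : jap (x + w) <= jap x + enorm w.
Proof.
have N0 := enorm_ge0 w; have J := jap_ge0 x; have h := enorm_le_jap x.
rewrite -(ler_pXn2r (n := 2)) ?nnegrE ?jap_ge0 ?addr_ge0 // jap_sqr sqrrD jap_sqr.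
have := enormD x w; have N1 := enorm_ge0 (x + w); have N2 := enorm_ge0 x => h2.
have : enorm (x + w) ^+ 2 <= (enorm x + enorm w) ^+ 2 by rewrite lerXn2r ?nnegrE ?addr_ge0.
rewrite sqrrD.
have : enorm x * enorm w <= jap x * enorm w by rewrite ler_wpM2r.
lra.
Qed.

Lemma measurable_jap : measurable_fun setT (jap : Rd R d -> R).
Proof.
have ms : measurable_fun [set: R] (Num.sqrt : R -> R).
  by apply: continuous_measurable_fun; exact: sqrt_continuous.
apply: (measurableT_comp ms); apply: measurable_funD => //.
exact: (measurable_enorm_sqr (fun x : Rd_measurableType R d => x) measurable_idRd).
Qed.

End japanese_bracket.

Section drift.
Context {R : realType} {d : nat}.
Variables (mu : {measure set Rd R d -> \bar R}) (Hmu : is_lebesgue mu).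
Variables (U : 'rV[R]_d -> R) (gradU : 'rV[R]_d -> 'rV[R]_d) (L eta : R).
Local Notation E := (Rd_measurableType R d).
Local Notation rej := (reject U gradU).
Hypotheses (mU : measurable_fun setT (U : E -> R))
  (mG : measurable_fun setT (gradU : E -> Rd R d))
  (eta0 : 0 < eta) (HL : 0 <= L)
  (grad_le : forall x, enorm (gradU x) <= L * enorm x)
  (growth : forall B : R, exists2 K, 1 <= K & forall x, K <= enorm x ->
    B * enorm x <= dotR (gradU x) x)
  (cocoercive : exists C K : R, [/\ 0 < C, 1 <= K & forall x, K <= enorm x ->
    enorm (gradU x) ^+ 2 <= C * dotR (gradU x) x])
  (near : exists2 C : R, 0 < C & forall (g : R) x y, 0 < g <= 1 ->
    rej g x y <= C * (g * Num.sqrt g) * (1 + enorm x) ^+ 3 *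
      expR (enorm (y - (x - g *: gradU x)) ^+ 2 / (16 * g)))
  (far : exists C K g0 : R, [/\ 0 < C, 1 <= K, 0 < g0 &
    forall (g : R) x y, 0 < g <= g0 -> K <= enorm x ->
      rej g x y <= C * enorm (y - (x - g *: gradU x)) ^+ 2]).

Definition lyap (x : 'rV[R]_d) : R := expR (eta * jap x).
Definition prop_mean (g : R) (x : 'rV[R]_d) := x - g *: gradU x.
Local Notation am := prop_mean.
Local Notation W := lyap.

Lemma lyap_gt0 x : 0 < W x. Proof. exact: expR_gt0. Qed.
Lemma lyap_ge0 x : 0 <= W x. Proof. exact: expR_ge0. Qed.

Lemma lyap_ge1 x : 1 <= W x.
Proof. by rewrite -expR0 ler_expR mulr_ge0 ?jap_ge0 // ltW. Qed.

Lemma measurable_lyap : measurable_fun setT (W : E -> R).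
Proof.
by apply: measurableT_comp => //; apply: measurable_funM => //; exact: measurable_jap.
Qed.

Lemma lyap_shift x w : W (x + w) <= W x * expR (eta * enorm w).
Proof. by rewrite -expRD ler_expR -mulrDr ler_pM2l // jap_lip. Qed.

Lemma lyap_ge_enorm x : expR (eta * enorm x) <= W x.
Proof. by rewrite ler_expR ler_pM2l // enorm_le_jap. Qed.

(** The cubic term of the exponential series at [eta * jap x]; 48 is [3!] times the [2 ^+ 3] coming
    from [1 + enorm x <= 2 * jap x]. *)
Lemma cube_le_lyap x : (1 + enorm x) ^+ 3 <= 48 / eta ^+ 3 * W x.
Proof.
have N0 := enorm_ge0 x; have J := jap_ge1 x; have h := enorm_le_jap x.
have h1 : (1 + enorm x) ^+ 3 <= (2 * jap x) ^+ 3.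
  by rewrite lerXn2r ?nnegrE ?addr_ge0 ?mulr_ge0 ?jap_ge0 //; lra.
have h2 := @expR_ge1Dxn R (eta * jap x) 2 (mulr_ge0 (ltW eta0) (jap_ge0 x)).
have h3 : (eta * jap x) ^+ 3 <= 6 * W x.
  have f6 : (2.+1)`!%:R = 6 :> R by [].
  by move: h2; rewrite f6 -/(W x); lra.
apply: (le_trans h1); rewrite !exprMn; rewrite exprMn in h3.
have e3 : 0 < eta ^+ 3 by rewrite exprn_gt0.
by rewrite [leRHS]mulrAC ler_pdivlMr //; lra.
Qed.

(** [jap_quad] majorises [W] by the exponential of a linear and a quadratic term, whose mean is
    given by [gauss_quad]. The slope satisfies [enorm l <= eta] and the variance factor is
    [1 - 2 * eta * g >= 1 / 2], so the excess is exponential of order [g]. *)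
Lemma gexp_lyap_le (g : R) a : 0 < g -> 4 * eta * g <= 1 ->
  gint mu g a W /\ gexp mu g a W <= W a * expR ((2 * eta * d%:R + 2 * eta ^+ 2) * g).
Proof.
move=> g0 g4.
have k1 : 4 * g * (eta / 2) < 1 by lra.
pose l := (eta / jap a) *: a.
have [iH eH] := gauss_quad mu Hmu g a l (eta / 2) g0 k1.
pose H u := W a * expR (dotR l (u - a) + eta / 2 * enorm (u - a) ^+ 2).
have WH u : `|W u| <= H u.
  rewrite ger0_norm ?lyap_ge0 // /H -expRD ler_expR.
  have -> : eta * jap a + (dotR l (u - a) + eta / 2 * enorm (u - a) ^+ 2) =
    eta * (jap a + dotR a (u - a) / jap a + enorm (u - a) ^+ 2 / 2).
    by rewrite /l dotRZl; field; rewrite gt_eqF // jap_gt0.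
  by rewrite ler_pM2l //; have := jap_quad a (u - a); rewrite (addrC a) subrK.
have iHH : gint mu g a H := gintZ mu g a (W a) _ iH.
have iW := gint_dom mu g a W H measurable_lyap iHH WH.
split=> //; have := le_gexp mu g a W H iW iHH (fun u => le_trans (ler_norm _) (WH u)).
move=> /le_trans; apply; rewrite (gexpZ mu g a (W a) _ iH) eH ler_pM2l ?lyap_gt0 //.
set q := 1 - 4 * g * (eta / 2); have q2 : 2^-1 <= q by rewrite /q; lra.
have l1 : enorm l ^+ 2 <= eta ^+ 2.
  have J := jap_gt0 a.
  rewrite /l enormZ exprMn real_normK ?num_real // expr_div_n mulrAC ler_pdivrMr ?exprn_gt0 //.
  by rewrite ler_wpM2l ?sqr_ge0 // lerXn2r ?nnegrE ?jap_ge0 ?enorm_ge0 // enorm_le_jap.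
have h1 : powR q (- (d%:R / 2)) <= expR (2 * eta * d%:R * g).
  have t1 : 0 <= 2 * eta * g <= 2^-1.
    by apply/andP; split; [rewrite !mulr_ge0 // ltW|lra].
  have := expRN2_le (2 * eta * g) t1.
  have -> : 1 - 2 * eta * g = q by rewrite /q; field.
  move=> hq.
  have : powR (expR (- (2 * (2 * eta * g)))) (d%:R / 2) <= powR q (d%:R / 2).
    by apply: ge0_ler_powR; rewrite ?nnegrE ?expR_ge0 ?divr_ge0 //; lra.
  rewrite -expRM => hh.
  rewrite powRN invf_ple ?posrE ?expR_gt0 ?powR_gt0 //; last by lra.
  rewrite -expRN; apply: le_trans hh; rewrite ler_expR.
  by rewrite le_eqVlt; apply/orP; left; apply/eqP; field.
have h2 : g / q * enorm l ^+ 2 <= 2 * eta ^+ 2 * g.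
  rewrite [leRHS](_ : _ = 2 * g * eta ^+ 2); last by ring.
  apply: ler_pM => //; [by rewrite divr_ge0 ?ltW //; lra|exact: sqr_ge0|].
  rewrite ler_pdivrMr; last by lra.
  have : g * 2^-1 <= g * q by rewrite ler_pM2l.
  lra.
rewrite mulrDl expRD; apply: ler_pM; rewrite ?powR_ge0 ?expR_ge0 //.
by rewrite ler_expR.
Qed.

Lemma measurable_rej {d'} {T : measurableType d'} (g : R) (f h : T -> 'rV[R]_d) :
  measurable_fun setT (f : T -> Rd R d) -> measurable_fun setT (h : T -> Rd R d) ->
  measurable_fun setT (fun t => rej g (f t) (h t)).
Proof.
move=> mf mh; apply: measurable_funB => //; apply: measurable_minr => //.
apply: measurableT_comp => //; apply: measurable_funD.
  by apply: measurable_funB; [exact: (measurableT_comp mU mf)|exact: (measurableT_comp mU mh)].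
have mgf : measurable_fun setT ((fun t => g *: gradU (f t)) : T -> Rd R d).
  by apply: (measurable_scaleRd (cst g)) => //; exact: (measurableT_comp mG mf).
have mgh : measurable_fun setT ((fun t => g *: gradU (h t)) : T -> Rd R d).
  by apply: (measurable_scaleRd (cst g)) => //; exact: (measurableT_comp mG mh).
apply: measurable_funM => //; apply: measurable_funB; apply: measurable_enorm_sqr.
  exact: measurable_addRd (measurable_subRd _ _ mh mf) mgf.
exact: measurable_addRd (measurable_subRd _ _ mf mh) mgh.
Qed.

Lemma measurable_rej1 (g : R) x : measurable_fun setT (rej g x : E -> R).
Proof. exact: (measurable_rej g (cst x) (fun y : E => y) (measurable_cst _) measurable_idRd). Qed.

(** This is 2 to the power [d / 2], the mean of [expR (enorm w ^+ 2 / (8 * g))] for the noise [w],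
    whatever the step. *)
Definition gconst : R := powR 2^-1 (- (d%:R / 2)).

Lemma gconst_gt0 : 0 < gconst. Proof. by rewrite powR_gt0. Qed.

Lemma gexp_quad8 (g : R) a : 0 < g ->
  gint mu g a (fun u => expR (enorm (u - a) ^+ 2 / (8 * g))) /\
  gexp mu g a (fun u => expR (enorm (u - a) ^+ 2 / (8 * g))) = gconst.
Proof.
move=> g0; have gn : g != 0 by rewrite gt_eqF.
have E4 : 4 * g * (8 * g)^-1 = 2^-1 by field.
have [|iH eH] := gauss_quad mu Hmu g a 0 (8 * g)^-1 g0; first by rewrite E4; lra.
have EE : (fun u => expR (dotR 0 (u - a) + (8 * g)^-1 * enorm (u - a) ^+ 2)) =
  (fun u => expR (enorm (u - a) ^+ 2 / (8 * g))).
  by apply: funext => u; rewrite dot0R add0r mulrC.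
rewrite EE in iH eH; split=> //; rewrite eH enorm0 expr0n mulr0 expR0 mulr1 E4 /gconst.
by congr powR; field.
Qed.

(** Turns the growth of [W] along the noise into a Gaussian weight. Multiplied by the weight of
    [rej_near] it gives the exponent [1 / (8 * g)], still below the [1 / (4 * g)] of the
    proposal. *)
Lemma exp_linear_le (g w : R) : 0 < g <= 1 -> 0 <= w ->
  expR (eta * w) <= expR (4 * eta ^+ 2) * expR (w ^+ 2 / (16 * g)).
Proof.
move=> /andP[g0 g1] w0; rewrite -expRD ler_expR.
apply: (@le_trans _ _ (4 * eta ^+ 2 + w ^+ 2 / 16)); first by have := sqr_ge0 (2 * eta - w / 4); rewrite sqrrB; lra.
rewrite lerD2l ler_wpM2l ?sqr_ge0 // lef_pV2 ?posrE ?mulr_gt0 //; lra.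
Qed.

Lemma expR_16_8 (g w : R) : 0 < g ->
  expR (w ^+ 2 / (16 * g)) * expR (w ^+ 2 / (16 * g)) = expR (w ^+ 2 / (8 * g)).
Proof. by move=> g0; rewrite -expRD; congr expR; field; rewrite gt_eqF. Qed.

Lemma expR_16_le (g w : R) : 0 < g -> expR (w ^+ 2 / (16 * g)) <= expR (w ^+ 2 / (8 * g)).
Proof.
move=> g0; rewrite ler_expR ler_wpM2l ?sqr_ge0 // lef_pV2 ?posrE ?mulr_gt0 //; lra.
Qed.

(** [rprob] is the probability of a rejection. [rcost] is its price in the weight part [W x + W y]
    of the distance. *)
Definition rprob (g : R) x := gexp mu g (am g x) (rej g x).
Definition rcost (g : R) x := gexp mu g (am g x) (fun y => (W x + W y) * rej g x y).

Lemma measurable_rcost (g : R) x : measurable_fun setT ((fun y => (W x + W y) * rej g x y) : E -> R).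
Proof.
apply: measurable_funM; last exact: measurable_rej1.
by apply: measurable_funD => //; exact: measurable_lyap.
Qed.

Lemma rcost_bound (g : R) x (C : R) : 0 < g -> 0 <= C ->
  (forall y, (W x + W y) * rej g x y <= C * expR (enorm (y - am g x) ^+ 2 / (8 * g))) ->
  gint mu g (am g x) (fun y => (W x + W y) * rej g x y) /\ rcost g x <= C * gconst.
Proof.
move=> g0 C0 H; have [iH eH] := gexp_quad8 g (am g x) g0.
have iC := gintZ mu g _ C _ iH.
have H' y : `|(W x + W y) * rej g x y| <= C * expR (enorm (y - am g x) ^+ 2 / (8 * g)).
  by rewrite ger0_norm // mulr_ge0 ?rej_ge0 // addr_ge0 ?lyap_ge0.
split; first exact: gint_dom (measurable_rcost g x) iC H'.
rewrite -eH -(gexpZ mu g _ C _ iH).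
exact: le_trans (ler_norm _) (normr_gexp mu g _ _ _ (measurable_rcost g x) iC H').
Qed.

(** The cubic factor of [rej_near] is absorbed by [W]. The order [g ^ (3/2)] is what later makes the
    term negligible against [ep * g * W x]. *)
Lemma rprob_le : exists2 C : R, 0 < C & forall (g : R) x, 0 < g <= 1 ->
  gint mu g (am g x) (rej g x) /\ rprob g x <= C * (g * Num.sqrt g) * W x.
Proof.
have [Cn Cn0 H] := near; pose C := Cn * (48 / eta ^+ 3) * gconst.
have e3 : 0 < 48 / eta ^+ 3 by rewrite divr_gt0 // exprn_gt0.
exists C; first by apply: mulr_gt0; [exact: mulr_gt0|exact: gconst_gt0].
move=> g x /andP[g0 g1]; have [iH eH] := gexp_quad8 g (am g x) g0.
pose K := Cn * (g * Num.sqrt g) * (48 / eta ^+ 3 * W x).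
have s0 : 0 <= Cn * (g * Num.sqrt g) by rewrite !mulr_ge0 ?sqrtr_ge0 // ltW.
have iK := gintZ mu g _ K _ iH.
have H' y : `|rej g x y| <= K * expR (enorm (y - am g x) ^+ 2 / (8 * g)).
  rewrite ger0_norm ?rej_ge0 //; apply: (le_trans (H g x y _)); first by rewrite g0.
  apply: ler_pM; rewrite ?expR_ge0 ?expR_16_le //.
    by rewrite mulr_ge0 // exprn_ge0 // addr_ge0 ?enorm_ge0.
  by rewrite ler_wpM2l // cube_le_lyap.
split; first exact: gint_dom (measurable_rej1 g x) iK H'.
apply: (le_trans (ler_norm _)); apply: (le_trans (normr_gexp mu g _ _ _ (measurable_rej1 g x) iK H')).
by rewrite (gexpZ mu g _ K _ iH) eH /K /C; lra.
Qed.

(** The constant may depend on the radius [r]. A fixed [r] serves the bounded region in [drift], and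
    [r = enorm x] gives integrability at every point. *)
Lemma rcost_le_near : exists2 C : R -> R, (forall r, 0 <= C r) & forall (g : R) x r, 0 < g <= 1 ->
  enorm x <= r ->
  gint mu g (am g x) (fun y => (W x + W y) * rej g x y) /\ rcost g x <= C r * g * W x.
Proof.
have [Cn Cn0 H] := near.
pose D (r : R) := Cn * (1 + `|r|) ^+ 3 * (2 * expR (eta * L * `|r| + 4 * eta ^+ 2)).
have D0 (r : R) : 0 <= D r.
  rewrite /D; apply: mulr_ge0; last by rewrite mulr_ge0 ?expR_ge0.
  by apply: mulr_ge0; [exact: ltW|rewrite exprn_ge0 // addr_ge0].
exists (fun r => D r * gconst); first by move=> r; rewrite mulr_ge0 // ltW // gconst_gt0.
move=> g x r /andP[g0 g1] xr; have N0 := @enorm_ge0 R d.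
have r0 : 0 <= r by apply: le_trans xr.
have -> : D r * gconst * g * W x = D r * g * W x * gconst by ring.
apply: rcost_bound => //.
  by apply: mulr_ge0; [apply: mulr_ge0; [exact: D0|exact: ltW]|exact: lyap_ge0].
move=> y; set w := y - am g x; have {H} := H g x y; rewrite g0 g1 -/w => /(_ isT).
have Wy : W x + W y <= W x * (2 * expR (eta * L * `|r| + 4 * eta ^+ 2) * expR (enorm w ^+ 2 / (16 * g))).
  have h1 : W y <= W x * expR (eta * enorm (y - x)).
    by have := lyap_shift x (y - x); rewrite (addrC x) subrK.
  have h2 : enorm (y - x) <= L * r + enorm w.
    have -> : y - x = w - g *: gradU x by rewrite /w /am opprB addrA addrAC addrK.
    apply: le_trans (enormD _ _) _; rewrite addrC lerD2r enormN enormZ gtr0_norm //.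
    apply: (@le_trans _ _ (1 * (L * r))); last by rewrite mul1r.
    apply: ler_pM => //; first exact: ltW.
    by apply: (le_trans (grad_le x)); rewrite ler_wpM2l.
  have h3 : expR (eta * enorm (y - x)) <= expR (eta * L * `|r| + 4 * eta ^+ 2) * expR (enorm w ^+ 2 / (16 * g)).
    rewrite expRD -mulrA; apply: (@le_trans _ _ (expR (eta * L * `|r|) * expR (eta * enorm w))).
      by rewrite -expRD ler_expR ger0_norm // -mulrA -mulrDr ler_pM2l.
    by rewrite ler_pM2l ?expR_gt0 // exp_linear_le // g0.
  have h4 : 1 <= expR (eta * L * `|r| + 4 * eta ^+ 2) * expR (enorm w ^+ 2 / (16 * g)).
    apply: le_trans h3; rewrite -[leLHS]expR0 ler_expR mulr_ge0 // ltW //.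
  have W0 := lyap_ge0 x.
  apply: (@le_trans _ _ (W x * 1 + W x * expR (eta * enorm (y - x)))); first by rewrite mulr1 lerD2l.
  have := ler_wpM2l W0 h4; have := ler_wpM2l W0 h3; lra.
have s1 : Num.sqrt g <= 1 by rewrite -sqrtr1 ler_wsqrtr.
move=> h; have h2 : rej g x y <= Cn * g * (1 + `|r|) ^+ 3 * expR (enorm w ^+ 2 / (16 * g)).
  apply: (le_trans h); rewrite ler_wpM2r ?expR_ge0 //.
  apply: ler_pM; first by rewrite !mulr_ge0 ?sqrtr_ge0 // ltW.
  - by rewrite exprn_ge0 // addr_ge0.
  - by rewrite (ler_pM2l Cn0) (ger_pMr _ g0).
  - by rewrite lerXn2r ?nnegrE ?addr_ge0 // lerD2l (le_trans xr) // ler_norm.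
apply: (le_trans (ler_pM _ _ Wy h2)); rewrite ?rej_ge0 ?addr_ge0 ?lyap_ge0 //.
rewrite -expR_16_8 // /D; set e := expR (_ / _); set e' := expR (_ + _).
by rewrite le_eqVlt; apply/orP; left; apply/eqP; ring.
Qed.

(** In the expansion of the square, cocoercivity pays for [g ^+ 2 * enorm (gradU x) ^+ 2] with half
    of [2 * g * dotR (gradU x) x]. *)
Lemma am_sqr_le : exists K g0 : R, [/\ 1 <= K, 0 < g0 & forall (g : R) x, 0 < g <= g0 -> K <= enorm x ->
  enorm (am g x) ^+ 2 <= enorm x ^+ 2 - g * dotR (gradU x) x].
Proof.
have [C [K [C0 K1 H]]] := cocoercive; exists K, C^-1; split=> //; first by rewrite invr_gt0.
move=> g x /andP[g0 gC] xK; have {}H := H x xK.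
rewrite /am enorm_sqrB enormZ exprMn real_normK ?num_real // dotRZr (dotRC x).
have gC1 : g * C <= 1 by rewrite -ler_pdivlMr // mul1r.
have p0 : 0 <= dotR (gradU x) x by rewrite -(pmulr_rge0 _ C0); apply: le_trans H; exact: sqr_ge0.
have : g ^+ 2 * enorm (gradU x) ^+ 2 <= g * dotR (gradU x) x.
  apply: (@le_trans _ _ (g ^+ 2 * (C * dotR (gradU x) x))); first by rewrite ler_wpM2l ?sqr_ge0.
  rewrite [leLHS](_ : _ = g * (g * C * dotR (gradU x) x)); last by ring.
  by rewrite ler_pM2l // ler_piMl.
lra.
Qed.

(** The factor [g] comes from [enorm w ^+ 2 <= 16 * g * expR (enorm w ^+ 2 / (16 * g))]. The
    constant is uniform in [x] because the gradient step does not increase [W] there. *)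
Lemma rcost_le_far : exists C K g0 : R, [/\ 0 < C, 1 <= K, 0 < g0 &
  forall (g : R) x, 0 < g <= g0 -> K <= enorm x -> rcost g x <= C * g * W x].
Proof.
have [C [K [g1 [C0 K1 g10 H]]]] := far; have [K' [g2 [K'1 g20 H']]] := am_sqr_le.
(* [B = 0] provides the nonnegativity of [dotR (gradU x) x]. *)
have [Kg Kg1 Hg] := growth 0.
pose D := 2 * C * (16 * expR (4 * eta ^+ 2)).
have D0 : 0 < D by rewrite /D; apply: mulr_gt0; [rewrite mulr_gt0|rewrite mulr_gt0 ?expR_gt0].
exists (D * gconst), (Num.max K (Num.max K' Kg)), (Num.min 1 (Num.min g1 g2)); split.
- by rewrite mulr_gt0 // gconst_gt0.
- by rewrite le_max K1.
- by rewrite !lt_min ltr01 g10.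
move=> g x /andP[g0]; rewrite !le_min => /and3P[gl1 gg1 gg2]; rewrite !ge_max => /and3P[xK xK' xKg].
have N0 := @enorm_ge0 R d.
have [] := rcost_bound g x (D * g * W x) g0; last by move=> _ /le_trans; apply; lra.
  by apply: mulr_ge0; [apply: mulr_ge0; exact: ltW|exact: lyap_ge0].
move=> y; set w := y - am g x.
have hr : rej g x y <= C * enorm w ^+ 2 by apply: H => //; rewrite g0.
have Wa : W (am g x) <= W x.
  rewrite ler_expR ler_pM2l //; rewrite -(ler_pXn2r (n := 2)) ?nnegrE ?jap_ge0 // !jap_sqr lerD2l.
  apply: le_trans (H' g x _ xK') _; first by rewrite g0.
  by rewrite gerBl mulr_ge0 ?(ltW g0) //; have := Hg x xKg; rewrite mul0r.
have Wy : W y <= W x * expR (eta * enorm w).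
  have := lyap_shift (am g x) w; rewrite /w (addrC (am g x)) subrK => /le_trans; apply.
  by rewrite ler_wpM2r ?expR_ge0.
have e1 : 1 <= expR (eta * enorm w) by rewrite -[leLHS]expR0 ler_expR mulr_ge0 // ltW.
have W0 := lyap_ge0 x.
have WW : W x + W y <= W x * (2 * expR (eta * enorm w)).
  have := ler_wpM2l W0 e1; lra.
have h1 := exp_linear_le g (enorm w); rewrite g0 gl1 N0 in h1; have {}h1 := h1 isT isT.
have h2 : enorm w ^+ 2 <= 16 * g * expR (enorm w ^+ 2 / (16 * g)).
  have g16 : 0 < 16 * g by rewrite mulr_gt0.
  have := expR_ge1Dx (enorm w ^+ 2 / (16 * g)) => h.
  rewrite mulrC -ler_pdivrMr //; lra.
apply: (le_trans (ler_pM _ _ WW hr)); rewrite ?rej_ge0 ?addr_ge0 ?lyap_ge0 //.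
have h3 : expR (eta * enorm w) * enorm w ^+ 2 <=
   16 * g * expR (4 * eta ^+ 2) * expR (enorm w ^+ 2 / (8 * g)).
  apply: (le_trans (ler_pM _ _ h1 h2)); rewrite ?expR_ge0 ?sqr_ge0 //.
  by rewrite -expR_16_8 //; set e := expR (_ / _); lra.
have : 0 <= W x * (2 * C) by apply: mulr_ge0 => //; apply: mulr_ge0 => //; exact: ltW.
move=> p0; have := ler_wpM2l p0 h3; rewrite /D; lra.
Qed.

(* Far away the drift of the proposal beats any prescribed multiple of [g], in particular the cost of rejections *)
Lemma drift : exists b g0 : R, [/\ 0 < b, 0 < g0 & forall (g : R) x, 0 < g <= g0 ->
  [/\ gint mu g (am g x) W, gint mu g (am g x) (fun y => (W x + W y) * rej g x y) &
      gexp mu g (am g x) W + rcost g x <= (1 - g) * W x + b * g]].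
Proof.
have [C2 [K2 [g2 [C20 K21 g20 Hfar]]]] := rcost_le_far.
have [Cn Cn0 Hnear] := rcost_le_near.
have [K1 [g1 [K11 g10 Hsqr]]] := am_sqr_le.
pose cQ := 2 * eta * d%:R + 2 * eta ^+ 2.
have cQ0 : 0 <= cQ by rewrite addr_ge0 ?mulr_ge0 ?sqr_ge0 // ltW.
(* A decay [expR (- (kp * g)) <= 1 - kp * g / 2] leaves [g] for the drift and [C2 * g] for the
   rejections. [B] is such that the step lowers [eta * jap x] by [g * (kp + cQ)], where [cQ] is the
   Gaussian excess of [gexp_lyap_le]. *)
pose kp := 2 * (1 + C2); have kp0 : 0 < kp by rewrite mulr_gt0 // ltr_wpDl.
pose B := 4 * (kp + cQ) / eta.
have [K3 K31 Hg] := growth B.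
pose K := Num.max K1 (Num.max K2 K3).
have K0 : 0 <= K by rewrite le_max (le_trans _ K11).
pose lm := eta * (L * K) + cQ.
have lm0 : 0 <= lm by rewrite addr_ge0 // !mulr_ge0 // ltW.
pose b := expR (eta * (1 + K)) * (1 + 2 * lm + Cn K).
pose g0 := Num.min (Num.min 1 (4 * eta)^-1) (Num.min (Num.min g1 g2) (Num.min kp^-1 (2 * lm + 1)^-1)).
have b0 : 0 < b by apply: mulr_gt0; [exact: expR_gt0|rewrite ltr_wpDr // ltr_wpDr // mulr_ge0].
exists b, g0; split=> //.
- by rewrite !lt_min ltr01 g10 g20 !invr_gt0 kp0 mulr_gt0 // ltr_wpDl // mulr_ge0.
move=> g x /andP[gp]; rewrite !le_min => /andP[/andP[gl1 ge] /andP[/andP[gg1 gg2] /andP[gk gm]]].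
have e4 : 0 < 4 * eta by rewrite mulr_gt0.
have ge4 : 4 * eta * g <= 1.
  by rewrite mulrC -ler_pdivlMr // mul1r.
have gk1 : g * kp <= 1 by rewrite -ler_pdivlMr // mul1r.
have gm1 : g * (2 * lm + 1) <= 1 by rewrite -ler_pdivlMr ?mul1r // ltr_wpDl // mulr_ge0.
have [iW hW] := gexp_lyap_le g (am g x) gp ge4.
have g01 : 0 < g <= 1 by rewrite gp.
have [i2 h2] := Hnear g x (enorm x) g01 (lexx _).
split=> //; have W0 := lyap_gt0 x.
have N0 := @enorm_ge0 R d.
have [xK|xK] := leP (enorm x) K; last first.
  have [xK1 xK2 xK3] : [/\ K1 <= enorm x, K2 <= enorm x & K3 <= enorm x].
    by move: (ltW xK); rewrite !ge_max => /and3P[-> -> ->].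
  have x1 : 1 <= enorm x by exact: le_trans xK1.
  have hr : rcost g x <= C2 * g * W x by apply: Hfar => //; rewrite gp.
  have hB := Hg x xK3.
  have hs : enorm (am g x) ^+ 2 <= enorm x ^+ 2 - g * (B * enorm x).
    apply: le_trans (Hsqr g x _ xK1) _; first by rewrite gp.
    by rewrite lerD2l lerN2 ler_pM2l.
  have J := jap_gt0 x; have J1 := jap_ge1 x.
  have J2 : jap x <= 2 * enorm x by have := jap_le x; lra.
  have B0 : 0 <= B by apply: divr_ge0; [apply: mulr_ge0 => //; apply: addr_ge0 => //; exact: ltW|exact: ltW].
  have hj : jap (am g x) <= jap x - g * B / 4.
    apply: (le_trans (jap_amgm x _)).
    have : (1 + enorm (am g x) ^+ 2) / jap x <= jap x - g * B / 2.
      rewrite ler_pdivrMr //.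
      have := jap_sqr x; have : g * B * jap x <= g * B * (2 * enorm x).
        by rewrite ler_wpM2l // mulr_ge0 // ltW.
      lra.
    lra.
  have hQ : gexp mu g (am g x) W <= W x * expR (- (kp * g)).
    apply: (le_trans hW); rewrite -!expRD ler_expR -/cQ.
    have : eta * jap (am g x) <= eta * (jap x - g * B / 4) by rewrite ler_pM2l.
    have -> : eta * (jap x - g * B / 4) = eta * jap x - g * (kp + cQ).
      by rewrite /B; field; rewrite gt_eqF.
    lra.
  have hk : expR (- (kp * g)) <= 1 - kp * g / 2.
    by apply: expRN_le_half; rewrite mulr_ge0 ?(ltW kp0) ?(ltW gp) // mulrC.
  have hQ2 : gexp mu g (am g x) W <= W x * (1 - kp * g / 2).
    by apply: (le_trans hQ); rewrite ler_pM2l.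
  have bg : 0 <= b * g by apply: mulr_ge0; exact: ltW.
  apply: (le_trans (lerD hQ2 hr)).
  rewrite /kp in bg *; lra.
have [_ hr] := Hnear g x K g01 xK.
have hj : jap (am g x) <= jap x + g * (L * K).
  apply: (le_trans (jap_lip x _)); rewrite lerD2l enormN enormZ gtr0_norm // ler_pM2l //.
  by apply: (le_trans (grad_le x)); rewrite ler_wpM2l.
have hQ : gexp mu g (am g x) W <= W x * expR (lm * g).
  apply: (le_trans hW); rewrite -!expRD ler_expR -/cQ.
  have : eta * jap (am g x) <= eta * (jap x + g * (L * K)) by rewrite ler_pM2l.
  rewrite /lm; lra.
have lg : expR (lm * g) <= 1 + 2 * (lm * g).
  apply: expR_le_1D2; apply/andP; split; first by rewrite mulr_ge0 // ltW.
  lra.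
have hQ2 : gexp mu g (am g x) W <= W x * (1 + 2 * (lm * g)).
  by apply: (le_trans hQ); rewrite ler_pM2l.
have Wb : W x <= expR (eta * (1 + K)).
  by rewrite ler_expR ler_pM2l // (le_trans (jap_le x)) // lerD2l.
have : W x * ((1 + 2 * lm + Cn K) * g) <= expR (eta * (1 + K)) * ((1 + 2 * lm + Cn K) * g).
  by rewrite ler_wpM2r // mulr_ge0 ?(ltW gp) // !addr_ge0 // mulr_ge0.
rewrite /b; have := lerD hQ2 hr; lra.
Qed.

End drift.

(** * Contraction of one step *)

Section profile.
Context {R : realType}.
Implicit Types (t lam g L D r q : R).

Lemma expRN_le_sqr t : 0 < t -> expR (- t) <= 2 / t ^+ 2.
Proof.
move=> t0; have t2 : 0 < t ^+ 2 by rewrite exprn_gt0.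
have h := @expR_ge1Dxn R t 1 (ltW t0); rewrite (_ : 2`!%:R = 2 :> R) // in h.
rewrite expRN -[leRHS]invrK lef_pV2 ?posrE ?expR_gt0 ?invr_gt0 ?divr_gt0 //.
by rewrite invf_div; lra.
Qed.

Lemma mulr_expRN_le t : t * expR (- t) <= 1.
Proof.
rewrite expRN -[t * _]/(t / expR t) ler_pdivrMr ?expR_gt0 // mul1r.
by apply: le_trans (expR_ge1Dx t); rewrite lerDr.
Qed.

(* [th := 1 / (16 g lam)] makes the error of [odd_profile_le] superlinear in the step [g] *)
Lemma profile_error_le g lam th : th = (16 * g * lam)^-1 -> 0 < g -> 0 < lam -> 64 * (g * lam ^+ 2) <= 1 ->
  expR (- th / lam + 4 * g * (lam + th) ^+ 2) <= 2 ^+ 11 * (g * lam ^+ 2) ^+ 2.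
Proof.
move=> thE g0 l0; set u := g * lam ^+ 2; move=> u1.
have u0 : 0 < u by rewrite mulr_gt0 // exprn_gt0.
have g1 : g != 0 by rewrite gt_eqF. have l1 : lam != 0 by rewrite gt_eqF.
have t0 : 0 < (32 * u)^-1 by rewrite invr_gt0 mulr_gt0.
have -> : 2 ^+ 11 * u ^+ 2 = 2 / (32 * u)^-1 ^+ 2 by field; rewrite gt_eqF.
apply: le_trans (expRN_le_sqr _ t0); rewrite ler_expR.
have -> : - th / lam + 4 * g * (lam + th) ^+ 2 = - (3 / (64 * u)) + 2^-1 + 4 * u.
  by rewrite thE /u; field; apply/andP.
have -> : (32 * u)^-1 = 2 / (64 * u) by field; rewrite gt_eqF.
have : 1 <= 1 / (64 * u).
  by rewrite ler_pdivlMr ?mulr_gt0 // mul1r.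
lra.
Qed.

Lemma profile_shift_le lam r z : expR (- lam * r) * (1 + z) <= expR (- lam * r + z).
Proof. by rewrite expRD ler_pM2l ?expR_gt0 // expR_ge1Dx. Qed.

(** The new exponent is [- lam * r + g * lam * (4 * lam - L * r)]: the variance contributes
    [4 * lam], the expansion of the gradient step [- L * r]. For [r <= D] the bracket is at least
    [3 * lam]. *)
Lemma profile_gain lam L D r g : 0 < g -> 0 < lam -> 0 <= L -> L * D <= lam -> r <= D ->
  2 - expR (- lam * ((1 + L * g) * r) + 4 * g * lam ^+ 2) <=
  2 - expR (- lam * r) - 3 * g * (lam ^+ 2 * expR (- lam * D)).
Proof.
move=> g0 l0 L0 LD rD; have l2 : 0 < lam ^+ 2 by rewrite exprn_gt0.
have -> : - lam * ((1 + L * g) * r) + 4 * g * lam ^+ 2 =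
  - lam * r + g * lam * (4 * lam - L * r) by ring.
have h := profile_shift_le lam r (g * lam * (4 * lam - L * r)).
have h2 : 3 * lam <= 4 * lam - L * r by have := ler_wpM2l L0 rD; lra.
have h3 : expR (- lam * D) <= expR (- lam * r) by rewrite ler_expR !mulNr lerN2 ler_pM2l.
have gl : 0 < g * lam by rewrite mulr_gt0.
have h4 : expR (- lam * D) * (g * lam * (3 * lam)) <= expR (- lam * r) * (g * lam * (4 * lam - L * r)).
  apply: ler_pM; rewrite ?expR_ge0 ?h3 ?(ler_pM2l gl) //.
  by apply: mulr_ge0; [exact: ltW|apply: mulr_ge0 => //; exact: ltW].
lra.
Qed.

(** At large distance the expansion may win, but only when [L * r > 4 * lam]. Then [r > 4 * D] and
    the profile is so flat that the loss is at most a third of the gain of [profile_gain]. *)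
Lemma profile_loss lam L D r g : 0 < g -> 2 <= lam -> 0 <= L -> L <= lam -> 0 < D -> L * D <= lam -> 0 <= r ->
  2 - expR (- lam * ((1 + L * g) * r) + 4 * g * lam ^+ 2) <=
  2 - expR (- lam * r) + g * (lam ^+ 2 * expR (- lam * D)).
Proof.
move=> g0 l1 L0 Ll D0 LD r0; have l0 : 0 < lam by apply: lt_le_trans l1.
have -> : - lam * ((1 + L * g) * r) + 4 * g * lam ^+ 2 =
  - lam * r + g * lam * (4 * lam - L * r) by ring.
have h := profile_shift_le lam r (g * lam * (4 * lam - L * r)).
have gl : 0 < g * lam by rewrite mulr_gt0.
have e0 := expR_ge0 (- lam * r).
have p0 : 0 <= lam ^+ 2 * expR (- lam * D) by rewrite mulr_ge0 ?sqr_ge0 ?expR_ge0.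
have [c|c] := leP (L * r) (4 * lam).
  have : 0 <= expR (- lam * r) * (g * lam * (4 * lam - L * r)).
    by apply: mulr_ge0 => //; apply: mulr_ge0; [exact: ltW|rewrite subr_ge0].
  have := mulr_ge0 (ltW g0) p0; lra.
have Lp : 0 < L.
  by rewrite lt_def L0 andbT; apply/eqP => L00; move: c; rewrite L00 mul0r; lra.
have rD : 4 * D < r.
  by rewrite -(ltr_pM2l Lp); lra.
have h1 : L * r * expR (- lam * r) <= lam * expR (- lam * D).
  have h2 : expR (- lam * r) = expR (- lam * (r - D)) * expR (- lam * D).
    by rewrite -expRD; congr expR; ring.
  rewrite h2 mulrA ler_pM2r ?expR_gt0 //.
  apply: (@le_trans _ _ (lam * (2 * (r - D)) * expR (- lam * (r - D)))).
    by rewrite ler_pM2r ?expR_gt0 //; apply: ler_pM => //; lra.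
  have := mulr_expRN_le (lam * (r - D)); rewrite mulNr => h3; lra.
have : 0 <= g * lam * (lam * expR (- lam * D) - L * r * expR (- lam * r)).
  by rewrite mulr_ge0 ?subr_ge0 // ltW.
have : 0 <= expR (- lam * r) * (g * lam * (4 * lam)).
  by apply: mulr_ge0 => //; apply: mulr_ge0; [exact: ltW|lra].
lra.
Qed.

(** Budget of a step: the drift yields [- ep * g * (wx + wy)] and costs [2 * ep * b * g = g * q],
    rejections cost a quarter of [ep * g * (wx + wy)], and the error [T] of the profile costs
    [g * q / 2]. *)
Lemma combine_bounds (dQ rx ry Qx Qy cx cy px py wx wy ep b C sg g q P T : R) :
  0 <= ep -> 0 <= g -> 0 <= wx + wy -> 2 * (ep * b) = q -> 8 * C * sg <= ep ->
  Qx + cx <= (1 - g) * wx + b * g -> Qy + cy <= (1 - g) * wy + b * g ->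
  px <= C * (g * sg) * wx -> py <= C * (g * sg) * wy ->
  rx <= 2 * px + ep * cx -> ry <= 2 * py + ep * cy ->
  T <= g * q / 2 -> dQ <= P + T + ep * (Qx + Qy) ->
  dQ + rx + ry <= P + g * q / 2 + ep * (wx + wy) - 3 / 4 * (ep * g * (wx + wy)) + g * q.
Proof.
move=> e0 g0 s0 eb eC dx dy hx hy kx ky hT hQ.
have k1 := ler_wpM2l e0 (lerD dx dy).
have k2 := ler_wpM2r (mulr_ge0 g0 s0) eC.
rewrite -eb in hT *; lra.
Qed.

(** The gain [3 * g * q] exceeds the costs [g * q] and [g * q / 2], and the remainder covers
    [c * g * F <= g * q]. *)
Lemma combine_near (X P F S ep g q c : R) :
  0 <= g -> 0 <= c -> 0 <= ep -> 0 <= S -> 0 <= q -> c <= 4^-1 -> c <= q / 2 -> F <= 2 ->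
  X <= P + g * q / 2 + ep * S - 3 / 4 * (ep * g * S) + g * q ->
  P <= F - 3 * g * q -> X <= (1 - c * g) * (F + ep * S).
Proof.
move=> g0 c0 e0 S0 q0 c4 cq F2 h1 h2.
have k1 := ler_wpM2r (mulr_ge0 (mulr_ge0 e0 g0) S0) c4.
have k2 := ler_wpM2l (mulr_ge0 c0 g0) F2.
have k3 := ler_wpM2r g0 cq.
have k4 := mulr_ge0 (mulr_ge0 e0 g0) S0; have k5 := mulr_ge0 g0 q0.
lra.
Qed.

(** The costs add up to [5 / 2 * g * q], and [c * g * F] to at most [g * q]. From
    [3 / 4 * ep * g * S], a quarter of [ep * g * S] pays for the rate and the remaining half is at
    least [8 * ep * g * b = 4 * g * q]. *)
Lemma combine_far (X P F S ep g q c b : R) :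
  0 <= g -> 0 <= c -> 0 <= ep -> 0 <= S -> 0 <= q -> c <= 4^-1 -> c <= q / 2 -> F <= 2 ->
  2 * (ep * b) = q -> 16 * b <= S ->
  X <= P + g * q / 2 + ep * S - 3 / 4 * (ep * g * S) + g * q ->
  P <= F + g * q -> X <= (1 - c * g) * (F + ep * S).
Proof.
move=> g0 c0 e0 S0 q0 c4 cq F2 eb bS h1 h2.
have k1 := ler_wpM2r (mulr_ge0 (mulr_ge0 e0 g0) S0) c4.
have k2 := ler_wpM2l (mulr_ge0 c0 g0) F2.
have k3 := ler_wpM2r g0 cq.
have k4 := ler_wpM2l (mulr_ge0 e0 g0) bS.
have k5 := mulr_ge0 g0 q0.
rewrite -eb in h1 h2 cq k3 k5 *; lra.
Qed.

Lemma lyap_growth_bound (Q r w b g : R) : 0 <= b -> 0 < g -> g <= 1 -> 1 <= w -> 0 <= r ->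
  Q + r <= (1 - g) * w + b * g -> Q <= (1 + b) * w.
Proof.
move=> b0 g0 g1 w1 r0 h.
have k1 := ler_wpM2l b0 g1; have k2 := ler_wpM2l b0 w1.
have k3 : 0 <= g * w by rewrite mulr_ge0 ?(ltW g0) // (le_trans _ w1).
lra.
Qed.

Lemma error_budget (g q T : R) : 0 < g -> 0 < T -> g <= q / (2 * T) -> T * g ^+ 2 <= g * q / 2.
Proof.
move=> g0 T0; rewrite ler_pdivlMr ?mulr_gt0 // => /(ler_wpM2l (ltW g0)); lra.
Qed.

Lemma far_apart (eta b x y r : R) : 0 < eta -> 0 <= b -> 1 + 2 * (16 * b) / eta < r ->
  eta * r <= x + y -> 16 * b <= x + y.
Proof.
move=> e0 b0 h; apply: le_trans; have := ltr_pM2l e0 (1 + 2 * (16 * b) / eta) r; rewrite h.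
have -> : eta * (1 + 2 * (16 * b) / eta) = eta + 32 * b by field; rewrite gt_eqF.
lra.
Qed.

End profile.

(** * One step of the kernel in the weighted distance *)

Section kernel_contraction.
Context {R : realType} {d : nat}.
Variables (mu : {measure set Rd R d -> \bar R}) (Hmu : is_lebesgue mu).
Variables (U : 'rV[R]_d -> R) (gradU : 'rV[R]_d -> 'rV[R]_d) (L eta : R).
Local Notation E := (Rd_measurableType R d).
Local Notation rej := (reject U gradU).
Local Notation W := (lyap eta).
Local Notation am := (prop_mean gradU).
Hypotheses (mU : measurable_fun setT (U : E -> R))
  (mG : measurable_fun setT (gradU : E -> Rd R d))
  (eta0 : 0 < eta) (HL : 0 <= L)
  (grad_lip : forall x v, enorm (gradU (x + v) - gradU x) <= L * enorm v)
  (rprob_small : exists2 C : R, 0 < C & forall (g : R) x, 0 < g <= 1 ->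
    gint mu g (am g x) (rej g x) /\
    rprob mu U gradU g x <= C * (g * Num.sqrt g) * W x)
  (lyap_drift : exists b g0 : R, [/\ 0 < b, 0 < g0 & forall (g : R) x, 0 < g <= g0 ->
    [/\ gint mu g (am g x) W, gint mu g (am g x) (fun y => (W x + W y) * rej g x y) &
      gexp mu g (am g x) W + rcost mu U gradU eta g x <= (1 - g) * W x + b * g]]).

(** The kernel as a perturbation of its proposal by the rejections; [mala_opE] identifies it with
    [mala_op] on the functions considered. *)
Definition kernel_op (g : R) (f : 'rV[R]_d -> R) (x : 'rV[R]_d) : R :=
  gexp mu g (am g x) f + gexp mu g (am g x) (fun y => (f x - f y) * rej g x y).

(** Represents the distance off the diagonal only: at [x = y] the formula does not vanish, hence the
    conditions [x != y] throughout. *)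
Definition wdist (lam ep : R) (x y : 'rV[R]_d) : R :=
  2 - expR (- lam * enorm (x - y)) + ep * (W x + W y).

Lemma wdist_le (lam ep : R) x y : wdist lam ep x y <= 2 + ep * (W x + W y).
Proof. by rewrite lerD2r gerBl expR_ge0. Qed.

Lemma osc_le (lam ep K : R) (f : 'rV[R]_d -> R) x y : 0 <= ep -> 0 <= K ->
  (forall x y, x != y -> `|f x - f y| <= K * wdist lam ep x y) ->
  `|f x - f y| <= K * (2 + ep * (W x + W y)).
Proof.
move=> e0 K0 H; have [->|xy] := eqVneq x y.
  rewrite subrr normr0 mulr_ge0 // addr_ge0 // mulr_ge0 // addr_ge0 ?lyap_ge0 //.
by apply: (le_trans (H _ _ xy)); rewrite ler_wpM2l // wdist_le.
Qed.

Lemma gint_osc (g lam ep K : R) (f : 'rV[R]_d -> R) a : 0 < g -> 0 <= ep -> 0 <= K ->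
  measurable_fun setT (f : E -> R) -> gint mu g a W ->
  (forall x y, x != y -> `|f x - f y| <= K * wdist lam ep x y) -> gint mu g a f.
Proof.
move=> g0 e0 K0 mf iW H.
have [i1 _] := gexp_cst mu Hmu g a (`|f a| + K * (2 + ep * W a)) g0.
apply: (gint_dom mu g a f (fun u => `|f a| + K * (2 + ep * W a) + K * ep * W u) mf).
  exact: (gintD _ _ _ _ _ i1 (gintZ _ _ _ (K * ep) _ iW)).
move=> u; have := osc_le lam ep K f u a e0 K0 H.
have := ler_normD (f u - f a) (f a); rewrite subrK; lra.
Qed.

Lemma reject_term_le (g lam ep : R) (f : 'rV[R]_d -> R) x : 0 <= ep ->
  measurable_fun setT (f : E -> R) ->
  gint mu g (am g x) (rej g x) -> gint mu g (am g x) (fun y => (W x + W y) * rej g x y) ->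
  (forall x y, x != y -> `|f x - f y| <= wdist lam ep x y) ->
  gint mu g (am g x) (fun y => (f x - f y) * rej g x y) /\
  `|gexp mu g (am g x) (fun y => (f x - f y) * rej g x y)| <=
    2 * rprob mu U gradU g x + ep * rcost mu U gradU eta g x.
Proof.
move=> e0 mf i1 i2 H.
pose h y := 2 * rej g x y + ep * ((W x + W y) * rej g x y).
have m1 : measurable_fun setT ((fun y => (f x - f y) * rej g x y) : E -> R).
  apply: measurable_funM; first exact: measurable_funB.
  exact: measurable_rej1.
have j1 := gintZ _ _ _ 2 _ i1; have j2 := gintZ _ _ _ ep _ i2.
have ih : gint mu g (am g x) h by exact: (gintD _ _ _ _ _ j1 j2).
have fh y : `|(f x - f y) * rej g x y| <= h y.
  rewrite normrM (ger0_norm (rej_ge0 _ _ _ _ _)) /h.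
  have H1 z w : z != w -> `|f z - f w| <= 1 * wdist lam ep z w by rewrite mul1r; exact: H.
  have := osc_le lam ep 1 f x y e0 ler01 H1; rewrite mul1r => h1.
  by have := ler_wpM2r (rej_ge0 U gradU g x y) h1; lra.
split; first exact: (gint_dom mu g (am g x) _ h m1 ih fh).
apply: (le_trans (normr_gexp mu g (am g x) _ h m1 ih fh)).
by rewrite /h (gexpD _ _ _ _ _ j1 j2) (gexpZ _ _ _ 2 _ i1) (gexpZ _ _ _ ep _ i2).
Qed.

Lemma proposal_contraction (g lam ep : R) (f : 'rV[R]_d -> R) x y :
  0 < g -> 0 < lam -> 64 * (g * lam ^+ 2) <= 1 -> 0 <= ep ->
  measurable_fun setT (f : E -> R) -> gint mu g (am g x) W -> gint mu g (am g y) W ->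
  (forall x y, x != y -> `|f x - f y| <= wdist lam ep x y) ->
  `|gexp mu g (am g x) f - gexp mu g (am g y) f| <=
    2 - expR (- lam * ((1 + L * g) * enorm (x - y)) + 4 * g * lam ^+ 2) +
    2 ^+ 11 * (g * lam ^+ 2) ^+ 2 + ep * (gexp mu g (am g x) W + gexp mu g (am g y) W).
Proof.
move=> g0 l0 gl e0 mf iWx iWy H.
have H1 z w : z != w -> `|f z - f w| <= 1 * wdist lam ep z w by rewrite mul1r; exact: H.
have ifx := gint_osc g lam ep 1 f (am g x) g0 e0 ler01 mf iWx H1.
have ify := gint_osc g lam ep 1 f (am g y) g0 e0 ler01 mf iWy H1.
have dist_le : enorm (am g x - am g y) <= (1 + L * g) * enorm (x - y).
  have -> : am g x - am g y = (x - y) - g *: (gradU (y + (x - y)) - gradU y).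
    by rewrite /prop_mean (addrC y (x - y)) subrK scalerBr !opprD !opprK addrACA.
  apply: (le_trans (enormD _ _)); rewrite enormN enormZ gtr0_norm //.
  have := ler_wpM2l (ltW g0) (grad_lip y (x - y)); lra.
have T0 : 0 <= 2 ^+ 11 * (g * lam ^+ 2) ^+ 2.
  by apply: mulr_ge0; [exact: exprn_ge0|exact: sqr_ge0].
have e1 : expR (- lam * ((1 + L * g) * enorm (x - y)) + 4 * g * lam ^+ 2) <=
  expR (- lam * enorm (am g x - am g y) + 4 * g * lam ^+ 2).
  rewrite ler_expR (lerD2r (4 * g * lam ^+ 2)) (mulNr lam) (mulNr lam) lerN2 (ler_pM2l l0).
  exact: dist_le.
(* Coinciding means have no bisector. The left side is then 0, and [4 * g * lam ^+ 2 <= 1 / 16]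
   makes the right side nonnegative. *)
have [xy|xy] := eqVneq (am g x) (am g y).
  rewrite xy subrr normr0; rewrite xy subrr enorm0 mulr0 add0r in e1.
  have : 0 <= ep * (gexp mu g (am g y) W + gexp mu g (am g y) W).
    by apply: mulr_ge0 => //; apply: addr_ge0; apply: gexp_ge0 => u; exact: lyap_ge0.
  have : expR (4 * g * lam ^+ 2) <= 1 + 2 * (4 * g * lam ^+ 2).
    apply: expR_le_1D2; apply/andP; split; last by lra.
    by apply: mulr_ge0; [apply: mulr_ge0 => //; exact: ltW|exact: sqr_ge0].
  lra.
(* The truncation at 0 matters only for negative arguments, where the coupling lemma still requires
   [0 <= F t]. *)
pose F (t : R) := Num.max 0 (2 - expR (- lam * t)).
pose F1 (t : R) := 2 - expR (- lam * t).
have FE t : 0 <= t -> F t = F1 t.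
  move=> t0; apply/max_idPr; have : expR (- lam * t) <= 1.
    by rewrite -expR0 ler_expR mulNr oppr_le0 mulr_ge0 // ltW.
  rewrite /F1; lra.
have mF : measurable_fun setT F.
  apply: measurable_maxr => //; apply: measurable_funB => //.
  by apply: measurableT_comp => //; exact: measurable_funM.
have F2 t : 0 <= F t <= 2.
  by rewrite /F le_max lexx /= ge_max; apply/andP; split => //; rewrite gerBl expR_ge0.
have HF u v : u != v -> `|f u - f v| <= F (enorm (u - v)) + ep * (W u + W v).
  by move=> uv; rewrite FE ?enorm_ge0 //; exact: H.
have := reflection_coupling mu Hmu g g0 _ _ xy f W F ep ifx ify iWx iWy mF F2 e0 (@lyap_ge0 _ _ _) HF.
move=> /le_trans; apply; rewrite lerD2r.
have th0 : 0 < (16 * g * lam)^-1 by rewrite invr_gt0 !mulr_gt0.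
have -> : (fun u => Num.sg (sdist (am g x) (am g y) u) * F `|sdist (am g x) (am g y) u|) =
  (fun u => Num.sg (sdist (am g x) (am g y) u) * (2 - expR (- lam * `|sdist (am g x) (am g y) u|))).
  by apply: funext => u; rewrite FE.
apply: (le_trans (gexp_profile_le mu Hmu g g0 _ _ xy lam _ l0 th0)).
apply: lerD; first by rewrite lerD2l lerN2.
exact: profile_error_le.
Qed.

Lemma kernel_contraction : exists lam ep c g0 B : R, [/\ 0 < lam, 0 < ep, 0 < c, 0 < g0 &
  forall g : R, 0 < g <= g0 -> [/\ c * g < 1,
    forall x, [/\ gint mu g (am g x) W, gexp mu g (am g x) W <= B * W x,
        gint mu g (am g x) (rej g x) &
        gint mu g (am g x) (fun y => (W x + W y) * rej g x y)] &
    forall f : 'rV[R]_d -> R, measurable_fun setT (f : E -> R) ->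
      (forall x y : 'rV[R]_d, x != y -> `|f x - f y| <= wdist lam ep x y) ->
      forall x y : 'rV[R]_d, x != y -> `|kernel_op g f x - kernel_op g f y| <= (1 - c * g) * wdist lam ep x y]].
Proof.
have L0 := HL; have [C C0 Hrp] := rprob_small; have [b [g1 [b0 g10 Hdr]]] := lyap_drift.
(* [D] is chosen from [eta * enorm z <= W z]: two points farther apart than [D] satisfy
   [S0 <= W x + W y], as [combine_far] requires. *)
pose S0 := 16 * b; pose D := 1 + 2 * S0 / eta.
have S00 : 0 < S0 by rewrite mulr_gt0.
have D1 : 1 <= D by rewrite lerDl; apply: divr_ge0; [apply: mulr_ge0 => //; exact: ltW|exact: ltW].
have D0 : 0 < D by apply: lt_le_trans D1.
(* A single choice that exceeds 2, [L] and [L * D], the three lower bounds needed by the gain and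
   loss estimates. *)
pose lam := (L + 2) * D.
have lam2 : 2 <= lam by rewrite -[leLHS]mulr1; apply: ler_pM => //; lra.
have lamL : L <= lam by rewrite -[leLHS]mulr1; apply: ler_pM => //; lra.
have lam0 : 0 < lam by apply: lt_le_trans lam2.
have lamLD : L * D <= lam by rewrite ler_pM2r //; lra.
pose q := lam ^+ 2 * expR (- lam * D).
have q0 : 0 < q by rewrite mulr_gt0 ?expR_gt0 // exprn_gt0.
(* Balances weight and profile: the drift constants of the two points cost [2 * ep * b * g = q * g],
   a third of the gain. *)
pose ep := q / (2 * b).
have ep0 : 0 < ep by rewrite divr_gt0 // mulr_gt0.
have epb : 2 * (ep * b) = q by rewrite /ep; field; rewrite gt_eqF.
pose c := Num.min 4^-1 (q / 2).
have c0 : 0 < c by rewrite lt_min; apply/andP; split; [rewrite invr_gt0|exact: divr_gt0].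
have c4 : c <= 4^-1 by rewrite ge_min lexx.
have cq : c <= q / 2 by rewrite ge_min lexx orbT.
pose T := 2 ^+ 11 * (lam ^+ 2) ^+ 2.
have T0 : 0 < T by apply: mulr_gt0; rewrite ?exprn_gt0.
(* Besides the range of the rejection and drift estimates, the bounds on [g] make the profile error
   [T * g ^+ 2] at most [g * q / 2], allow [profile_error_le], and bring rejections below
   [ep * g / 4] through [8 * C * Num.sqrt g <= ep]. *)
pose g0 := Num.min (Num.min 1 g1) (Num.min (q / (2 * T)) (Num.min (64 * lam ^+ 2)^-1 ((ep / (8 * C)) ^+ 2))).
have epC : 0 < ep / (8 * C) by rewrite divr_gt0 // mulr_gt0.
have l64 : 0 < 64 * lam ^+ 2 by rewrite mulr_gt0 // exprn_gt0.
exists lam, ep, c, g0, (1 + b); split=> //.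
  rewrite !lt_min ltr01 g10 invr_gt0 l64 (exprn_gt0 _ epC) !andbT /=.
  by rewrite divr_gt0 // mulr_gt0.
move=> g /andP[gp]; rewrite !le_min => /andP[/andP[gl1 gg1] /and3P[gT gl gC]].
have gT' : T * g ^+ 2 <= g * q / 2 := error_budget _ _ _ gp T0 gT.
have gl' : 64 * (g * lam ^+ 2) <= 1.
  have : g * (64 * lam ^+ 2) <= 1 by rewrite -ler_pdivlMr // mul1r.
  lra.
have gC' : 8 * C * Num.sqrt g <= ep.
  have h : Num.sqrt g <= ep / (8 * C).
    by rewrite -(ler_pXn2r (n := 2)) ?nnegrE ?sqrtr_ge0 ?(ltW epC) // sqr_sqrtr // ltW.
  by rewrite mulrC -ler_pdivlMr // mulr_gt0.
have G x : [/\ gint mu g (am g x) W, gexp mu g (am g x) W <= (1 + b) * W x,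
        gint mu g (am g x) (rej g x) &
        gint mu g (am g x) (fun y => (W x + W y) * rej g x y)].
  have g01 : 0 < g <= 1 by rewrite gp.
  have g02 : 0 < g <= g1 by rewrite gp.
  have [? _] := Hrp g x g01; have [? ? hQ] := Hdr g x g02; split=> //.
  have rc0 : 0 <= rcost mu U gradU eta g x.
    apply: gexp_ge0 => y; apply: mulr_ge0; last exact: rej_ge0.
    by apply: addr_ge0; exact: lyap_ge0.
  exact: (lyap_growth_bound _ _ _ _ _ (ltW b0) gp gl1 (lyap_ge1 eta eta0 x) rc0 hQ).
split=> //; first by have := ler_wpM2r (ltW gp) c4; lra.
move=> f mf H x y xy.
have [iWx _ irx iwx] := G x; have [iWy _ iry iwy] := G y.
have g01 : 0 < g <= 1 by rewrite gp.
have g02 : 0 < g <= g1 by rewrite gp.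
have [_ px] := Hrp g x g01; have [_ py] := Hrp g y g01.
have [_ _ dx] := Hdr g x g02; have [_ _ dy] := Hdr g y g02.
have [_ rx] := reject_term_le g lam ep f x (ltW ep0) mf irx iwx H.
have [_ ry] := reject_term_le g lam ep f y (ltW ep0) mf iry iwy H.
have Pr := proposal_contraction g lam ep f x y gp lam0 gl' (ltW ep0) mf iWx iWy H.
have W0x := lyap_gt0 eta x; have W0y := lyap_gt0 eta y.
set S := W x + W y; have S1 : 0 < S by rewrite addr_gt0.
set F := 2 - expR (- lam * enorm (x - y)).
have F2 : F <= 2 by rewrite gerBl expR_ge0.
have main : `|kernel_op g f x - kernel_op g f y| <=
   2 - expR (- lam * ((1 + L * g) * enorm (x - y)) + 4 * g * lam ^+ 2) +
   g * q / 2 + ep * S - (3 / 4) * (ep * g * S) + g * q.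
  have e1 := ler_normD (gexp mu g (am g x) f - gexp mu g (am g y) f)
    (gexp mu g (am g x) (fun z => (f x - f z) * rej g x z) - gexp mu g (am g y) (fun z => (f y - f z) * rej g y z)).
  have e2 := ler_normB (gexp mu g (am g x) (fun z => (f x - f z) * rej g x z))
    (gexp mu g (am g y) (fun z => (f y - f z) * rej g y z)).
  have -> : kernel_op g f x - kernel_op g f y = gexp mu g (am g x) f - gexp mu g (am g y) f +
    (gexp mu g (am g x) (fun z => (f x - f z) * rej g x z) - gexp mu g (am g y) (fun z => (f y - f z) * rej g y z)).
    by rewrite /kernel_op opprD addrACA.
  have k3 : 2 ^+ 11 * (g * lam ^+ 2) ^+ 2 <= g * q / 2.
    by rewrite exprMn (mulrC (g ^+ 2)) mulrA; exact: gT'.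
  apply: (le_trans e1); apply: (le_trans (lerD (lexx _) e2)); rewrite addrA.
  exact: (combine_bounds _ _ _ _ _ _ _ _ _ _ _ _ _ _ _ _ _ _ _ (ltW ep0) (ltW gp) (ltW S1) epb gC' dx dy px py rx ry k3 Pr).
have [rD|rD] := leP (enorm (x - y)) D.
  have hP := profile_gain lam L D (enorm (x - y)) g gp lam0 HL lamLD rD.
  exact: (combine_near _ _ _ _ _ _ _ _ (ltW gp) (ltW c0) (ltW ep0) (ltW S1) (ltW q0) c4 cq F2 main hP).
have hP := profile_loss lam L D (enorm (x - y)) g gp lam2 HL lamL D0 lamLD (enorm_ge0 _).
apply: (combine_far _ _ _ _ _ _ _ _ _ (ltW gp) (ltW c0) (ltW ep0) (ltW S1) (ltW q0) c4 cq F2 epb _ main hP).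
have h (z : 'rV[R]_d) : eta * enorm z <= W z.
  apply: le_trans (lyap_ge_enorm eta eta0 z); apply: le_trans (expR_ge1Dx _).
  by rewrite lerDr.
apply: (far_apart eta b _ _ _ eta0 (ltW b0) rD).
apply: le_trans (lerD (h x) (h y)); rewrite -mulrDr (ler_pM2l eta0).
by have := enormD x (- y); rewrite enormN.
Qed.

End kernel_contraction.

(** * Invariance and conclusion *)

Lemma integral_expRN_norm {R : realType} :
  (\int[lebesgue_measure]_t (expR (- `|t : R|))%:E = 2%:E)%E.
Proof.
rewrite ge0_symfun_integralT.
- rewrite -[RHS]mule1 -(integral_exponential_pdf (ltr01 : 0 < (1 : R))); congr (_ * _)%E.
  rewrite (_ : [set x | _] = `[0, +oo[%classic); last first.
    by apply/seteqP; split => x /=; rewrite in_itv /= andbT.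
  rewrite [LHS]integral_mkcond; apply: eq_integral => t _.
  rewrite /exponential_pdf !patchE; case: ifPn => // /[!inE] /=; rewrite in_itv /= andbT => t0.
  by rewrite mul1r mulN1r ger0_norm.
- by move=> t; exact: expR_ge0.
- move=> t; apply: (@continuous_comp _ _ _ (fun t : R => - `|t|) expR); last exact: continuous_expR.
  by apply: (@continuousN _ R^o); exact: norm_continuous.
- by move=> t /=; rewrite normrN.
Qed.

Section gibbs.
Context {R : realType} {d : nat}.
Variables (mu : {measure set Rd R d -> \bar R}) (Hmu : is_lebesgue mu).
Variables (U : 'rV[R]_d -> R) (gradU : 'rV[R]_d -> 'rV[R]_d) (L eta : R).
Local Notation E := (Rd_measurableType R d).
Local Notation W := (lyap eta).
Hypotheses (mU : measurable_fun setT (U : E -> R)) (eta0 : 0 < eta) (HL : 0 <= L)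
  (derive_U : forall x v (t : R),
    is_derive t (1 : R) (fun s : R => U (x + s *: v)) (dotR (gradU (x + t *: v)) v))
  (grad_le : forall x, enorm (gradU x) <= L * enorm x)
  (growth : forall B : R, exists2 K, 1 <= K & forall x, K <= enorm x ->
    B * enorm x <= dotR (gradU x) x).

Lemma normr_coord_le (x : 'rV[R]_d) i : `|x ord0 i| <= enorm x.
Proof.
rewrite -(ler_pXn2r (n := 2)) ?nnegrE ?enorm_ge0 // enorm_sqr dotRE (bigD1 i) //=.
by rewrite real_normK ?num_real // lerDl sumr_ge0 // => j _; exact: sqr_ge0.
Qed.

(** [d%:R * enorm x] dominates the sum of the absolute coordinates, so the integrand lies below a
    product of one-dimensional Laplace functions, each of integral 2. *)
Lemma integral_expRN_enorm :
  (\int[mu]_x (expR (- (d%:R * enorm (x : 'rV[R]_d))))%:E <= (2 ^+ d)%:E)%E.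
Proof.
have mN : measurable_fun [set: R] (fun t : R => expR (- `|t|)).
  by apply: measurableT_comp => //; apply: measurableT_comp => //; exact: measurable_normr.
rewrite -(lebesgue_integral_prod d mu _ 2 Hmu mN (fun t => expR_ge0 _) integral_expRN_norm).
have EP (x : 'rV[R]_d) : \prod_i expR (- `|x ord0 i|) = expR (\sum_i - `|x ord0 i|).
  by rewrite expR_sum.
apply: ge0_le_integral => //.
- apply/measurable_EFinP; apply: measurableT_comp => //; apply: measurableT_comp => //.
  by apply: measurable_funM => //; exact: (measurable_enorm (fun x : E => x) measurable_idRd).
- under eq_fun do rewrite EP.
  apply/measurable_EFinP; apply: measurableT_comp => //; apply: measurable_sum => i.
  by apply: measurableT_comp => //; apply: measurableT_comp => //; exact: measurable_coord.
move=> x _; rewrite lee_fin EP ler_expR sumrN lerN2.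
apply: (@le_trans _ _ (\sum_(i < d) enorm x)); first by apply: ler_sum => i _; exact: normr_coord_le.
by rewrite sumr_const card_ord mulr_natl.
Qed.

Lemma potential_quadratic x : `|U x - U 0| <= L * enorm x ^+ 2.
Proof.
have [c /andP[c0 c1]] := mean_value _ _ 0 1 ler01 (derive_U 0 x).
rewrite scale1r scale0r !add0r subr0 mulr1 => ->.
apply: (le_trans (normr_dotR _ _)); rewrite expr2 mulrA ler_wpM2r ?enorm_ge0 //.
apply: (le_trans (grad_le _)); rewrite enormZ ger0_norm // ler_wpM2l //.
by rewrite ler_piMl ?enorm_ge0.
Qed.

(** Outside radius [K] the radial derivative of [U] is at least [B]; it is integrated along the ray
    from radius [K], where [potential_quadratic] bounds [U] from below. *)
Lemma potential_growth (B : R) : 0 <= B -> exists C : R, forall x, B * enorm x - C <= U x.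
Proof.
move=> B0; have [K K1 H] := growth B; have K0 : 0 <= K by exact: le_trans K1.
have small x : enorm x <= K -> U 0 - L * K ^+ 2 <= U x.
  move=> xK; have := potential_quadratic x; rewrite ler_norml => /andP[h _].
  have : L * enorm x ^+ 2 <= L * K ^+ 2.
    by rewrite ler_wpM2l // lerXn2r ?nnegrE ?enorm_ge0.
  lra.
exists (L * K ^+ 2 + B * K - U 0) => x.
have [xK|xK] := leP (enorm x) K.
  by have := small x xK; have := ler_wpM2l B0 xK; lra.
have [e e1 ->] : exists2 e, enorm e = 1 & x = enorm x *: e.
  by apply: unit_dir; apply: contraTneq xK => ->; rewrite enorm0 -leNgt.
have r0 := enorm_ge0 x; rewrite (enorm_ray e _ e1 r0).
have [c /andP[cK cr]] := mean_value _ _ K (enorm x) (ltW xK) (derive_U 0 e).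
have c0 : 0 < c by apply: lt_le_trans cK; exact: lt_le_trans K1.
have := H (c *: e); rewrite (enorm_ray e _ e1 (ltW c0)) dotRZr !add0r => /(_ cK).
rewrite mulrC ler_pM2l // => h2 h3.
have h4 : B * (enorm x - K) <= dotR (gradU (c *: e)) e * (enorm x - K).
  by rewrite ler_wpM2r // subr_ge0 ltW.
have := small (K *: e); rewrite (enorm_ray e _ e1 K0) => /(_ (lexx _)); lra.
Qed.

Lemma measurable_gibbs : measurable_fun setT ((fun x => expR (- U x)) : E -> R).
Proof. by apply: measurableT_comp => //; exact: measurableT_comp. Qed.

Lemma lyap_gibbs_ge0 x : 0 <= W x * expR (- U x).
Proof. by apply: mulr_ge0; [exact: lyap_ge0|exact: expR_ge0]. Qed.

Lemma integral_lyap_gibbs_lty : (\int[mu]_x (W (x : 'rV[R]_d) * expR (- U x))%:E < +oo)%E.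
Proof.
(* The growth rate [eta + d%:R] pays for [W] with [eta] and leaves the rate [d%:R] for
   [integral_expRN_enorm]. *)
have B0 : 0 <= eta + d%:R by rewrite addr_ge0 // ltW.
have [C HC] := potential_growth _ B0.
have k0 : (0 <= (expR (eta + C))%:E)%E by rewrite lee_fin expR_ge0.
have mE : measurable_fun setT (fun x : E => (expR (- (d%:R * enorm (x : 'rV[R]_d))))%:E).
  apply/measurable_EFinP; apply: measurableT_comp => //; apply: measurableT_comp => //.
  by apply: measurable_funM => //; exact: (measurable_enorm (fun x : E => x) measurable_idRd).
have e0 (x : E) : setT x -> (0 <= (expR (- (d%:R * enorm (x : 'rV[R]_d))))%:E)%E.
  by move=> _; rewrite lee_fin expR_ge0.
apply: (@le_lt_trans _ _ ((expR (eta + C))%:E * (2 ^+ d)%:E)%E); last by rewrite -EFinM ltry.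
refine (le_trans _ (lee_wpmul2l k0 integral_expRN_enorm)).
rewrite -(ge0_integralZl mu measurableT mE e0 k0).
apply: ge0_le_integral; [exact: measurableT| | | | ].
- by move=> x _; rewrite lee_fin; exact: lyap_gibbs_ge0.
- apply/measurable_EFinP; apply: measurable_funM; [exact: measurable_lyap|exact: measurable_gibbs].
- exact: measurable_funeM.
move=> x _; rewrite -EFinM lee_fin -!expRD ler_expR.
have := ler_wpM2l (ltW eta0) (jap_le x); have := HC x; lra.
Qed.

Lemma integral_gibbs_le : (\int[mu]_x (expR (- U (x : 'rV[R]_d)))%:E <=
  \int[mu]_x (W (x : 'rV[R]_d) * expR (- U x))%:E)%E.
Proof.
apply: ge0_le_integral => //.
- by apply/measurable_EFinP; exact: measurable_gibbs.
- apply/measurable_EFinP; apply: measurable_funM; [exact: measurable_lyap|exact: measurable_gibbs].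
by move=> x _; rewrite lee_fin ler_peMl ?expR_ge0 // lyap_ge1.
Qed.

(** Finiteness matters as much as positivity, since [fine] sends infinity to 0. The lower bound is a
    Gaussian from [potential_quadratic], with [L + 1] to keep its variance finite when [L = 0]. *)
Lemma Zpi_gt0 : 0 < Zpi mu U.
Proof.
have L1 : 0 < (L + 1)^-1 by rewrite invr_gt0 ltr_wpDl.
apply: fine_gt0; apply/andP; split; last exact: le_lt_trans integral_gibbs_le integral_lyap_gibbs_lty.
have k0 : (0 <= (expR (- U 0))%:E)%E by rewrite lee_fin expR_ge0.
have mE : measurable_fun setT (fun x : E => (expR (- enorm (x : 'rV[R]_d) ^+ 2 / (L + 1)^-1))%:E).
  apply/measurable_EFinP; apply: measurableT_comp => //; apply: measurable_funM => //; apply: measurableT_comp => //.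
  exact: (measurable_enorm_sqr (fun x : E => x) measurable_idRd).
have e0 (x : E) : setT x -> (0 <= (expR (- enorm (x : 'rV[R]_d) ^+ 2 / (L + 1)^-1))%:E)%E.
  by move=> _; rewrite lee_fin expR_ge0.
apply: (@lt_le_trans _ _ ((expR (- U 0))%:E * (powR ((L + 1)^-1 * pi) (d%:R / 2))%:E)%E).
  by rewrite -EFinM lte_fin mulr_gt0 ?expR_gt0 // powR_gt0 // mulr_gt0 // pi_gt0.
rewrite -(lebesgue_integral_gauss _ _ _ Hmu L1) -(ge0_integralZl mu measurableT mE e0 k0).
apply: ge0_le_integral => //.
- exact: measurable_funeM.
- by apply/measurable_EFinP; exact: measurable_gibbs.
move=> x _; rewrite -EFinM lee_fin -expRD ler_expR invrK.
have := potential_quadratic x; rewrite ler_norml => /andP[_]; have := sqr_ge0 (enorm x); lra.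
Qed.

Lemma measurable_pidens : measurable_fun setT (pidens mu U : E -> R).
Proof. by apply: measurable_funM => //; exact: measurable_gibbs. Qed.

Lemma integral_pidens : (\int[mu]_x (pidens mu U (x : 'rV[R]_d))%:E = 1)%E.
Proof.
have Z0 := Zpi_gt0.
have z0 : (0 <= ((Zpi mu U)^-1)%:E)%E by rewrite lee_fin invr_ge0 ltW.
have mE : measurable_fun setT (fun x : E => (expR (- U (x : 'rV[R]_d)))%:E).
  by apply/measurable_EFinP; exact: measurable_gibbs.
have e0 (x : E) : setT x -> (0 <= (expR (- U (x : 'rV[R]_d)))%:E)%E by move=> _; rewrite lee_fin expR_ge0.
transitivity (\int[mu]_x (((Zpi mu U)^-1)%:E * (expR (- U (x : 'rV[R]_d)))%:E))%E.
  by apply: eq_integral => x _; rewrite -EFinM mulrC.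
apply: (etrans (ge0_integralZl mu measurableT mE e0 z0)).
rewrite -[X in (_ * X)%E]fineK; last first.
  rewrite ge0_fin_numE; first exact: le_lt_trans integral_gibbs_le integral_lyap_gibbs_lty.
  exact: integral_ge0.
by rewrite -/(Zpi mu U) -EFinM mulVf // gt_eqF.
Qed.

Lemma integrable_lyap_pidens : mu.-integrable setT (EFin \o (fun x : E => W x * pidens mu U x)).
Proof.
have i1 : mu.-integrable setT (EFin \o (fun x : E => W x * expR (- U x))).
  apply/integrableP; split.
    apply/measurable_EFinP; apply: measurable_funM; [exact: measurable_lyap|exact: measurable_gibbs].
  apply: le_lt_trans integral_lyap_gibbs_lty; rewrite le_eqVlt; apply/orP; left; apply/eqP.
  by apply: eq_integral => x _; rewrite /= (ger0_norm (lyap_gibbs_ge0 x)).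
apply: eq_integrable (integrableZl measurableT (Zpi mu U)^-1 i1) => // x _.
by rewrite /= -EFinM /pidens mulrCA (mulrC _^-1).
Qed.

End gibbs.

Transparent gint gexp.

(** * Integrals with a parameter and antisymmetric integrands *)

Section parametric_integral.
Context {R : realType} {d : nat}.
Variables (mu : {measure set Rd R d -> \bar R}) (Hmu : is_lebesgue mu).
Local Notation E := (Rd_measurableType R d).

Lemma measurable_Rintegral_param {d'} {T : measurableType d'} (h : T * E -> R) :
  measurable_fun setT h ->
  measurable_fun setT (fun t => Rintegral mu setT (fun u : Rd R d => h (t, u))).
Proof.
move=> mh; apply: measurableT_comp => //.
have mH : measurable_fun setT (EFin \o h) by exact/measurable_EFinP.
rewrite (_ : (fun t => _) =
  (fun t => (\int[mu]_u (EFin \o h)^\+ (t, u) - \int[mu]_u (EFin \o h)^\- (t, u))%E)).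
  apply: emeasurable_funB; apply: (lebesgue_measurable_fubini_F mu Hmu) => //.
    exact: measurable_funepos.
  exact: measurable_funeneg.
apply: funext => t; rewrite [LHS]integralE; congr (_ - _)%E; apply: eq_integral => u _.
  by rewrite !funeposE.
by rewrite !funenegE.
Qed.

Lemma gint_EFin (g : R) a (f : 'rV[R]_d -> R) : gint mu g a f ->
  (\int[mu]_u (f u * gdens g a u)%:E = (gexp mu g a f)%:E)%E.
Proof. by move=> [mf i_f]; rewrite fineK //; exact: integrable_fin_num i_f. Qed.

(** Exchanging the integrals and using antisymmetry shows that the integral of [G] is its own
    opposite. *)
Lemma integral_antisym (J : E * E -> R) (G : E -> R) :
  measurable_fun setT J ->
  (\int[mu]_x \int[mu]_y `|(J (x, y))%:E| < +oo)%E ->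
  (forall x y, J (y, x) = - J (x, y)) ->
  (forall x, \int[mu]_y (J (x, y))%:E = (G x)%:E)%E ->
  mu.-integrable setT (EFin \o G) /\ Rintegral mu setT G = 0.
Proof.
move=> mJ iJ aJ GE.
pose m := lebesgue_sfm mu Hmu.
have mE : measurable_fun setT (EFin \o J) by exact/measurable_EFinP.
have iE : (m \x m)%E.-integrable setT (EFin \o J).
  exact/(integrable12ltyP m m mE).
have FE : fubini_F m (EFin \o J) = EFin \o G.
  by apply: funext => x; rewrite /fubini_F /= GE.
have iG : mu.-integrable setT (EFin \o G).
  by have := integrable_fubini_F iE; rewrite FE.
split=> //.
have H : (\int[mu]_x (G x)%:E = \int[mu]_y (- G y)%:E)%E.
  transitivity (\int[mu]_x \int[mu]_y (J (x, y))%:E)%E.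
    by apply: eq_integral => x _; rewrite GE.
  apply: (etrans (Fubini iE)); apply: eq_integral => y _.
  transitivity (\int[mu]_x (- (J (y, x))%:E))%E.
    by apply: eq_integral => x _; rewrite /= aJ.
  have fG : (\int[mu]_x (J (y, x))%:E)%E \is a fin_num by rewrite GE.
  rewrite integralN ?GE //; apply: fin_num_adde_defl; rewrite fin_numN.
  by rewrite integralE fin_numB in fG; case/andP: fG.
have : Rintegral mu setT G = - Rintegral mu setT G.
  rewrite -[RHS]mulN1r -(RintegralZl _ measurableT iG) /Rintegral H; congr fine.
  by apply: eq_integral => x _; rewrite mulN1r.
lra.
Qed.

End parametric_integral.

(** * Detailed balance, invariance and iteration of the kernel *)

Section mala_kernel.
Context {R : realType} {d : nat}.
Variables (mu : {measure set Rd R d -> \bar R}) (Hmu : is_lebesgue mu).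
Variables (U : 'rV[R]_d -> R) (gradU : 'rV[R]_d -> 'rV[R]_d) (eta lam ep c B g : R).
Local Notation E := (Rd_measurableType R d).
Local Notation rej := (reject U gradU).
Local Notation W := (lyap eta).
Local Notation am := (prop_mean gradU).
Local Notation pid := (pidens mu U).
Local Notation rop := (kernel_op mu U gradU g).
Hypotheses (mU : measurable_fun setT (U : E -> R))
  (mG : measurable_fun setT (gradU : E -> Rd R d))
  (eta0 : 0 < eta) (g0 : 0 < g) (lam0 : 0 < lam) (ep0 : 0 < ep) (cg1 : c * g < 1)
  (Z0 : 0 < Zpi mu U)
  (int_pi : (\int[mu]_x (pid (x : 'rV[R]_d))%:E = 1)%E)
  (int_W : mu.-integrable setT (EFin \o (fun x : E => W x * pid x)))
  (ints : forall x, [/\ gint mu g (am g x) W, gexp mu g (am g x) W <= B * W x,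
        gint mu g (am g x) (rej g x) &
        gint mu g (am g x) (fun y => (W x + W y) * rej g x y)])
  (contr : forall f : 'rV[R]_d -> R, measurable_fun setT (f : E -> R) ->
      (forall x y : 'rV[R]_d, x != y -> `|f x - f y| <= wdist eta lam ep x y) ->
      forall x y : 'rV[R]_d, x != y -> `|rop f x - rop f y| <= (1 - c * g) * wdist eta lam ep x y).

Let pid_gt0 x : 0 < pid x. Proof. by rewrite divr_gt0 ?expR_gt0. Qed.

Lemma measurable_prop_mean {d'} {T : measurableType d'} (f : T -> 'rV[R]_d) :
  measurable_fun setT (f : T -> Rd R d) ->
  measurable_fun setT ((fun t => am g (f t)) : T -> Rd R d).
Proof.
move=> mf; apply: measurable_subRd => //.
by apply: (measurable_scaleRd (cst g)) => //; exact: (measurableT_comp mG mf).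
Qed.

Lemma measurable_rop (f : 'rV[R]_d -> R) : measurable_fun setT (f : E -> R) ->
  measurable_fun setT (rop f : E -> R).
Proof.
move=> mf.
have m1 : measurable_fun setT ((fun p => p.1) : E * E -> Rd R d) by exact: measurable_fst.
have m2 : measurable_fun setT ((fun p => p.2) : E * E -> Rd R d) by exact: measurable_snd.
have mg : measurable_fun setT (fun p : E * E => gdens g (am g p.1) p.2).
  by apply: measurable_gdens => //; exact: measurable_prop_mean.
have f1 : measurable_fun setT ((fun p => f p.1) : E * E -> R) by exact: (measurableT_comp mf m1).
have f2 : measurable_fun setT ((fun p => f p.2) : E * E -> R) by exact: (measurableT_comp mf m2).
apply: measurable_funD.
  apply: (measurable_Rintegral_param mu Hmu (fun p : E * E => f p.2 * gdens g (am g p.1) p.2)).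
  exact: measurable_funM.
apply: (measurable_Rintegral_param mu Hmu (fun p : E * E => (f p.1 - f p.2) * rej g p.1 p.2 * gdens g (am g p.1) p.2)).
apply: measurable_funM => //; apply: measurable_funM; first exact: measurable_funB.
exact: measurable_rej.
Qed.

Definition osc_class (K : R) (f : 'rV[R]_d -> R) : Prop :=
  measurable_fun setT (f : E -> R) /\
  forall x y, x != y -> `|f x - f y| <= K * wdist eta lam ep x y.

Lemma osc_class_gint (K : R) (f : 'rV[R]_d -> R) x : 0 < K -> osc_class K f ->
  gint mu g (am g x) f /\ gint mu g (am g x) (fun y => (f x - f y) * rej g x y).
Proof.
move=> K0 [mf H]; have [iW _ ir iwr] := ints x.
split; first exact: (gint_osc _ Hmu _ _ lam ep K _ _ g0 (ltW ep0) (ltW K0) mf iW H).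
have mf' : measurable_fun setT ((fun y => K^-1 * f y) : E -> R) by exact: measurable_funM.
have H' u v : u != v -> `|K^-1 * f u - K^-1 * f v| <= wdist eta lam ep u v.
  move=> uv; rewrite -mulrBr normrM gtr0_norm ?invr_gt0 // mulrC ler_pdivrMr // mulrC.
  exact: H.
have [i1 _] := reject_term_le mu U gradU eta mU mG g lam ep (fun y => K^-1 * f y) x (ltW ep0) mf' ir iwr H'.
have := gintZ mu g (am g x) K _ i1; congr gint; apply: funext => y.
by rewrite -mulrBr !mulrA divff ?mul1r // gt_eqF.
Qed.

(** [contr] is stated for constant 1; the general case follows by applying it to [K^-1 * f], since
    the operator is homogeneous. *)
Lemma osc_class_rop (K : R) (f : 'rV[R]_d -> R) : 0 < K -> osc_class K f ->
  osc_class (K * (1 - c * g)) (rop f).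
Proof.
move=> K0 fK; have [mf H] := fK; split; first exact: measurable_rop.
move=> x y xy.
have mf' : measurable_fun setT ((fun y => K^-1 * f y) : E -> R) by exact: measurable_funM.
have H' u v : u != v -> `|K^-1 * f u - K^-1 * f v| <= wdist eta lam ep u v.
  move=> uv; rewrite -mulrBr normrM gtr0_norm ?invr_gt0 // mulrC ler_pdivrMr // mulrC.
  exact: H.
have E1 z : rop (fun y => K^-1 * f y) z = K^-1 * rop f z.
  have [i1 i2] := osc_class_gint K f z K0 fK.
  rewrite /kernel_op (gexpZ _ _ _ _ _ i1).
  rewrite (_ : (fun y => (K^-1 * f z - K^-1 * f y) * rej g z y) = (fun y => K^-1 * ((f z - f y) * rej g z y))).
    by rewrite (gexpZ _ _ _ _ _ i2) mulrDr.
  by apply: funext => u; rewrite -mulrBr mulrA.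
have := contr _ mf' H' x y xy; rewrite !E1 -mulrBr normrM gtr0_norm ?invr_gt0 //.
by rewrite mulrC ler_pdivrMr // mulrC mulrA.
Qed.

Lemma lograt_opp x y : lograt U gradU g y x = - lograt U gradU g x y.
Proof. by rewrite /lograt; ring. Qed.

Lemma rejE x y : 1 - rej g x y = Num.min 1 (expR (lograt U gradU g x y)).
Proof. by rewrite /reject subKr. Qed.

Lemma gdensE x y : gdens g (am g x) y = r_prop gradU g x y.
Proof. by rewrite /gdens /r_prop /prop_mean opprB addrA addrAC. Qed.

Lemma gibbs_proposal x y : pid y * gdens g (am g y) x =
  expR (lograt U gradU g x y) * (pid x * gdens g (am g x) y).
Proof.
rewrite /pidens !gdensE /r_prop /lograt.
set p := powR _ _; set z := Zpi mu U.
set a := enorm (x - y + _) ^+ 2; set b := enorm (y - x + _) ^+ 2.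
have -> : expR (- U y) / z * (p * expR (- a / (4 * g))) = expR (- U y + - a / (4 * g)) * (p / z).
  by rewrite expRD; ring.
have -> : expR (- U x) / z * (p * expR (- b / (4 * g))) = expR (- U x + - b / (4 * g)) * (p / z).
  by rewrite expRD; ring.
rewrite [RHS]mulrA -expRD; congr (expR _ * _).
by rewrite mulrBl; ring.
Qed.

(** With [A] the left density without acceptance and [l] the log ratio, both sides are the minimum
    of [A] and [expR l * A]. *)
Lemma detailed_balance x y :
  pid x * gdens g (am g x) y * (1 - rej g x y) = pid y * gdens g (am g y) x * (1 - rej g y x).
Proof.
rewrite [in LHS](rejE x y) [in RHS](rejE y x) (lograt_opp x y) (gibbs_proposal x y).
set A := pid x * gdens g (am g x) y; set l := lograt U gradU g x y.
have A0 : 0 <= A by rewrite mulr_ge0 ?gdens_ge0 // ltW.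
have e0 : 0 <= expR l * A by rewrite mulr_ge0 ?expR_ge0.
rewrite (minr_pMr 1 (expR l) A0) (minr_pMr 1 (expR (- l)) e0) !mulr1 [RHS]minC.
by rewrite [expR l * A * _]mulrAC -expRD subrr expR0 mul1r (mulrC A).
Qed.

Lemma alphaE x y : alpha_acc mu U gradU g x y = 1 - rej g x y.
Proof.
have A0 : 0 < pid x * r_prop gradU g x y.
  by rewrite mulr_gt0 // mulr_gt0 ?expR_gt0 // powR_gt0 // !mulr_gt0 // pi_gt0.
rewrite rejE /alpha_acc; congr Num.min.
by rewrite -(gdensE y) gibbs_proposal gdensE mulfK // gt_eqF.
Qed.

(** Rests on [f y * (1 - r) + f x * r = f y + (f x - f y) * r], integrated in [y]; the integrals are
    separated because each of them converges. *)
Lemma mala_opE (K : R) (f : 'rV[R]_d -> R) x : 0 < K -> osc_class K f ->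
  mala_op mu U gradU g f x = rop f x.
Proof.
move=> K0 fK; have [mf H] := fK.
have [i1 i2] := osc_class_gint K f x K0 fK; have [_ _ ir _] := ints x.
have E1 : Rintegral mu setT (fun y : Rd R d => f y * alpha_acc mu U gradU g x y * r_prop gradU g x y) =
    gexp mu g (am g x) (fun y => f y + ((f x - f y) * rej g x y - f x * rej g x y)).
  apply: eq_Rintegral => y _; rewrite alphaE -gdensE; congr (_ * _); ring.
have E2 : Rintegral mu setT (fun y : Rd R d => (1 - alpha_acc mu U gradU g x y) * r_prop gradU g x y) =
    gexp mu g (am g x) (rej g x).
  by apply: eq_Rintegral => y _; rewrite alphaE -gdensE subKr.
rewrite /mala_op E1 E2.
have i3 := gintZ _ _ _ (f x) _ ir.
rewrite (gexpD _ _ _ _ _ i1 (gintB _ _ _ _ _ i2 i3)) (gexpB _ _ _ _ _ i2 i3) (gexpZ _ _ _ _ _ ir) /kernel_op.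
by rewrite -addrA subrK.
Qed.

Lemma osc_class_pi_integrable (K : R) (f : 'rV[R]_d -> R) : 0 < K -> osc_class K f ->
  mu.-integrable setT (EFin \o (fun x : E => f x * pid x)).
Proof.
move=> K0 [mf H]; pose A : R := `|f 0| + K * (2 + ep * (W (0 : 'rV[R]_d) + 1)).
have iA := integrableZl measurableT A int_W.
apply: (le_integrable measurableT _ _ iA).
  by apply/measurable_EFinP; apply: measurable_funM => //; exact: measurable_pidens.
move=> x _; rewrite /= lee_fin (mulrA A (W x) (pid x)) (normrM (f x) (pid x)) (normrM (A * W x) (pid x)) (gtr0_norm (pid_gt0 x)) (ler_pM2r (pid_gt0 x)).
have W1 := lyap_ge1 eta eta0 x.
apply: (@le_trans _ _ (A * W x)); last exact: ler_norm.
have h1 := osc_le eta lam ep K f x 0 (ltW ep0) (ltW K0) H.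
have h2 := ler_normD (f x - f 0) (f 0); rewrite subrK in h2.
have h3 : `|f 0| + K * (2 + ep * (W x + W (0 : 'rV[R]_d))) <= A * W x.
  rewrite /A mulrDl -mulrA; apply: lerD; first by rewrite ler_peMr.
  rewrite ler_pM2l // mulrDl; apply: lerD; first by rewrite ler_peMr.
  rewrite -mulrA ler_pM2l // mulrDl mul1r addrC lerD2r ler_peMr //.
  exact: lyap_ge0.
apply: (le_trans h2); apply: le_trans h3; rewrite addrC lerD2l.
exact: h1.
Qed.

(** Its integral in the second variable is [(rop f x - f x) * pid x], so invariance of [pi] says
    that its double integral vanishes. *)
Definition flow (f : 'rV[R]_d -> R) (p : E * E) : R :=
  pid p.1 * ((f p.2 - f p.1) * (1 - rej g p.1 p.2)) * gdens g (am g p.1) p.2.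

Lemma flow_antisym f x y : flow f (y, x) = - flow f (x, y).
Proof.
rewrite /flow /= [LHS](_ : _ = (f x - f y) * (pid y * gdens g (am g y) x * (1 - rej g y x))).
  by rewrite -(detailed_balance x y); ring.
by ring.
Qed.

Lemma measurable_flow (f : 'rV[R]_d -> R) : measurable_fun setT (f : E -> R) ->
  measurable_fun setT (flow f).
Proof.
move=> mf.
have m1 : measurable_fun setT ((fun p => p.1) : E * E -> Rd R d) by exact: measurable_fst.
have m2 : measurable_fun setT ((fun p => p.2) : E * E -> Rd R d) by exact: measurable_snd.
have mg : measurable_fun setT (fun p : E * E => gdens g (am g p.1) p.2).
  by apply: measurable_gdens => //; exact: measurable_prop_mean.
have f1 : measurable_fun setT ((fun p => f p.1) : E * E -> R) by exact: (measurableT_comp mf m1).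
have f2 : measurable_fun setT ((fun p => f p.2) : E * E -> R) by exact: (measurableT_comp mf m2).
have p1 : measurable_fun setT ((fun p => pid p.1) : E * E -> R).
  by exact: (measurableT_comp (measurable_pidens mu U mU) m1).
apply: measurable_funM => //; apply: measurable_funM => //; apply: measurable_funM.
  exact: measurable_funB.
by apply: measurable_funB => //; exact: measurable_rej.
Qed.

Lemma gexp_flow (K : R) (f : 'rV[R]_d -> R) x : 0 < K -> osc_class K f ->
  gint mu g (am g x) (fun y => pid x * ((f y - f x) * (1 - rej g x y))) /\
  gexp mu g (am g x) (fun y => pid x * ((f y - f x) * (1 - rej g x y))) = (rop f x - f x) * pid x.
Proof.
move=> K0 fK; have [i1 i2] := osc_class_gint K f x K0 fK.
have [i3 e3] := gexp_cst mu Hmu g (am g x) (- f x) g0.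
have i4 := gintD _ _ _ _ _ i1 (gintD _ _ _ _ _ i2 i3).
have E1 : (fun y => pid x * ((f y - f x) * (1 - rej g x y))) =
    (fun y => pid x * (f y + ((f x - f y) * rej g x y + - f x))).
  by apply: funext => y; ring.
rewrite E1; split; first exact: gintZ.
rewrite (gexpZ _ _ _ _ _ i4) (gexpD _ _ _ _ _ i1 (gintD _ _ _ _ _ i2 i3)) (gexpD _ _ _ _ _ i2 i3) e3.
by rewrite /kernel_op addrA mulrC.
Qed.

(** The mean of [W] under the proposal is at most [B * W x], so the inner integral is at most a
    constant times [W x * pid x], which is integrable. *)
Lemma integral_flow_lty (K : R) (f : 'rV[R]_d -> R) : 0 < K -> osc_class K f ->
  (\int[mu]_x \int[mu]_y `|(flow f (x, y))%:E| < +oo)%E.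
Proof.
move=> K0 fK; have [mf H] := fK; pose A := K * (2 + ep * (1 + B)).
have mJ : measurable_fun setT (fun p : E * E => `|(flow f p)%:E|)%E.
  by apply: measurableT_comp => //; apply/measurable_EFinP; exact: measurable_flow.
have iA := integrableZl measurableT A int_W.
refine (le_lt_trans _ (integrable_lty measurableT iA)).
apply: ge0_le_integral; [exact: measurableT| | | |].
- by move=> x _; exact: integral_ge0.
- exact: (lebesgue_measurable_fubini_F mu Hmu (fun p : E * E => `|(flow f p)%:E|%E)).
- exact: measurable_int iA.
move=> x _ /=; have [iW hW _ _] := ints x.
have [i1 _] := gexp_cst mu Hmu g (am g x) (pid x * (K * (2 + ep * W x))) g0.
have i2 := gintZ _ _ _ (pid x * (K * ep)) _ iW.
pose h (y : 'rV[R]_d) := pid x * (K * (2 + ep * W x)) + pid x * (K * ep) * W y.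
have ih : gint mu g (am g x) h by exact: (gintD _ _ _ _ _ i1 i2).
apply: (@le_trans _ _ (\int[mu]_y (h y * gdens g (am g x) y)%:E)%E).
  apply: ge0_le_integral; [exact: measurableT| | | |].
  - by move=> y _; rewrite lee_fin normr_ge0.
  - exact: (measurableT_comp mJ (pair1_measurable x)).
  - by case: ih => mh ih; exact: measurable_int ih.
  move=> y _; rewrite /flow /= lee_fin normrM (ger0_norm (gdens_ge0 _ _ _)) ler_wpM2r ?gdens_ge0 //.
  rewrite normrM (gtr0_norm (pid_gt0 x)) normrM /h -mulrA -mulrDr ler_pM2l //.
  have r0 := rej_ge0 U gradU g x y; have r1 := rej_le1 U gradU g x y.
  rewrite (ger0_norm (_ : 0 <= 1 - rej g x y)); last by rewrite subr_ge0.
  have h1 := osc_le eta lam ep K f y x (ltW ep0) (ltW K0) H.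
  apply: (@le_trans _ _ `|f y - f x|); first by rewrite ler_piMr // gerBl.
  apply: (le_trans h1); rewrite le_eqVlt; apply/orP; left; apply/eqP; ring.
rewrite (gint_EFin mu g _ _ ih) lee_fin /h.
rewrite (gexpD _ _ _ _ _ i1 i2) (gexpZ _ _ _ _ _ iW) (gexp_cst mu Hmu g (am g x) _ g0).2.
have W1 := lyap_ge1 eta eta0 x.
rewrite [leRHS](_ : _ = pid x * (K * (2 * W x + ep * W x + ep * (B * W x)))); last by rewrite /A; ring.
rewrite -mulrA -mulrDr ler_pM2l // -(mulrA K) -mulrDr ler_pM2l //.
apply: lerD; last by rewrite ler_pM2l.
by rewrite lerD2r ler_peMr.
Qed.

Lemma pi_invariant (K : R) (f : 'rV[R]_d -> R) : 0 < K -> osc_class K f ->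
  fine (pi_int mu U (rop f)) = fine (pi_int mu U f).
Proof.
move=> K0 fK; have [mf _] := fK.
have GE x : (\int[mu]_y (flow f (x, y))%:E)%E = ((rop f x - f x) * pid x)%:E.
  by have [i1 e1] := gexp_flow K f x K0 fK; rewrite (gint_EFin mu g _ _ i1) e1.
have [iG G0] := integral_antisym mu Hmu (flow f) (fun x => (rop f x - f x) * pid x)
   (measurable_flow f mf) (integral_flow_lty K f K0 fK) (flow_antisym f) GE.
have i_f := osc_class_pi_integrable K f K0 fK.
transitivity (Rintegral mu setT (fun x : Rd R d => f x * pid x + (rop f x - f x) * pid x)).
  by apply: eq_Rintegral => x _; ring.
by rewrite (RintegralD measurableT i_f iG) G0 addr0.
Qed.

Lemma osc_class_pi_dev (K : R) (f : 'rV[R]_d -> R) x : 0 < K -> osc_class K f ->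
  `|f x - fine (pi_int mu U f)| <= K * (2 + ep * (W x + fine (pi_int mu U W))).
Proof.
move=> K0 fK; have [mf H] := fK.
have i_f := osc_class_pi_integrable K f K0 fK.
have ipid : mu.-integrable setT (EFin \o (pid : E -> R)).
  apply/integrableP; split; first by apply/measurable_EFinP; exact: measurable_pidens.
  rewrite (_ : (\int[mu]_x _ = 1)%E) ?ltry // -int_pi.
  by apply: eq_integral => y _; rewrite /= (gtr0_norm (pid_gt0 y)).
have R1 : Rintegral mu setT (pid : Rd R d -> R) = 1 by rewrite /Rintegral int_pi.
have i1 (k : R) := integrableZl measurableT k ipid.
have E1 (k : R) : Rintegral mu setT (fun y : Rd R d => k * pid y) = k.
  by rewrite (RintegralZl k measurableT ipid) R1 mulr1.
rewrite -[in leLHS](E1 (f x)) -(RintegralB measurableT (i1 (f x)) i_f).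
have iD := integrableB measurableT (i1 (f x)) i_f.
apply: (le_trans (le_normr_Rintegral measurableT iD)).
pose h (y : E) := (K * (2 + ep * W x)) * pid y + K * ep * (W y * pid y).
have i2 := integrableZl measurableT (K * ep) int_W.
apply: (@le_trans _ _ (Rintegral mu setT h)).
  apply: le_Rintegral => //.
  - exact: integrable_norm.
  - exact: integrableD (i1 _) i2.
  move=> y _; rewrite -mulrBl normrM (gtr0_norm (pid_gt0 y)) /h (mulrA (K * ep)) -mulrDl (ler_pM2r (pid_gt0 y)).
  have := osc_le eta lam ep K f x y (ltW ep0) (ltW K0) H; lra.
rewrite /h (RintegralD measurableT (i1 _) i2) E1 (RintegralZl (K * ep) measurableT int_W).
rewrite le_eqVlt; apply/orP; left; apply/eqP; rewrite /pi_int /Rintegral; ring.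
Qed.

Lemma osc_class_iter (K : R) (f : 'rV[R]_d -> R) k : 0 < K -> osc_class K f ->
  osc_class (K * (1 - c * g) ^+ k) (iter k (mala_op mu U gradU g) f) /\
  fine (pi_int mu U (iter k (mala_op mu U gradU g) f)) = fine (pi_int mu U f).
Proof.
move=> K0 fK; elim: k => [|k [Ck Ik]]; first by rewrite expr0 mulr1.
have Kk : 0 < K * (1 - c * g) ^+ k by rewrite mulr_gt0 // exprn_gt0 // subr_gt0.
rewrite iterS (_ : mala_op _ _ _ _ _ = rop (iter k (mala_op mu U gradU g) f)); last first.
  by apply: funext => x; exact: mala_opE Kk Ck.
split; last by rewrite (pi_invariant _ _ Kk Ck).
by rewrite exprSr mulrA; exact: osc_class_rop.
Qed.

Lemma mala_dev (f : 'rV[R]_d -> R) k x : measurable_fun setT (f : E -> R) ->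
  (forall z, `|f z| <= W z) ->
  `|iter k (mala_op mu U gradU g) f x - fine (pi_int mu U f)| <=
    (2 + ep) / ep * powR (expR (- c)) (g * k%:R) * (W x + fine (pi_int mu U W)).
Proof.
move=> mf fW; have e1 : 0 < ep^-1 by rewrite invr_gt0.
have W1 := lyap_ge1 eta eta0 x.
have f1 : osc_class ep^-1 f.
  (* The weight part alone suffices: [|f u - f v| <= W u + W v], and the profile part is
     nonnegative. *)
  split=> // u v uv; apply: (le_trans (ler_normB _ _)); apply: (le_trans (lerD (fW u) (fW v))).
  rewrite mulrC ler_pdivlMr // mulrC /wdist lerDr.
  have : expR (- lam * enorm (u - v)) <= 1.
    by rewrite -expR0 ler_expR mulNr oppr_le0 mulr_ge0 ?enorm_ge0 // ltW.
  lra.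
have [Ck <-] := osc_class_iter ep^-1 f k e1 f1.
have Kk : 0 < ep^-1 * (1 - c * g) ^+ k by rewrite mulr_gt0 // exprn_gt0 // subr_gt0.
apply: (le_trans (osc_class_pi_dev _ _ x Kk Ck)).
have p0 : 0 <= fine (pi_int mu U W).
  by apply: Rintegral_ge0 => y _; rewrite mulr_ge0 ?lyap_ge0 // ltW.
have hk : (1 - c * g) ^+ k <= powR (expR (- c)) (g * k%:R).
  rewrite -expRM (_ : - c * (g * k%:R) = k%:R * - (c * g)); last by ring.
  rewrite expRM_natl.
  apply: lerXn2r; rewrite ?nnegrE ?expR_ge0 //; first by rewrite subr_ge0 ltW.
  exact: expR_ge1Dx.
set p := fine _ in p0 *; set w := W x in W1 *.
(* Uses [1 <= W x] to turn the constant 2 into a multiple of [W x]; together with [ep^-1] this gives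
   the factor [(2 + ep) / ep]. *)
have h1 : 2 + ep * (w + p) <= (2 + ep) * (w + p) by lra.
rewrite [leRHS](_ : _ = ep^-1 * powR (expR (- c)) (g * k%:R) * ((2 + ep) * (w + p))); last by ring.
apply: ler_pM => //; first exact: ltW.
  by rewrite addr_ge0 // mulr_ge0 ?(ltW ep0) // addr_ge0 // (le_trans _ W1).
by rewrite ler_pM2l.
Qed.

End mala_kernel.

Theorem theorem5 (R : realType) (d : nat)
  (mu : {measure set Rd R d -> \bar R}) (Hmu : is_lebesgue mu)
  (beta : R) (Hbeta : 0 <= beta < 1)
  (U : 'rV[R]_d -> R) (gradU : 'rV[R]_d -> 'rV[R]_d)
  (hessU : 'rV[R]_d -> 'M[R]_d) (D3U : 'rV[R]_d -> 'rV[R]_d -> 'M[R]_d)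
  (L M m_beta L_beta K_beta : R)
  (HD1 : forall x : 'rV[R]_d, is_diff x U (fun h => dotR (gradU x) h))
  (HD2 : forall x : 'rV[R]_d, is_diff x gradU (fun h => h *m hessU x))
  (HD3 : forall x : 'rV[R]_d, is_diff x hessU (D3U x))
  (HD3c : forall h : 'rV[R]_d, continuous (fun x => D3U x h))
  (Hgrad0 : gradU 0 = 0)
  (HL : 0 <= L)
  (Hhess : forall x y z, `|bilin (hessU x) y z| <= L * enorm y * enorm z)
  (HM : 0 <= M)
  (HD3b : forall x h y z, `|bilin (D3U x h) y z| <= M * enorm h * enorm y * enorm z)
  (Hmb : 0 < m_beta) (HLb : 0 <= L_beta) (HKb : 0 <= K_beta)
  (Hcurv : forall x y : 'rV[R]_d, K_beta <= enorm x -> enorm y = 1 ->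
      bilin (hessU x) y y <= L_beta / (1 + powR (enorm x) (3 * beta / 4)) /\
      m_beta / (1 + powR (enorm x) beta) <= bilin (hessU x) y y) :
  let eta := m_beta / 2 ^+ 5 in
  let W := fun x : 'rV[R]_d => expR (eta * Num.sqrt (1 + enorm x ^+ 2)) in
  exists Gam A : R, 0 < Gam /\ 0 < A /\ (pi_int mu U W <= A%:E)%E /\
    forall gbar : R, 0 < gbar <= Gam ->
      exists C rho : R, 0 <= C /\ 0 <= rho < 1 /\
        forall (x : 'rV[R]_d) (gamma : R) (k : nat), 0 < gamma <= gbar ->
          (Vdist mu U gradU W gamma k x
             <= (C * powR rho (gamma * k%:R))%:E * ((W x)%:E + pi_int mu U W))%E.
Proof.
move=> eta W.
have eta0 : 0 < eta by rewrite divr_gt0 // exprn_gt0.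
have mU : measurable_fun setT (U : Rd_measurableType R d -> R).
  apply: continuous_measurable_Rd => x; apply: differentiable_continuous.
  by case: (HD1 x).
have mG : measurable_fun setT (gradU : Rd_measurableType R d -> Rd R d).
  apply: measurable_fun_Rd => i.
  apply: (continuous_measurable_Rd (fun x => gradU x ord0 i)) => x.
  apply: (@continuous_comp _ _ _ gradU (fun v : 'rV[R]_d => v ord0 i)); last exact: coord_continuous.
  by apply: differentiable_continuous; case: (HD2 x).
have U_line := is_derive_U U gradU HD1.
have glip : forall x v, enorm (gradU (x + v) - gradU x) <= L * enorm v.
  exact: (grad_lip gradU hessU L HD2 HL Hhess).
have gle : forall x, enorm (gradU x) <= L * enorm x.
  exact: (grad_le gradU hessU L HD2 Hgrad0 HL Hhess).
have growth : forall B : R, exists2 K, 1 <= K & forall x, K <= enorm x -> B * enorm x <= dotR (gradU x) x.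
  exact: (grad_growth gradU hessU L HD2 Hgrad0 HL Hhess beta m_beta L_beta K_beta Hbeta Hmb HKb Hcurv).
have coco : exists C K : R, [/\ 0 < C, 1 <= K & forall x, K <= enorm x ->
    enorm (gradU x) ^+ 2 <= C * dotR (gradU x) x].
  exact: (grad_cocoercive U gradU hessU D3U L M HD1 HD2 HD3 Hgrad0 HL Hhess HM HD3b beta m_beta L_beta K_beta Hbeta Hmb HKb Hcurv).
have near : exists2 C : R, 0 < C & forall (g : R) x y, 0 < g <= 1 ->
    reject U gradU g x y <= C * (g * Num.sqrt g) * (1 + enorm x) ^+ 3 *
      expR (enorm (y - (x - g *: gradU x)) ^+ 2 / (16 * g)).
  exact: (rej_near U gradU hessU D3U L M HD1 HD2 HD3 Hgrad0 HL Hhess HM HD3b).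
have far : exists C K g0 : R, [/\ 0 < C, 1 <= K, 0 < g0 &
    forall (g : R) x y, 0 < g <= g0 -> K <= enorm x ->
      reject U gradU g x y <= C * enorm (y - (x - g *: gradU x)) ^+ 2].
  exact: (rej_far U gradU hessU D3U L M HD1 HD2 HD3 Hgrad0 HL Hhess HM HD3b beta m_beta L_beta K_beta Hbeta Hmb HLb HKb Hcurv).
have hdrift := drift mu Hmu U gradU L eta mU mG eta0 HL gle growth coco near far.
have hrprob := rprob_le mu Hmu U gradU eta mU mG eta0 near.
have [lam [ep [c [g0 [B [lam0 ep0 c0 g00 Hc]]]]]] :=
  kernel_contraction mu Hmu U gradU L eta mU mG eta0 HL glip hrprob hdrift.
have Z0 := Zpi_gt0 mu Hmu U gradU L eta mU eta0 HL U_line gle growth.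
have ipi := integral_pidens mu Hmu U gradU L eta mU eta0 HL U_line gle growth.
have iW := integrable_lyap_pidens mu Hmu U gradU L eta mU eta0 HL U_line gle growth.
have piE : pi_int mu U W = (fine (pi_int mu U W))%:E.
  by rewrite fineK //; exact: integrable_fin_num iW.
set p := fine (pi_int mu U W) in piE.
have p0 : 0 <= p.
  apply: Rintegral_ge0 => y _; apply: mulr_ge0; first exact: expR_ge0.
  by rewrite /pidens divr_ge0 ?expR_ge0 // ltW.
(* The added 1 makes the bound on [pi_int mu U W] strictly positive. The constants chosen next are
   the same for every [gbar] below [g0]. *)
exists g0, (p + 1); split=> //; split; first by rewrite ltr_wpDl.
split; first by rewrite piE lee_fin lerDl.
move=> gbar /andP[gb0 gbg]; exists ((2 + ep) / ep), (expR (- c)).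
have e2 : 0 <= (2 + ep) / ep by rewrite divr_ge0 ?addr_ge0 // ltW.
split=> //; split; first by rewrite expR_ge0 expR_lt1 oppr_lt0.
move=> x g k /andP[gp gg]; rewrite piE -EFinD -EFinM.
have gg0 : 0 < g <= g0 by rewrite gp (le_trans gg).
have [cg ints contr] := Hc g gg0.
apply: ge_ereal_sup => _ [f [mf fW] <-]; rewrite lee_fin.
exact: (mala_dev mu Hmu U gradU eta lam ep c B g mU mG eta0 gp lam0 ep0 cg Z0 ipi iW ints contr f k x mf fW).
Qed.
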